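(* Let $H$ be a quasitriangular Hopf algebra over a field $\Bbbk$ with universal R-matrix $R$, and let $C,B$ be weakly dual Hopf algebras in $H\text{-}\mathbf{Mod}$. Given $\sigma\in C^2_H(B,\Bbbk)$ and $\tau\in C^2_H({}^{\mathrm{cop}}C,\Bbbk)$, there is a right $2$-cocycle $\sigma\circ\tau\in C^2(\mathrm{Drin}_H(C,B),\Bbbk)$ with $$\sigma\circ\tau(b,b')=\sigma(b,b'),\qquad \sigma\circ\tau(c,c')=\tau(c,c'),\qquad \sigma\circ\tau(h,h')=\varepsilon(hh'),$$ given for all $b,b'\in B$, $h,h'\in H$, $c,c'\in C$ by $$\sigma\circ\tau(bhc,b'h'c')=\sigma\big(b,hR^{-(1)}\triangleright b'_{(2)}\big)\,\mathrm{ev}(c_{(2)},b'_{(1)})\,\tau\big(R^{-(2)}\triangleright c_{(1)},h'\triangleright c'\big).$$ This construction commutes with coboundaries: if $\sigma\sim\sigma'$ in $C^2_H(B,\Bbbk)$ and $\tau\sim\tau'$ in $C^2_H({}^{\mathrm{cop}}C,\Bbbk)$, then $\sigma\circ\tau\sim\sigma'\circ\tau'$ in $C^2(\mathrm{Drin}_H(C,B),\Bbbk)$, so that it induces a map $H^2_H(B,\Bbbk)\times H^2_H({}^{\mathrm{cop}}C,\Bbbk)\to H^2(\mathrm{Drin}_H(C,B),\Bbbk)$.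
   Context: Conventions: Sweedler notation with implicit sums; $R=R^{(1)}\otimes R^{(2)}\in H\otimes H$ is the universal R-matrix, with inverse $R^{-1}=R^{-(1)}\otimes R^{-(2)}$, satisfying ${R^{(1)}}_{(1)}\otimes {R^{(1)}}_{(2)}\otimes R^{(2)}=R_1^{(1)}\otimes R_2^{(1)}\otimes R_1^{(2)}R_2^{(2)}$, $R^{(1)}\otimes {R^{(2)}}_{(1)}\otimes {R^{(2)}}_{(2)}=R_1^{(1)}R_2^{(1)}\otimes R_2^{(2)}\otimes R_1^{(2)}$ (subscripts $1,2$ on $R$ denote different copies of $R$), and $R^{(1)}h_{(1)}\otimes R^{(2)}h_{(2)}=h_{(2)}R^{(1)}\otimes h_{(1)}R^{(2)}$. All Hopf algebras have invertible antipode. $\mathcal{B}=H\text{-}\mathbf{Mod}$ denotes left $H$-modules (action $\triangleright$), braided by $\Psi_{V,W}(v\otimes w)=(R^{(2)}\triangleright w)\otimes(R^{(1)}\triangleright v)$; $\overline{\mathcal{B}}$ is the same monoidal category with the inverse braiding $v\otimes w\mapsto (R^{-(1)}\triangleright w)\otimes(R^{-(2)}\triangleright v)$. Hopf algebras in a braided category: algebra and coalgebra structures in the category with $\Delta m=(m\otimes m)(\mathrm{Id}\otimes\Psi\otimes\mathrm{Id})(\Delta\otimes\Delta)$, $\Delta,\varepsilon$ unital, $\varepsilon$ multiplicative, with antipode $S$ in the category. $b_{(1)}\otimes b_{(2)}$, $c_{(1)}\otimes c_{(2)}$ denote the coproducts in $\mathcal{B}$ of $B$, $C$. ${}^{\mathrm{cop}}C$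 is $C$ with the same product and coproduct $c\mapsto (R^{-(1)}\triangleright c_{(2)})\otimes(R^{-(2)}\triangleright c_{(1)})$; it is a bialgebra in $\overline{\mathcal{B}}$. Weakly dual Hopf algebras $C,B$: there is a morphism $\mathrm{ev}\colon C\otimes B\to\Bbbk$ in $\mathcal{B}$ (not necessarily non-degenerate) with $\mathrm{ev}(cc',b)=\mathrm{ev}(c,b_{(2)})\mathrm{ev}(c',b_{(1)})$, $\mathrm{ev}(c,bb')=\mathrm{ev}(c_{(2)},b)\mathrm{ev}(c_{(1)},b')$, $\mathrm{ev}(1,b)=\varepsilon(b)$, $\mathrm{ev}(c,1)=\varepsilon(c)$, $\mathrm{ev}(Sc,b)=\mathrm{ev}(c,Sb)$. $\mathrm{Drin}_H(C,B)$ is the $\Bbbk$-Hopf algebra generated by $C,H,B$ as subalgebras with relations $$(R^{-(1)}\triangleright b_{(2)})(R^{-(2)}\triangleright c_{(1)})\,\mathrm{ev}(c_{(2)},b_{(1)})=R^{-(1)}c_{(2)}b_{(1)}R^{(2)}\,\mathrm{ev}(R^{-(2)}\triangleright c_{(1)},R^{(1)}\triangleright b_{(2)}),$$ $hb=(h_{(1)}\triangleright b)h_{(2)}$, $hc=(h_{(1)}\triangleright c)h_{(2)}$, coproduct $\Delta(h)=h_{(1)}\otimes h_{(2)}$, $\Delta(b)=b_{(1)}R^{(2)}\otimes(R^{(1)}\triangleright b_{(2)})$, $\Delta(c)=R^{-(1)}c_{(2)}\otimes(R^{-(2)}\triangleright c_{(1)})$, and counit extending those of $C,H,B$ multiplicatively.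 As a vector space it is identified with $B\otimes H\otimes C$ via $b\otimes h\otimes c\mapsto bhc$. Right $2$-cocycles: for a bialgebra $E$ in a $\Bbbk$-linear braided monoidal category $\mathcal{C}$ with unit object $I$ and braiding $\Psi$, put $\Delta_{E\otimes E}=(\mathrm{Id}\otimes\Psi_{E,E}\otimes\mathrm{Id})(\Delta\otimes\Delta)$. A right $2$-cocycle over $E$ is a convolution-invertible morphism $\sigma\colon E\otimes E\to I$ in $\mathcal{C}$ with $\sigma(\mathrm{Id}_E\otimes m\otimes\sigma)(\mathrm{Id}_E\otimes\Delta_{E\otimes E})=\sigma(m\otimes\sigma\otimes\mathrm{Id}_E)(\Delta_{E\otimes E}\otimes\mathrm{Id}_E)$ and $\sigma(1\otimes\mathrm{Id}_E)=\varepsilon=\sigma(\mathrm{Id}_E\otimes 1)$. Two cocycles are cohomologous, $\sigma\sim\tau$, if there is a convolution-invertible morphism $\beta\colon E\to I$ in $\mathcal{C}$ with $\beta 1=\mathrm{Id}_I$ and convolution inverse $\beta^{-*}$ such that $\tau=\sigma^\beta:=(\beta^{-*}m\otimes\sigma)(\mathrm{Id}\otimes\Psi_{E,E}\otimes\mathrm{Id})(\Delta\otimes\beta\otimes\Delta\otimes\beta)(\Delta\otimes\Delta)$. $C^2_H(B,\Bbbk)$ denotes the right $2$-cocycles over $B$ in $\mathcal{B}$, $C^2_H({}^{\mathrm{cop}}C,\Bbbk)$ those over ${}^{\mathrm{cop}}C$ (a bialgebra in $\overline{\mathcal{B}}$), and $C^2(\cdot,\Bbbk)$ is the case of $\Bbbk$-vector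 spaces; $H^2_H$, $H^2$ are the quotients by $\sim$. *)

(* Defs.v *)
From HB Require Import structures.
From mathcomp Require Import all_boot all_algebra sesquilinear.
From mathcomp Require Import boolp.

Set Implicit Arguments.
Unset Strict Implicit.
Unset Printing Implicit Defensive.

Import GRing.Theory.

Local Open Scope ring_scope.
Local Open Scope quotient_scope.

Reserved Notation "x ⊗ y" (at level 40, left associativity).
Reserved Notation "\sw_ ( a , b <- t ) F"
  (at level 41, a name, b name, t at level 200, F at level 41,
   right associativity, format "\sw_ ( a ,  b  <-  t )  F").

(* The tensor product of two vector spaces of arbitrary dimension: finite
   formal sums of pairs, two of them being identified when no bilinear map
   with values in a vector space distinguishes them. *)
Section TensorProduct.
Variables (k : fieldType) (V W : lmodType k).

Definition tensor_eval (X : zmodType) (F : V -> W -> X) (s : seq (V * W)) : X :=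
  \sum_(p <- s) F p.1 p.2.

Definition tensor_equiv (s t : seq (V * W)) : bool :=
  `[< forall (X : lmodType k) (F : {bilinear V -> W -> X}),
        tensor_eval F s = tensor_eval F t >].

Lemma tensor_equiv_is_equiv : equiv_class_of tensor_equiv.
Proof.
split=> [s | s t | t s u]; first exact/asboolP.
- by apply/asboolP/asboolP => st X F; rewrite st.
- by move=> /asboolP st /asboolP tu; apply/asboolP => X F; rewrite st tu.
Qed.

Canonical tensor_equiv_equiv := EquivRelPack tensor_equiv_is_equiv.

Definition tensor : Type := {eq_quot tensor_equiv}.

HB.instance Definition _ := Choice.on tensor.
HB.instance Definition _ := EqQuotient.on tensor.

Definition tens (v : V) (w : W) : tensor := \pi_tensor [:: (v, w)].

Definition tensor_add (t u : tensor) : tensor := \pi_tensor (repr t ++ repr u).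
Definition tensor_scale (a : k) (t : tensor) : tensor :=
  \pi_tensor [seq (a *: p.1, p.2) | p <- repr t].
Definition tensor_zero : tensor := \pi_tensor [::].
Definition tensor_opp (t : tensor) : tensor := tensor_scale (-1) t.

Lemma tensor_eqP (t u : tensor) :
  (forall (X : lmodType k) (F : {bilinear V -> W -> X}),
     tensor_eval F (repr t) = tensor_eval F (repr u)) -> t = u.
Proof.
move=> tu; rewrite -[t]reprK -[u]reprK; apply/eqquotP.
exact/asboolP.
Qed.

Lemma tensor_eval_repr_pi (X : lmodType k) (F : {bilinear V -> W -> X}) s :
  tensor_eval F (repr (\pi_tensor s)) = tensor_eval F s.
Proof.
have /eqquotP : \pi_tensor (repr (\pi_tensor s)) = \pi_tensor s by rewrite reprK.
by move=> /asboolP.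
Qed.

Lemma tensor_eval_add (X : lmodType k) (F : {bilinear V -> W -> X}) t u :
  tensor_eval F (repr (tensor_add t u)) =
  tensor_eval F (repr t) + tensor_eval F (repr u).
Proof. by rewrite tensor_eval_repr_pi /tensor_eval big_cat. Qed.

Lemma tensor_eval_scale (X : lmodType k) (F : {bilinear V -> W -> X}) a t :
  tensor_eval F (repr (tensor_scale a t)) = a *: tensor_eval F (repr t).
Proof.
rewrite tensor_eval_repr_pi /tensor_eval big_map scaler_sumr.
by apply: eq_bigr => p _; rewrite linearZl_LR.
Qed.

Lemma tensor_eval_zero (X : lmodType k) (F : {bilinear V -> W -> X}) :
  tensor_eval F (repr tensor_zero) = 0.
Proof. by rewrite tensor_eval_repr_pi /tensor_eval big_nil. Qed.

Let tensorE := (tensor_eval_add, tensor_eval_scale, tensor_eval_zero).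

Fact tensor_addA : associative tensor_add.
Proof. by move=> t u v; apply: tensor_eqP => X F; rewrite !tensorE addrA. Qed.
Fact tensor_addC : commutative tensor_add.
Proof. by move=> t u; apply: tensor_eqP => X F; rewrite !tensorE addrC. Qed.
Fact tensor_add0 : left_id tensor_zero tensor_add.
Proof. by move=> t; apply: tensor_eqP => X F; rewrite !tensorE add0r. Qed.
Fact tensor_addN : left_inverse tensor_zero tensor_opp tensor_add.
Proof.
by move=> t; apply: tensor_eqP => X F; rewrite !tensorE scaleN1r addNr.
Qed.

HB.instance Definition _ :=
  GRing.isZmodule.Build tensor tensor_addA tensor_addC tensor_add0 tensor_addN.

Fact tensor_scaleA a b t :
  tensor_scale a (tensor_scale b t) = tensor_scale (a * b) t.
Proof. by apply: tensor_eqP => X F; rewrite !tensorE scalerA. Qed.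
Fact tensor_scale1 : left_id 1 tensor_scale.
Proof. by move=> t; apply: tensor_eqP => X F; rewrite !tensorE scale1r. Qed.
Fact tensor_scaleDr : right_distributive tensor_scale +%R.
Proof.
by move=> a t u; apply: tensor_eqP => X F; rewrite !tensorE scalerDr.
Qed.
Fact tensor_scaleDl t : {morph tensor_scale^~ t : a b / a + b}.
Proof.
by move=> a b; apply: tensor_eqP => X F; rewrite !tensorE scalerDl.
Qed.

HB.instance Definition _ := GRing.Zmodule_isLmodule.Build k tensor
  tensor_scaleA tensor_scale1 tensor_scaleDr tensor_scaleDl.

(* Sweedler sums: the sum of [F v w] over the terms [v ⊗ w] of some expression
   of [t].  The expression matters only when [F] is not bilinear; for bilinear
   [F] this is the linear map induced by [F], by the two lemmas below. *)
Definition sweedler (X : zmodType) (t : tensor) (F : V -> W -> X) : X :=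
  tensor_eval F (repr t).

Lemma sweedler_linear (X : lmodType k) (F : {bilinear V -> W -> X}) :
  linear (fun t => sweedler t F).
Proof. by move=> a t u; rewrite /sweedler !tensorE. Qed.

Lemma sweedler_tens (X : lmodType k) (F : {bilinear V -> W -> X}) v w :
  sweedler (tens v w) F = F v w.
Proof. by rewrite /sweedler tensor_eval_repr_pi /tensor_eval big_seq1. Qed.

End TensorProduct.

Notation "V ⊗ W" := (tensor V%type W%type) : type_scope.
Notation "v ⊗ w" := (tens v w) : ring_scope.
Notation "\sw_ ( a , b <- t ) F" := (sweedler t (fun a b => F)) : ring_scope.

Lemma tens_bilinear (k : fieldType) (V W : lmodType k) :
  bilinear_for *:%R *:%R (@tens k V W).
Proof.
split=> [w | v] a x y /=; apply: tensor_eqP => X F;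
  rewrite tensor_eval_add tensor_eval_scale !tensor_eval_repr_pi;
  by rewrite /tensor_eval !big_seq1 /= ?linearPl ?linearPr.
Qed.

Section BialgebraNotions.
Variables (k : fieldType) (E : algType k).

Definition flip (V W : lmodType k) (t : V ⊗ W) : W ⊗ V :=
  \sw_(v, w <- t) w ⊗ v.

Definition tmult (t : E ⊗ E) : E := \sw_(x, y <- t) x * y.

Definition tensor_mul (t u : E ⊗ E) : E ⊗ E :=
  \sw_(x, y <- t) \sw_(x', y' <- u) (x * x') ⊗ (y * y').

Variables (Psi : E ⊗ E -> E ⊗ E) (Delta : E -> E ⊗ E) (eps : E -> k).

(* (Id ⊗ Psi ⊗ Id)(Delta ⊗ Delta) *)
Definition comul2 (t : E ⊗ E) : (E ⊗ E) ⊗ (E ⊗ E) :=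
  \sw_(x, y <- t) \sw_(x1, x2 <- Delta x) \sw_(y1, y2 <- Delta y)
    \sw_(u, v <- Psi (x2 ⊗ y1)) (x1 ⊗ u) ⊗ (v ⊗ y2).

Definition counit2 (t : E ⊗ E) : k := \sw_(x, y <- t) eps x * eps y.

Record is_bialgebra : Prop := IsBialgebra {
  coassociativity : forall x : E,
    \sw_(x1, x2 <- Delta x) \sw_(y1, y2 <- Delta x1) y1 ⊗ (y2 ⊗ x2) =
    \sw_(x1, x2 <- Delta x) \sw_(y1, y2 <- Delta x2) x1 ⊗ (y1 ⊗ y2);
  counit_left : forall x : E, \sw_(x1, x2 <- Delta x) eps x1 *: x2 = x;
  counit_right : forall x : E, \sw_(x1, x2 <- Delta x) eps x2 *: x1 = x;
  comul_mul : forall x y : E,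
    Delta (x * y) = \sw_(p, q <- comul2 (x ⊗ y)) tmult p ⊗ tmult q;
  comul_one : Delta 1 = 1 ⊗ 1;
  counit_mul : forall x y : E, eps (x * y) = eps x * eps y;
  counit_one : eps 1 = 1
}.

Definition is_antipode (S : E -> E) : Prop := forall x : E,
  \sw_(x1, x2 <- Delta x) S x1 * x2 = (eps x)%:A /\
  \sw_(x1, x2 <- Delta x) x1 * S x2 = (eps x)%:A.

End BialgebraNotions.

Record hopfAlg (k : fieldType) := HopfAlg {
  hopf_alg :> algType k;
  hopf_comul : {linear hopf_alg -> (hopf_alg ⊗ hopf_alg)%type};
  hopf_counit : {linear hopf_alg -> k^o};
  hopf_antipode : {linear hopf_alg -> hopf_alg};
  hopf_bialgebra : is_bialgebra (@flip k _ _) hopf_comul hopf_counit;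
  hopf_antipodeP : is_antipode hopf_comul hopf_counit hopf_antipode;
  hopf_antipode_bij : bijective hopf_antipode
}.

Record quasitriangular (k : fieldType) (H : hopfAlg k) := Quasitriangular {
  Rmat : H ⊗ H;
  Rmat_inv : H ⊗ H;
  RmatV : tensor_mul Rmat Rmat_inv = 1 ⊗ 1;
  RmatVV : tensor_mul Rmat_inv Rmat = 1 ⊗ 1;
  Rmat_comul_left :
    \sw_(r, s <- Rmat) \sw_(r1, r2 <- hopf_comul H r) r1 ⊗ (r2 ⊗ s) =
    \sw_(r, s <- Rmat) \sw_(r', s' <- Rmat) r ⊗ (r' ⊗ (s * s'));
  Rmat_comul_right :
    \sw_(r, s <- Rmat) \sw_(s1, s2 <- hopf_comul H s) r ⊗ (s1 ⊗ s2) =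
    \sw_(r, s <- Rmat) \sw_(r', s' <- Rmat) (r * r') ⊗ (s' ⊗ s);
  Rmat_comm : forall h : H,
    \sw_(r, s <- Rmat) \sw_(h1, h2 <- hopf_comul H h) (r * h1) ⊗ (s * h2) =
    \sw_(r, s <- Rmat) \sw_(h1, h2 <- hopf_comul H h) (h2 * r) ⊗ (h1 * s)
}.

Section ModuleCategory.
Variables (k : fieldType) (H : hopfAlg k).

Definition is_action (V : lmodType k) (act : H -> V -> V) : Prop :=
  (forall v, act 1 v = v) /\
  (forall g h v, act (g * h) v = act g (act h v)).

Definition act_unit (h : H) (a : k) : k := hopf_counit H h * a.

Definition act_tensor (V W : lmodType k) (aV : H -> V -> V) (aW : H -> W -> W)
    (h : H) (t : V ⊗ W) : V ⊗ W :=
  \sw_(v, w <- t) \sw_(h1, h2 <- hopf_comul H h) aV h1 v ⊗ aW h2 w.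

Definition hequivariant (V W : Type) (aV : H -> V -> V) (aW : H -> W -> W)
    (f : V -> W) : Prop :=
  forall h v, f (aV h v) = aW h (f v).

Variable Q : quasitriangular H.

Definition braiding (V W : lmodType k) (aV : H -> V -> V) (aW : H -> W -> W)
    (t : V ⊗ W) : W ⊗ V :=
  \sw_(v, w <- t) \sw_(r, s <- Rmat Q) aW s w ⊗ aV r v.

Definition inverse_braiding (V W : lmodType k)
    (aV : H -> V -> V) (aW : H -> W -> W) (t : V ⊗ W) : W ⊗ V :=
  \sw_(v, w <- t) \sw_(r, s <- Rmat_inv Q) aW r w ⊗ aV s v.

Record braidedHopfAlg := BraidedHopfAlg {
  bh_alg :> algType k;
  bh_act : {bilinear H -> bh_alg -> bh_alg};
  bh_comul : {linear bh_alg -> (bh_alg ⊗ bh_alg)%type};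
  bh_counit : {linear bh_alg -> k^o};
  bh_antipode : {linear bh_alg -> bh_alg};
  bh_actP : is_action bh_act;
  bh_mul_equiv :
    hequivariant (act_tensor bh_act bh_act) bh_act (@tmult k bh_alg);
  bh_one_equiv : hequivariant act_unit bh_act (fun a : k => a%:A);
  bh_comul_equiv : hequivariant bh_act (act_tensor bh_act bh_act) bh_comul;
  bh_counit_equiv : hequivariant bh_act act_unit bh_counit;
  bh_antipode_equiv : hequivariant bh_act bh_act bh_antipode;
  bh_bialgebra : is_bialgebra (braiding bh_act bh_act) bh_comul bh_counit;
  bh_antipodeP : is_antipode bh_comul bh_counit bh_antipode;
  bh_antipode_bij : bijective bh_antipode
}.

Definition cop_comul (C : braidedHopfAlg) (c : C) : C ⊗ C :=
  \sw_(c1, c2 <- bh_comul C c) \sw_(r, s <- Rmat_inv Q)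
    bh_act C r c2 ⊗ bh_act C s c1.

Record weakly_dual (C B : braidedHopfAlg) := WeaklyDual {
  ev : {linear (C ⊗ B)%type -> k^o};
  ev_equiv : hequivariant (act_tensor (bh_act C) (bh_act B)) act_unit ev;
  ev_mul_left : forall (c c' : C) (b : B), ev ((c * c') ⊗ b) =
    \sw_(b1, b2 <- bh_comul B b) ev (c ⊗ b2) * ev (c' ⊗ b1);
  ev_mul_right : forall (c : C) (b b' : B), ev (c ⊗ (b * b')) =
    \sw_(c1, c2 <- bh_comul C c) ev (c2 ⊗ b) * ev (c1 ⊗ b');
  ev_one_left : forall b : B, ev (1 ⊗ b) = bh_counit B b;
  ev_one_right : forall c : C, ev (c ⊗ 1) = bh_counit C c;
  ev_antipode : forall (c : C) (b : B),
    ev (bh_antipode C c ⊗ b) = ev (c ⊗ bh_antipode B b)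
}.

Section DrinfeldDouble.
Variables (C B : braidedHopfAlg) (e : weakly_dual C B).

Record drinfeld_relations (A : algType k)
    (fB : B -> A) (fH : H -> A) (fC : C -> A) : Prop := DrinfeldRelations {
  drin_rel_CB : forall (b : B) (c : C),
    \sw_(b1, b2 <- bh_comul B b) \sw_(c1, c2 <- bh_comul C c)
      \sw_(r, s <- Rmat_inv Q)
        ev e (c2 ⊗ b1) *: (fB (bh_act B r b2) * fC (bh_act C s c1)) =
    \sw_(b1, b2 <- bh_comul B b) \sw_(c1, c2 <- bh_comul C c)
      \sw_(r, s <- Rmat_inv Q) \sw_(r', s' <- Rmat Q)
        ev e (bh_act C s c1 ⊗ bh_act B r' b2) *:
          (fH r * fC c2 * fB b1 * fH s');
  drin_rel_HB : forall (h : H) (b : B),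
    fH h * fB b =
    \sw_(h1, h2 <- hopf_comul H h) fB (bh_act B h1 b) * fH h2;
  drin_rel_HC : forall (h : H) (c : C),
    fH h * fC c =
    \sw_(h1, h2 <- hopf_comul H h) fC (bh_act C h1 c) * fH h2
}.

(* [D] is Drin_H(C,B): as an algebra it is presented by the generators C, H, B
   and the relations above ([drin_presentation]), and the multiplication map
   b ⊗ h ⊗ c |-> b h c identifies it with B ⊗ H ⊗ C ([drin_triangular]); in
   particular C, H, B are subalgebras. *)
Record drinfeld_double := DrinfeldDouble {
  drin_hopf :> hopfAlg k;
  drin_B : {lrmorphism B -> drin_hopf};
  drin_H : {lrmorphism H -> drin_hopf};
  drin_C : {lrmorphism C -> drin_hopf};
  drin_rel : drinfeld_relations drin_B drin_H drin_C;
  drin_presentation : forall (A : algType k) (fB : {lrmorphism B -> A})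
      (fH : {lrmorphism H -> A}) (fC : {lrmorphism C -> A}),
    drinfeld_relations fB fH fC ->
    exists2 f : {lrmorphism drin_hopf -> A},
      [/\ f \o drin_B =1 fB, f \o drin_H =1 fH & f \o drin_C =1 fC] &
      forall g : {lrmorphism drin_hopf -> A},
        [/\ g \o drin_B =1 fB, g \o drin_H =1 fH & g \o drin_C =1 fC] ->
        g =1 f;
  drin_triangular : bijective (fun t : B ⊗ (H ⊗ C) =>
    \sw_(b, u <- t) \sw_(h, c <- u) drin_B b * drin_H h * drin_C c);
  drin_comul_H : forall h : H, hopf_comul drin_hopf (drin_H h) =
    \sw_(h1, h2 <- hopf_comul H h) drin_H h1 ⊗ drin_H h2;
  drin_comul_B : forall b : B, hopf_comul drin_hopf (drin_B b) =
    \sw_(b1, b2 <- bh_comul B b) \sw_(r, s <- Rmat Q)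
      (drin_B b1 * drin_H s) ⊗ drin_B (bh_act B r b2);
  drin_comul_C : forall c : C, hopf_comul drin_hopf (drin_C c) =
    \sw_(c1, c2 <- bh_comul C c) \sw_(r, s <- Rmat_inv Q)
      (drin_H r * drin_C c2) ⊗ drin_C (bh_act C s c1);
  drin_counit_H : forall h : H,
    hopf_counit drin_hopf (drin_H h) = hopf_counit H h;
  drin_counit_B : forall b : B,
    hopf_counit drin_hopf (drin_B b) = bh_counit B b;
  drin_counit_C : forall c : C,
    hopf_counit drin_hopf (drin_C c) = bh_counit C c
}.

End DrinfeldDouble.
End ModuleCategory.

(* The data of a bialgebra in a braided category of vector spaces with
   additional structure that the notion of a cocycle depends on: the braiding
   E ⊗ E -> E ⊗ E, and which linear forms on E and on E ⊗ E are morphisms to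
   the unit object k of the category. *)
Record bialgebra_in_category (k : fieldType) := BialgebraInCategory {
  bc_alg :> algType k;
  bc_comul : bc_alg -> bc_alg ⊗ bc_alg;
  bc_counit : bc_alg -> k;
  bc_braid : bc_alg ⊗ bc_alg -> bc_alg ⊗ bc_alg;
  bc_hom1 : (bc_alg -> k) -> Prop;
  bc_hom2 : (bc_alg ⊗ bc_alg -> k) -> Prop
}.

Definition in_HMod (k : fieldType) (H : hopfAlg k) (Q : quasitriangular H)
    (B : braidedHopfAlg Q) : bialgebra_in_category k :=
  BialgebraInCategory (bh_comul B) (bh_counit B)
    (braiding Q (bh_act B) (bh_act B))
    (hequivariant (bh_act B) (@act_unit k H))
    (hequivariant (act_tensor (bh_act B) (bh_act B)) (@act_unit k H)).

Definition cop_in_HMod_bar (k : fieldType) (H : hopfAlg k)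
    (Q : quasitriangular H) (C : braidedHopfAlg Q) : bialgebra_in_category k :=
  BialgebraInCategory (@cop_comul k H Q C) (bh_counit C)
    (inverse_braiding Q (bh_act C) (bh_act C))
    (hequivariant (bh_act C) (@act_unit k H))
    (hequivariant (act_tensor (bh_act C) (bh_act C)) (@act_unit k H)).

Definition in_Vect (k : fieldType) (D : hopfAlg k) : bialgebra_in_category k :=
  BialgebraInCategory (hopf_comul D) (hopf_counit D) (@flip k D D)
    (fun _ => True) (fun _ => True).

Section Cohomology.
Variables (k : fieldType) (E : bialgebra_in_category k).

Definition convolution_inverse (X : lmodType k) (Delta : X -> X ⊗ X)
    (eps f g : X -> k) : Prop := forall x,
  \sw_(x1, x2 <- Delta x) f x1 * g x2 = eps x /\
  \sw_(x1, x2 <- Delta x) g x1 * f x2 = eps x.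

Let DeltaEE := comul2 (@bc_braid k E) (@bc_comul k E).

Record is_right_cocycle (sigma : {linear (E ⊗ E)%type -> k^o}) : Prop :=
  IsRightCocycle {
  cocycle_hom : bc_hom2 (sigma : E ⊗ E -> k);
  cocycle_invertible : exists sigma' : {linear (E ⊗ E)%type -> k^o},
    bc_hom2 (sigma' : E ⊗ E -> k) /\
    convolution_inverse DeltaEE (counit2 (@bc_counit k E)) sigma sigma';
  cocycle_eq : forall x y z : E,
    \sw_(p, q <- DeltaEE (y ⊗ z)) sigma (x ⊗ tmult p) * sigma q =
    \sw_(p, q <- DeltaEE (x ⊗ y)) sigma (tmult p ⊗ z) * sigma q;
  cocycle_one_left : forall x : E, sigma (1 ⊗ x) = bc_counit x;
  cocycle_one_right : forall x : E, sigma (x ⊗ 1) = bc_counit x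
}.

Definition C2 := {sigma : {linear (E ⊗ E)%type -> k^o} | is_right_cocycle sigma}.

Definition cocycle_form (sigma : C2) : {linear (E ⊗ E)%type -> k^o} := proj1_sig sigma.

Definition cohomologous (sigma tau : C2) : Prop :=
  exists beta beta' : {linear E -> k^o},
    [/\ bc_hom1 (beta : E -> k), bc_hom1 (beta' : E -> k),
        convolution_inverse (@bc_comul k E) (@bc_counit k E) beta beta',
        beta 1 = 1 &
        forall x y : E, cocycle_form tau (x ⊗ y) =
          \sw_(x1, x2 <- bc_comul x) \sw_(y1, y2 <- bc_comul y)
          \sw_(x11, x12 <- bc_comul x1) \sw_(y11, y12 <- bc_comul y1)
          \sw_(u, v <- bc_braid (x12 ⊗ y11))
            beta' (x11 * u) * cocycle_form sigma (v ⊗ y12) * beta x2 * beta y2].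

(* The quotient of C2 by ~, as the set of classes. *)
Definition H2 :=
  {P : C2 -> Prop | exists sigma : C2, P = cohomologous sigma}.

Definition coh_class (sigma : C2) : H2 :=
  exist _ (cohomologous sigma) (ex_intro _ sigma erefl).

End Cohomology.

Coercion cocycle_form : C2 >-> GRing.Linear.type.

(* Main.v *)
Require Import Defs.
From HB Require Import structures.
From mathcomp Require Import all_boot all_algebra sesquilinear.
From mathcomp Require Import boolp ring.
Set Implicit Arguments.
Unset Strict Implicit.
Unset Printing Implicit Defensive.
Import GRing.Theory.
Local Open Scope ring_scope.

(** Up to convolution invertibility, a right 2-cocycle J on a Hopf algebra D is the
same thing as an associative unital product on D that is colinear for the left
coaction of D: put x * y = J(x_(2), y_(2)) x_(1) y_(1).  The composite of this
product with the counit is J, and the product is associative with unit 1 exactly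
when J satisfies the identities of a right 2-cocycle.  So the form
sigma o tau is not checked against the cocycle identity; instead the twisted
product on the double D ([star]) is built from those on B and C, proved to be
associative ([starA]), colinear ([comul_star]) and unital, and J is read off as
its counit ([Jform], [Jform_cocycle]).

The twisted product has to be the given one on B (from sigma), on C (from tau)
and on H, and h must act on B and C as before.  What remains is the product
c * b, and the defining relation of D dictates it: one of its sides is
c_(-1) b_(-1) ev(c_(0), b_(0)) for the coactions of D on C and B, the colinear map
with counit ev, and the other side lies in B C ([cross], [cross_cofree]).  The
whole construction runs on one principle: a colinear map into D is determined by
its counit.  Associativity on B and on C is then the cocycle identity of sigma and
tau ([twmulA]), and compatibility of [cross] with the two twisted products
([cross_mB], [cross_mC]) becomes a scalar identity, which follows from
multiplicativity of ev and the fact that an invariant form exchanges R and its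
inverse ([R_invariant_form]).  Since C with the opposite coproduct stands to the
R-matrix R_21^-1 exactly as B stands to R ([flipped], [factorB], [factorC]), the
theory of a single factor is developed once, for both.

The value formula shows that J is the convolution product of three forms inflated
from ev, sigma and tau ([Jform_factor]).  Each of them is convolution invertible,
ev by means of the antipode, hence so is J ([Jform_inverse]).

Coboundaries are isomorphisms of twisted products: the gauge map
x |-> x_(1) beta(x_(2)) carries the product twisted by sigma^beta to the one twisted
by sigma ([twmul_coboundary]).  If beta and gamma do this for B and C, then the
gauge map of beta ⊗ eps ⊗ gamma does it for D ([delta_star]), which says that
sigma' o tau' is the coboundary twist of sigma o tau ([Jform_coboundary]).  The map
on cohomology sends two classes to the class of the form made from
representatives.  For this to be well defined it is enough that ~ is reflexive over
B and C and transitive over D. *)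

(** * Multilinear maps and Sweedler sums *)

Section Multilinear.
Variable k : fieldType.
Implicit Types (U V W X Y : lmodType k).

(** Linearity as a property of plain functions: the bodies of Sweedler sums are plain
functions, for which a bundled linear structure cannot be inferred. *)
Definition lin V W (f : V -> W) : Prop := linear f.

Definition bil U V X (F : U -> V -> X) : Prop :=
  (forall v, lin (F^~ v)) /\ (forall u, lin (F u)).

Definition tril U V W X (F : U -> V -> W -> X) : Prop :=
  [/\ forall v w, lin (fun u => F u v w), forall u w, lin (fun v => F u v w)
    & forall u v, lin (fun w => F u v w)].

Lemma lin_linear V W (f : {linear V -> W}) : lin f.
Proof. exact: linearP. Qed.

Definition linmap V W (f : V -> W) (hf : lin f) : {linear V -> W} :=
  HB.pack_for {linear V -> W} f (GRing.isLinear.Build k V W *:%R f hf).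

Lemma linZ V W (f : V -> W) : lin f -> forall a v, f (a *: v) = a *: f v.
Proof. by move=> hf; exact: (linearZ_LR (linmap hf)). Qed.
Lemma lin_sum V W (f : V -> W) : lin f ->
  forall I (r : seq I) (P : pred I) E,
  f (\sum_(i <- r | P i) E i) = \sum_(i <- r | P i) f (E i).
Proof. by move=> hf I r P E; exact: (linear_sum (linmap hf)). Qed.

Definition bilmap U V X (F : U -> V -> X) (hF : bil F) :
    {bilinear U -> V -> X} :=
  HB.pack_for {bilinear U -> V -> X} F
    (bilinear_isBilinear.Build k U V X *:%R *:%R F
       (conj (fun v => hF.1 v) (fun u => hF.2 u))).

Lemma lin_sw_bil U V X (F : U -> V -> X) : bil F -> lin (fun t => sweedler t F).
Proof. move=> hF; exact: (sweedler_linear (bilmap hF)). Qed.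

Lemma sw_tens U V X (F : U -> V -> X) u v : bil F -> sweedler (u ⊗ v) F = F u v.
Proof. move=> hF; exact: (sweedler_tens (bilmap hF)). Qed.

Lemma eq_sw U V (X : zmodType) (t : U ⊗ V) (F G : U -> V -> X) :
  (forall u v, F u v = G u v) -> sweedler t F = sweedler t G.
Proof. by move=> FG; apply: eq_bigr. Qed.

Lemma sw_exch U V U' V' (X : zmodType) (t : U ⊗ V) (t' : U' ⊗ V')
    (F : U -> V -> U' -> V' -> X) :
  \sw_(u, v <- t) \sw_(u', v' <- t') F u v u' v' =
  \sw_(u', v' <- t') \sw_(u, v <- t) F u v u' v'.
Proof. exact: exchange_big. Qed.

Lemma lin_sw V W X Y (f : X -> Y) (t : V ⊗ W) (F : V -> W -> X) :
  lin f -> f (\sw_(v, w <- t) F v w) = \sw_(v, w <- t) f (F v w).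
Proof. by move=> hf; exact: lin_sum. Qed.

Lemma sw_sw U V U' V' X (t : U ⊗ V) (G : U -> V -> U' ⊗ V')
    (F : U' -> V' -> X) : bil F ->
  \sw_(u', v' <- \sw_(u, v <- t) G u v) F u' v' =
  \sw_(u, v <- t) \sw_(u', v' <- G u v) F u' v'.
Proof. by move=> hF; exact: (lin_sw t G (lin_sw_bil hF)). Qed.

Lemma lin_id V : lin (fun x : V => x). Proof. by []. Qed.
Lemma lin_comp U V W (f : V -> W) (g : U -> V) :
  lin f -> lin g -> lin (fun x => f (g x)).
Proof. by move=> hf hg a x y; rewrite hg hf. Qed.
Lemma lin_sw_arg U V W X (t : W -> U ⊗ V) (F : U -> V -> X) :
  lin t -> bil F -> lin (fun x => sweedler (t x) F).
Proof. by move=> ht hF a x y; rewrite ht (lin_sw_bil hF). Qed.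
Lemma lin_sw_body U V W X (t : U ⊗ V) (F : W -> U -> V -> X) :
  (forall u v, lin (fun x => F x u v)) -> lin (fun x => sweedler t (F x)).
Proof.
move=> hF a x y; rewrite /sweedler /tensor_eval scaler_sumr -big_split /=.
by apply: eq_bigr => p _; rewrite hF.
Qed.
Lemma lin_tensl V W (w : W) : lin (fun v : V => v ⊗ w).
Proof. exact: (tens_bilinear V W).1. Qed.
Lemma lin_tensr V W (v : V) : lin (fun w : W => v ⊗ w).
Proof. exact: (tens_bilinear V W).2. Qed.
Lemma lin_mull (A : algType k) (a : A) : lin (fun x : A => x * a).
Proof. by move=> c x y; rewrite mulrDl scalerAl. Qed.
Lemma lin_mulr (A : algType k) (a : A) : lin (fun x : A => a * x).
Proof. by move=> c x y; rewrite mulrDr scalerAr. Qed.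
Lemma lin_scaler V (a : k) : lin (fun x : V => a *: x).
Proof. by move=> c x y; rewrite scalerDr !scalerA mulrC. Qed.
Lemma lin_scalel V (v : V) : lin (fun a : k^o => (a : k) *: v).
Proof. by move=> c x y; rewrite scalerDl scalerA. Qed.
Lemma lin_bill U V W (f : {bilinear U -> V -> W}) (v : V) : lin (fun u => f u v).
Proof. exact: linearPl. Qed.
Lemma lin_bilr U V W (f : {bilinear U -> V -> W}) (u : U) : lin (f u).
Proof. exact: linearPr. Qed.
Lemma lin_kmull (a : k) : lin (fun x : k^o => (x : k) * a : k^o).
Proof. exact: (@lin_mull (k^o : algType k)). Qed.
Lemma lin_kmulr (a : k) : lin (fun x : k^o => a * (x : k) : k^o).
Proof. exact: (@lin_mulr (k^o : algType k)). Qed.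

Lemma tril1 U V W X (F : U -> V -> W -> X) :
  tril F -> forall v w, lin (fun u => F u v w).
Proof. by case. Qed.
Lemma tril2 U V W X (F : U -> V -> W -> X) :
  tril F -> forall u w, lin (fun v => F u v w).
Proof. by case. Qed.
Lemma tril3 U V W X (F : U -> V -> W -> X) :
  tril F -> forall u v, lin (fun w => F u v w).
Proof. by case. Qed.

End Multilinear.

(** Linearity of an expression in one variable is proved by descending to the single
occurrence of that variable, through Sweedler sums (in the tensor or in the body),
scalings and applications of multilinear functions.  The module k^o is given
explicitly where needed, since unification does not find it from the carrier k. *)
Ltac linbase :=
  first [ exact: lin_linear | exact: lin_mull | exact: lin_mulr
        | exact: lin_tensl | exact: lin_tensr | exact: lin_scaler
        | exact: lin_scalel | exact: lin_bill | exact: lin_bilr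
        | exact: lin_kmull | exact: lin_kmulr | assumption
        | match goal with h : bil ?F |- lin _ => first [exact: h.1 | exact: h.2] end
        | match goal with h : tril ?F |- lin _ =>
            first [exact: (tril1 h) | exact: (tril2 h) | exact: (tril3 h)] end
        | solve [auto with lin]
        | solve [refine (proj1 (_ : bil _) _); auto with lin]
        | solve [refine (proj2 (_ : bil _) _); auto with lin] ].

Ltac absent x u := lazymatch u with context [x] => fail | _ => idtac end.
Ltac lambda x u := lazymatch eval pattern x in u with ?g _ => g end.

Ltac lincomp f g :=
  first [ apply: (@lin_comp _ _ _ _ f g); [linbase | linstep ]
        | apply: (@lin_comp _ _ (GRing.regular _) _ f g); [linbase | linstep ]
        | apply: (@lin_comp _ _ (GRing.regular _) (GRing.regular _) f g);
            [linbase | linstep ] ]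
with linbody x b :=
  lazymatch b with
  | x => clear x; exact: lin_id
  | @sweedler _ _ _ _ ?t ?F =>
      first [ absent x F; let t' := lambda x t in clear x;
              apply: (@lin_sw_arg _ _ _ _ _ t' F); linstep
            | absent x t; let F' := lambda x F in clear x;
              apply: (@lin_sw_body _ _ _ _ _ t F'); linstep ]
  | ?a *: ?v =>
      first [ absent x v; let a' := lambda x a in clear x;
              apply: (@lin_comp _ _ (GRing.regular _) _ (fun c => c *: v) a');
                [exact: lin_scalel | linstep]
            | absent x a; let v' := lambda x v in clear x;
              apply: (@lin_comp _ _ _ _ (fun w => a *: w) v');
                [exact: lin_scaler | linstep] ]
  | ?f ?u =>
      first [ absent x f; let g := lambda x u in clear x; lincomp f g
            | absent x u; lazymatch f with
              | ?f2 ?u2 => first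
                [ absent x f2; let g := lambda x u2 in clear x; lincomp (fun z => f2 z u) g
                | absent x u2; lazymatch f2 with ?f3 ?u3 =>
                  first [ absent x f3; let g := lambda x u3 in clear x;
                          lincomp (fun z => f3 z u2 u) g
                        | absent x u3; lazymatch f3 with ?f4 ?u4 =>
                            absent x f4; let g := lambda x u4 in clear x;
                            lincomp (fun z => f4 z u3 u2 u) g end ] end ] end ]
  end
with linstep :=
  lazymatch goal with
  | |- bil _ => split => ?; linstep
  | |- tril _ => split => ? ?; linstep
  | |- forall _, _ => intro; linstep
  | |- @lin ?k ?V ?W ?f =>
      let x := fresh "lv" in
      have x : GRing.Lmodule.sort V by [exact: 0];
      let b := eval cbv beta in (f x) in linbody x b
  end.
Ltac lintac := solve [linstep].

Ltac lt := try (by lintac).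

(** [lhs n tac] rewrites below n nested Sweedler sums: the new summand is an
existential variable that the closing [reflexivity] instantiates. *)
Tactic Notation "lhs" int_or_var(n) tactic3(tac) :=
  etransitivity; [do n (apply: eq_sw => ? ?); tac; reflexivity | cbv beta].
Tactic Notation "rhs" int_or_var(n) tactic3(tac) :=
  symmetry; lhs n tac; symmetry.

Section Pulling.
Variable k : fieldType.
Implicit Types (U V W X : lmodType k) (A : algType k).

Lemma sw_mull U V A (t : U ⊗ V) (F : U -> V -> A) y :
  (\sw_(u, v <- t) F u v) * y = \sw_(u, v <- t) F u v * y.
Proof. exact: mulr_suml. Qed.
Lemma sw_mulr U V A (t : U ⊗ V) (F : U -> V -> A) y :
  y * (\sw_(u, v <- t) F u v) = \sw_(u, v <- t) y * F u v.
Proof. exact: mulr_sumr. Qed.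
Lemma sw_scaler U V X (t : U ⊗ V) (F : U -> V -> X) a :
  a *: (\sw_(u, v <- t) F u v) = \sw_(u, v <- t) a *: F u v.
Proof. exact: scaler_sumr. Qed.
Lemma sw_scalel U V X (t : U ⊗ V) (F : U -> V -> k) (x : X) :
  (\sw_(u, v <- t) F u v) *: x = \sw_(u, v <- t) F u v *: x.
Proof. exact: scaler_suml. Qed.
Lemma sw_linear U V W X (t : U ⊗ V) (F : U -> V -> W) (f : {linear W -> X}) :
  f (\sw_(u, v <- t) F u v) = \sw_(u, v <- t) f (F u v).
Proof. exact: linear_sum. Qed.
Lemma sw_bill U V W W' X (t : U ⊗ V) (F : U -> V -> W)
    (f : {bilinear W -> W' -> X}) y :
  f (\sw_(u, v <- t) F u v) y = \sw_(u, v <- t) f (F u v) y.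
Proof. exact: (lin_sw _ _ (lin_bill f y)). Qed.
Lemma sw_tensr U V W W' (t : U ⊗ V) (F : U -> V -> W) (y : W') :
  y ⊗ (\sw_(u, v <- t) F u v) = \sw_(u, v <- t) y ⊗ F u v.
Proof. exact: (lin_sw _ _ (lin_tensr y)). Qed.
Lemma sw_scale U V X (t : U ⊗ V) (F : U -> V -> X) a : bil F ->
  \sw_(u, v <- a *: t) F u v = a *: \sw_(u, v <- t) F u v.
Proof. by move=> hF; exact: (linZ (lin_sw_bil hF)). Qed.
Lemma tensZr V W a (v : V) (w : W) : v ⊗ (a *: w) = a *: (v ⊗ w).
Proof. exact: (linZ (lin_tensr v)). Qed.

Lemma sw_id V W (t : V ⊗ W) : \sw_(v, w <- t) v ⊗ w = t.
Proof.
apply: tensor_eqP => X F; rewrite -/(sweedler _ F) -/(sweedler _ F).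
have hF : bil F by split; [exact: lin_bill | exact: lin_bilr].
by rewrite sw_sw //; apply: eq_sw => v w; rewrite sw_tens.
Qed.

Lemma tensor_ext V W X (f g : V ⊗ W -> X) : lin f -> lin g ->
  (forall v w, f (v ⊗ w) = g (v ⊗ w)) -> f =1 g.
Proof.
move=> hf hg fg t; rewrite -[t]sw_id (lin_sw _ _ hf) (lin_sw _ _ hg).
by apply: eq_sw.
Qed.

(** The axioms for coproducts and R-matrices are equations between threefold tensors;
this evaluates such an equation at a trilinear map. *)
Lemma tri_law U V W X A B A1 B1 A' B' A1' B1'
    (t : A ⊗ B) (t1 : A -> B -> A1 ⊗ B1) (t' : A' ⊗ B') (t1' : A' -> B' -> A1' ⊗ B1')
    (u : A -> B -> A1 -> B1 -> U) (v : A -> B -> A1 -> B1 -> V)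
    (w : A -> B -> A1 -> B1 -> W)
    (u' : A' -> B' -> A1' -> B1' -> U) (v' : A' -> B' -> A1' -> B1' -> V)
    (w' : A' -> B' -> A1' -> B1' -> W) (F : U -> V -> W -> X) :
  \sw_(a, b <- t) \sw_(c, d <- t1 a b) u a b c d ⊗ (v a b c d ⊗ w a b c d) =
  \sw_(a, b <- t') \sw_(c, d <- t1' a b) u' a b c d ⊗ (v' a b c d ⊗ w' a b c d) ->
  tril F ->
  \sw_(a, b <- t) \sw_(c, d <- t1 a b) F (u a b c d) (v a b c d) (w a b c d) =
  \sw_(a, b <- t') \sw_(c, d <- t1' a b) F (u' a b c d) (v' a b c d) (w' a b c d).
Proof.
move=> e hF; pose G := fun a s => \sw_(b, c <- s) F a b c.
have hG : bil G by rewrite /G; lintac.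
have := congr1 (fun s => sweedler s G) e; rewrite !sw_sw // => e2.
transitivity (\sw_(a, b <- t) \sw_(u', v' <- \sw_(c, d <- t1 a b)
  u a b c d ⊗ (v a b c d ⊗ w a b c d)) G u' v').
  apply: eq_sw => a b; rewrite sw_sw //; apply: eq_sw => c d.
  by rewrite sw_tens // /G sw_tens; lt.
rewrite e2; apply: eq_sw => a b; rewrite sw_sw //; apply: eq_sw => c d.
by rewrite sw_tens // /G sw_tens; lt.
Qed.

Lemma bi_law U V X A B A1 B1 A' B' A1' B1'
    (t : A ⊗ B) (t1 : A -> B -> A1 ⊗ B1) (t' : A' ⊗ B') (t1' : A' -> B' -> A1' ⊗ B1')
    (u : A -> B -> A1 -> B1 -> U) (v : A -> B -> A1 -> B1 -> V)
    (u' : A' -> B' -> A1' -> B1' -> U) (v' : A' -> B' -> A1' -> B1' -> V)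
    (F : U -> V -> X) :
  \sw_(a, b <- t) \sw_(c, d <- t1 a b) u a b c d ⊗ v a b c d =
  \sw_(a, b <- t') \sw_(c, d <- t1' a b) u' a b c d ⊗ v' a b c d ->
  bil F ->
  \sw_(a, b <- t) \sw_(c, d <- t1 a b) F (u a b c d) (v a b c d) =
  \sw_(a, b <- t') \sw_(c, d <- t1' a b) F (u' a b c d) (v' a b c d).
Proof.
move=> e hF; have := congr1 (fun s => sweedler s F) e; rewrite !sw_sw // => e2.
transitivity (\sw_(a, b <- t) \sw_(u', v' <- \sw_(c, d <- t1 a b)
  u a b c d ⊗ v a b c d) F u' v').
  by apply: eq_sw => a b; rewrite sw_sw //; apply: eq_sw => c d; rewrite sw_tens.
by rewrite e2; apply: eq_sw => a b; rewrite sw_sw //; apply: eq_sw => c d; rewrite sw_tens.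
Qed.

Lemma flip_sw V W X (t : V ⊗ W) (F : W -> V -> X) : bil F ->
  \sw_(w, v <- flip t) F w v = \sw_(v, w <- t) F w v.
Proof. by move=> hF; rewrite sw_sw //; apply: eq_sw => v w; rewrite sw_tens. Qed.

Lemma lin_flip V W : lin (@flip k V W).
Proof. rewrite /flip; lintac. Qed.
Lemma lin_tmult A : lin (@tmult k A).
Proof. rewrite /tmult; lintac. Qed.
Lemma tmult_tens A (x y : A) : tmult (x ⊗ y) = x * y.
Proof. by rewrite /tmult sw_tens; lt. Qed.

End Pulling.
#[global] Hint Resolve lin_flip lin_tmult : lin.

Section Comul2.
Variables (k : fieldType) (E : algType k) (Psi : E ⊗ E -> E ⊗ E).
Variables (Delta : E -> E ⊗ E) (hPsi : lin Psi) (hD : lin Delta).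
Lemma lin_comul2 : lin (comul2 Psi Delta).
Proof. rewrite /comul2; lintac. Qed.
Lemma comul2_sw (X : lmodType k) (F : E ⊗ E -> E ⊗ E -> X) x y : bil F ->
  \sw_(p, q <- comul2 Psi Delta (x ⊗ y)) F p q =
  \sw_(x1, x2 <- Delta x) \sw_(y1, y2 <- Delta y)
    \sw_(u, v <- Psi (x2 ⊗ y1)) F (x1 ⊗ u) (v ⊗ y2).
Proof.
move=> hF; rewrite /comul2 sw_tens; lt.
rewrite sw_sw //; apply: eq_sw => x1 x2.
rewrite sw_sw //; apply: eq_sw => y1 y2.
by rewrite sw_sw //; apply: eq_sw => u v; rewrite sw_tens.
Qed.
End Comul2.
#[global] Hint Resolve lin_comul2 : lin.

Section BialgebraLaws.
Variables (k : fieldType) (E : algType k) (Psi : E ⊗ E -> E ⊗ E).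
Variables (DE : E -> E ⊗ E) (eps : E -> k) (bi : is_bialgebra Psi DE eps).
Implicit Type X : lmodType k.

Lemma bialg_comulA X (F : E -> E -> E -> X) x : tril F ->
  \sw_(x1, x2 <- DE x) \sw_(y1, y2 <- DE x1) F y1 y2 x2 =
  \sw_(x1, x2 <- DE x) \sw_(y1, y2 <- DE x2) F x1 y1 y2.
Proof. exact: (tri_law (coassociativity bi x)). Qed.
Lemma bialg_counitl X (f : E -> X) x : lin f ->
  \sw_(x1, x2 <- DE x) eps x1 *: f x2 = f x.
Proof.
move=> hf; rewrite -{2}(counit_left bi x) (lin_sw _ _ hf).
by apply: eq_sw => a b; rewrite (linZ hf).
Qed.
Lemma bialg_counitr X (f : E -> X) x : lin f ->
  \sw_(x1, x2 <- DE x) eps x2 *: f x1 = f x.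
Proof.
move=> hf; rewrite -{2}(counit_right bi x) (lin_sw _ _ hf).
by apply: eq_sw => a b; rewrite (linZ hf).
Qed.
End BialgebraLaws.

Section HopfLaws.
Variables (k : fieldType) (H : hopfAlg k).
Local Notation De := (hopf_comul H).
Local Notation ep x := (hopf_counit H x : k).
Implicit Type X : lmodType k.

Definition comulA X (F : H -> H -> H -> X) := @bialg_comulA _ _ _ _ _ (hopf_bialgebra H) X F.
Definition counitl X (f : H -> X) := @bialg_counitl _ _ _ _ _ (hopf_bialgebra H) X f.
Definition counitr X (f : H -> X) := @bialg_counitr _ _ _ _ _ (hopf_bialgebra H) X f.
Lemma comulM X (F : H -> H -> X) x y : bil F ->
  \sw_(z1, z2 <- De (x * y)) F z1 z2 =
  \sw_(x1, x2 <- De x) \sw_(y1, y2 <- De y) F (x1 * y1) (x2 * y2).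
Proof.
move=> hF; rewrite (comul_mul (hopf_bialgebra H)) sw_sw //.
rewrite comul2_sw; lt.
apply: eq_sw => x1 x2; apply: eq_sw => y1 y2.
by rewrite /flip sw_tens; lt; rewrite !sw_tens ?tmult_tens //; lt; rewrite sw_tens.
Qed.
Lemma comul1 X (F : H -> H -> X) : bil F -> \sw_(z1, z2 <- De 1) F z1 z2 = F 1 1.
Proof. by move=> hF; rewrite (comul_one (hopf_bialgebra H)) sw_tens. Qed.
Lemma counitM x y : ep (x * y) = ep x * ep y.
Proof. exact: (counit_mul (hopf_bialgebra H)). Qed.
Lemma counit1 : ep 1 = 1. Proof. exact: (counit_one (hopf_bialgebra H)). Qed.
End HopfLaws.

(** Scalars inside a Sweedler sum are kept in the form a *: b with b in k^o, so that the
rules for linear maps apply to them as well. *)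
Section Scalars.
Variables (k : fieldType) (X : lmodType k).
Lemma scaler_swap (a b : k) (x : X) : a *: (b *: x) = b *: (a *: x).
Proof. by rewrite !scalerA mulrC. Qed.
Lemma scalerCk (a : k) (b : k^o) : a *: b = (b : k) *: (a : k^o).
Proof. exact: mulrC. Qed.
Lemma mulkE (a b : k) : a * b = a *: (b : k^o) :> k^o. Proof. by []. Qed.
Lemma scalekE (a b : k) : a *: (b : k^o) = a * b :> k. Proof. by []. Qed.
Lemma scaler_pull (a b c d : k) (x : X) :
  a *: (b *: (c *: (d *: x))) = (b * (c * d)) *: (a *: x).
Proof. by rewrite !scalerA; congr (_ *: _); rewrite -!mulrA mulrC -!mulrA. Qed.
Lemma scaler_front (a b c : k) (x : X) : a *: (b *: (c *: x)) = c *: (a *: (b *: x)).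
Proof. by rewrite !scalerA; congr (_ *: _); rewrite mulrC mulrA. Qed.
Lemma scaler_rev (a b : k) (c : k^o) : a *: (b *: c) = (c : k) *: (b *: (a : k^o)).
Proof. by change (a * (b * c) = c * (b * a)); rewrite mulrC mulrAC mulrC. Qed.
Lemma scalerM3 (a b c d : k) : a *: (b * (c * d) : k^o) = b *: (c *: (a *: (d : k^o))).
Proof.
change (a * (b * (c * d)) = b * (c * (a * d))).
by rewrite mulrCA [a * (c * d)]mulrCA.
Qed.
End Scalars.

(** * Antipode and R-matrix *)

Section Antipode.
Variables (k : fieldType) (H : hopfAlg k).
Local Notation De := (hopf_comul H).
Local Notation ep x := (hopf_counit H x : k).
Local Notation S := (hopf_antipode H).
Implicit Type X : lmodType k.

Lemma antipodel x : \sw_(x1, x2 <- De x) S x1 * x2 = (ep x)%:A.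
Proof. exact: (hopf_antipodeP x).1. Qed.
Lemma antipoder x : \sw_(x1, x2 <- De x) x1 * S x2 = (ep x)%:A.
Proof. exact: (hopf_antipodeP x).2. Qed.

Lemma antipode1 : S 1 = 1.
Proof.
have := antipodel 1; rewrite comul1; lt.
by rewrite mulr1 counit1 scale1r.
Qed.

(** Both sides are convolution inverse to the multiplication of H ⊗ H: [F] is the
summand of the convolution of S(xy), xy and S(y)S(x), bracketed in two ways. *)
Lemma antipodeM x y : S (x * y) = S y * S x.
Proof.
pose F (a b c d e f : H) : H := S (a * d) * (b * e) * (S f * S c).
transitivity (\sw_(x1, x2 <- De x) \sw_(y1, y2 <- De y)
  \sw_(a1, a2 <- De x2) \sw_(b1, b2 <- De y2) F x1 a1 a2 y1 b1 b2).
- lhs 0 (rewrite -(@counitr _ _ _ (fun x => S (x * y))); lt).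
  apply: eq_sw => x1 x2.
  lhs 0 (rewrite -(@counitr _ _ _ (fun y => S (x1 * y))); lt).
  rewrite sw_scaler; apply: eq_sw => y1 y2.
  symmetry; rewrite /F.
  have E u a b c d : u * (a * b) * (c * d) = u * (a * (b * c * d)) :> H by rewrite !mulrA.
  lhs 2 (rewrite E).
  lhs 1 (rewrite -!sw_mulr -sw_mull antipoder -scalerAl mul1r -!scalerAr).
  rewrite -sw_scaler -sw_mulr antipoder -scalerAr mulr1.
  by rewrite scalerA mulrC -scalerA.
- lhs 1 (rewrite sw_exch).
  lhs 0 (rewrite -(comulA (F := fun a b c => \sw_(y1, y2 <- De y)
           \sw_(b1, b2 <- De y2) F a b c y1 b1 b2)); rewrite /F; lt).
  lhs 2 (rewrite -(comulA (F := fun d e f => F _ _ _ d e f)); rewrite /F; lt).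
  have -> : S y * S x = \sw_(x1, x2 <- De x) ep x1 *: (S y * S x2).
    by rewrite (@counitl _ _ _ (fun x => S y * S x)); lt.
  apply: eq_sw => x1 x2.
  rewrite -(@counitl _ _ _ (fun y => S y * S x2)); lt.
  lhs 0 (rewrite sw_exch); rewrite sw_scaler; apply: eq_sw => y1 y2.
  lhs 1 (rewrite -sw_mull).
  rewrite -sw_mull -(comulM (F := fun a b => S a * b)); lt.
  by rewrite antipodel counitM -scalerAl mul1r scalerA.
Qed.

(** The inverse of S is an antipode for the opposite coproduct: apply S, which is
antimultiplicative. *)
Lemma antipode_inverse : exists2 T : H -> H, lin T &
  forall h, \sw_(h1, h2 <- De h) h2 * T h1 = (ep h)%:A.
Proof.
have [T TS ST] := hopf_antipode_bij H.
have hT : lin T by move=> a x y; apply: (can_inj TS); rewrite linearP !ST.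
exists T => // h; apply: (can_inj TS).
rewrite sw_linear linearZ_LR antipode1 -antipoder.
by apply: eq_sw => a b; rewrite antipodeM ST.
Qed.

End Antipode.

Section RMatrix.
Variables (k : fieldType) (H : hopfAlg k) (Q : quasitriangular H).
Local Notation De := (hopf_comul H).
Local Notation ep x := (hopf_counit H x : k).
Local Notation R := (Rmat Q).
Local Notation Ri := (Rmat_inv Q).
Implicit Type X : lmodType k.

Lemma R_comull X (F : H -> H -> H -> X) : tril F ->
  \sw_(r, s <- R) \sw_(r1, r2 <- De r) F r1 r2 s =
  \sw_(r, s <- R) \sw_(r', s' <- R) F r r' (s * s').
Proof. exact: (tri_law (Rmat_comul_left Q)). Qed.

Lemma R_comulr X (F : H -> H -> H -> X) : tril F ->
  \sw_(r, s <- R) \sw_(s1, s2 <- De s) F r s1 s2 =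
  \sw_(r, s <- R) \sw_(r', s' <- R) F (r * r') s' s.
Proof. exact: (tri_law (Rmat_comul_right Q)). Qed.

Lemma R_comm X (F : H -> H -> X) h : bil F ->
  \sw_(r, s <- R) \sw_(h1, h2 <- De h) F (r * h1) (s * h2) =
  \sw_(r, s <- R) \sw_(h1, h2 <- De h) F (h2 * r) (h1 * s).
Proof. exact: (bi_law (Rmat_comm Q h)). Qed.

Lemma R_Ri X (F : H -> H -> X) : bil F ->
  \sw_(r, s <- R) \sw_(a, b <- Ri) F (r * a) (s * b) = F 1 1.
Proof.
move=> hF; rewrite -(sw_tens _ _ hF) -(RmatV Q) sw_sw //.
by apply: eq_sw => r s; rewrite sw_sw //; apply: eq_sw => a b; rewrite sw_tens.
Qed.

Lemma Ri_R X (F : H -> H -> X) : bil F ->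
  \sw_(a, b <- Ri) \sw_(r, s <- R) F (a * r) (b * s) = F 1 1.
Proof.
move=> hF; rewrite -(sw_tens _ _ hF) -(RmatVV Q) sw_sw //.
by apply: eq_sw => r s; rewrite sw_sw //; apply: eq_sw => a b; rewrite sw_tens.
Qed.

(** This inverts the hexagon relation for R: a factor R^-1 R is inserted, the hexagon
splits this R into two copies, and they cancel against the two copies of R^-1. *)
Lemma Ri_comulr X (G : H -> H -> H -> X) : tril G ->
  \sw_(a, b <- Ri) \sw_(b1, b2 <- De b) G a b1 b2 =
  \sw_(a, b <- Ri) \sw_(a', b' <- Ri) G (a * a') b b'.
Proof.
move=> hG; symmetry.
have E1 a b a' b' : G (a * a') b b' = \sw_(c, d <- Ri) \sw_(d1, d2 <- De d)
    \sw_(r, s <- R) \sw_(r', s' <- R)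
      G (c * (r * (r' * a) * a')) (d1 * (s' * b)) (d2 * (s * b')).
  pose F1 x y := \sw_(y1, y2 <- De y) G (x * a * a') (y1 * b) (y2 * b').
  have -> : G (a * a') b b' = F1 1 1.
    by rewrite /F1 comul1; lt; rewrite !mul1r.
  rewrite -Ri_R /F1; lt; apply: eq_sw => c d.
  lhs 1 (rewrite comulM; lt).
  rewrite sw_exch; apply: eq_sw => d1 d2.
  rewrite (R_comulr (F := fun r s1 s2 => G (c * r * _ * _) (d1 * s1 * _) (d2 * s2 * _))); lt.
  by apply: eq_sw => r s; apply: eq_sw => r' s'; rewrite !mulrA.
lhs 2 (rewrite E1).
lhs 1 (rewrite sw_exch); rewrite sw_exch; apply: eq_sw => c d.
lhs 1 (rewrite sw_exch); rewrite sw_exch; apply: eq_sw => d1 d2.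
lhs 1 (rewrite sw_exch); rewrite sw_exch.
lhs 2 (rewrite sw_exch); lhs 1 (rewrite sw_exch).
lhs 1 (rewrite (R_Ri (F := fun x y => \sw_(a', b' <- Ri)
          G (c * (_ * x * a')) (d1 * y) (d2 * (_ * b')))); lt).
lhs 2 (rewrite !mulr1).
by rewrite (R_Ri (F := fun x y => G (c * x) d1 (d2 * y))); lt; rewrite !mulr1.
Qed.

Lemma Ri_comull X (G : H -> H -> H -> X) : tril G ->
  \sw_(a, b <- Ri) \sw_(a1, a2 <- De a) G a1 a2 b =
  \sw_(a, b <- Ri) \sw_(a', b' <- Ri) G a' a (b * b').
Proof.
move=> hG; symmetry.
have E1 a b a' b' : G a' a (b * b') = \sw_(c, d <- Ri) \sw_(c1, c2 <- De c)
    \sw_(r, s <- R) \sw_(r', s' <- R)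
      G (c1 * (r * a')) (c2 * (r' * a)) (d * (s * (s' * b) * b')).
  pose F1 x y := \sw_(x1, x2 <- De x) G (x1 * a') (x2 * a) (y * b * b').
  have -> : G a' a (b * b') = F1 1 1.
    by rewrite /F1 comul1; lt; rewrite !mul1r.
  rewrite -Ri_R /F1; lt; apply: eq_sw => c d.
  lhs 1 (rewrite comulM; lt).
  rewrite sw_exch; apply: eq_sw => d1 d2.
  rewrite (R_comull (F := fun r1 r2 s => G (d1 * r1 * _) (d2 * r2 * _) (d * s * _ * _))); lt.
  by apply: eq_sw => r s; apply: eq_sw => r' s'; rewrite !mulrA.
lhs 2 (rewrite E1).
lhs 1 (rewrite sw_exch); rewrite sw_exch; apply: eq_sw => c d.
lhs 1 (rewrite sw_exch); rewrite sw_exch; apply: eq_sw => d1 d2.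
lhs 1 (rewrite sw_exch); rewrite sw_exch.
lhs 2 (rewrite sw_exch); lhs 1 (rewrite sw_exch).
lhs 1 (rewrite (R_Ri (F := fun x y => \sw_(a', b' <- Ri)
          G (d1 * (_ * a')) (d2 * x) (d * (_ * y * b')))); lt).
lhs 2 (rewrite !mulr1).
by rewrite (R_Ri (F := fun x y => G (d1 * x) d2 (d * y))); lt; rewrite !mulr1.
Qed.

Lemma Ri_comm X (G : H -> H -> X) h : bil G ->
  \sw_(a, b <- Ri) \sw_(h1, h2 <- De h) G (a * h2) (b * h1) =
  \sw_(a, b <- Ri) \sw_(h1, h2 <- De h) G (h1 * a) (h2 * b).
Proof.
move=> hG; symmetry.
have E1 a b : \sw_(h1, h2 <- De h) G (h1 * a) (h2 * b) =
    \sw_(c, d <- Ri) \sw_(r, s <- R) \sw_(h1, h2 <- De h)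
      G (c * (h2 * (r * a))) (d * (h1 * (s * b))).
  pose F1 x y := \sw_(h1, h2 <- De h) G (x * (h1 * a)) (y * (h2 * b)).
  transitivity (F1 1 1); first by rewrite /F1; apply: eq_sw => h1 h2; rewrite !mul1r.
  rewrite -Ri_R /F1; lt; apply: eq_sw => c d.
  transitivity (\sw_(r, s <- R) \sw_(h1, h2 <- De h)
      G (c * (r * h1 * a)) (d * (s * h2 * b))).
    by apply: eq_sw => r s; apply: eq_sw => h1 h2; rewrite !mulrA.
  rewrite (R_comm (F := fun x y => G (c * (x * a)) (d * (y * b)))); lt.
  by apply: eq_sw => r s; apply: eq_sw => h1 h2; rewrite !mulrA.
lhs 1 (rewrite E1).
rewrite sw_exch; apply: eq_sw => c d; rewrite sw_exch.
lhs 1 (rewrite sw_exch); rewrite sw_exch.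
apply: eq_sw => h1 h2.
by rewrite (R_Ri (F := fun x y => G (c * (_ * x)) (d * (_ * y)))); lt; rewrite !mulr1.
Qed.

(** For u = (eps ⊗ id)(R) the first hexagon relation, with eps applied to its first
leg, gives R = (1 ⊗ u) R; as R is invertible, u = 1. *)
Lemma R_counitl X (f : H -> X) : lin f -> \sw_(r, s <- R) ep r *: f s = f 1.
Proof.
move=> hf; pose u := \sw_(r, s <- R) ep r *: s.
have -> : \sw_(r, s <- R) ep r *: f s = f u.
  by rewrite /u (lin_sw _ _ hf); apply: eq_sw => r s; rewrite (linZ hf).
have E (G : H -> H -> X) : bil G -> \sw_(r, s <- R) G r s = \sw_(r, s <- R) G r (u * s).
  move=> hG; lhs 1 (rewrite -(counitl (f := fun r => G r _)); lt).
  rewrite (R_comull (F := fun r1 r2 s => ep r1 *: G r2 s)); lt.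
  rewrite sw_exch; apply: eq_sw => r s; rewrite /u sw_mull (lin_sw _ _ (hG.2 r)).
  by apply: eq_sw => r' s'; rewrite -scalerAl (linZ (hG.2 r)).
pose G x y := \sw_(a, b <- Ri) ep (x * a) *: f (y * b).
suff: f 1 = f u by move=> ->.
transitivity (\sw_(r, s <- R) G r s).
  by rewrite /G (R_Ri (F := fun x y => ep x *: f y)); lt; rewrite counit1 scale1r.
rewrite (E G) /G; lt; lhs 2 (rewrite -mulrA).
by rewrite (R_Ri (F := fun x y => ep x *: f (u * y))); lt; rewrite counit1 scale1r mulr1.
Qed.

Lemma R_counitr X (f : H -> X) : lin f -> \sw_(r, s <- R) ep s *: f r = f 1.
Proof.
move=> hf; pose u := \sw_(r, s <- R) ep s *: r.
have -> : \sw_(r, s <- R) ep s *: f r = f u.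
  by rewrite /u (lin_sw _ _ hf); apply: eq_sw => r s; rewrite (linZ hf).
have E (G : H -> H -> X) : bil G -> \sw_(r, s <- R) G r s = \sw_(r, s <- R) G (u * r) s.
  move=> hG; lhs 1 (rewrite -(counitr (f := fun s => G _ s)); lt).
  rewrite (R_comulr (F := fun r s1 s2 => ep s2 *: G r s1)); lt.
  rewrite sw_exch; apply: eq_sw => r s; rewrite /u sw_mull (lin_sw _ _ (hG.1 s)).
  by apply: eq_sw => r' s'; rewrite -scalerAl (linZ (hG.1 s)).
pose G x y := \sw_(a, b <- Ri) ep (y * b) *: f (x * a).
suff: f 1 = f u by move=> ->.
transitivity (\sw_(r, s <- R) G r s).
  by rewrite /G (R_Ri (F := fun x y => ep y *: f x)); lt; rewrite counit1 scale1r.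
rewrite (E G) /G; lt; lhs 2 (rewrite -mulrA).
by rewrite (R_Ri (F := fun x y => ep y *: f (u * x))); lt; rewrite counit1 scale1r mulr1.
Qed.

End RMatrix.

Section Flipped.
Variables (k : fieldType) (H : hopfAlg k) (Q : quasitriangular H).
Local Notation De := (hopf_comul H).
Local Notation ep x := (hopf_counit H x : k).
Local Notation R := (Rmat Q).
Local Notation Ri := (Rmat_inv Q).
Implicit Type X : lmodType k.

Fact flipped_RmatV : tensor_mul (flip Ri) (flip R) = 1 ⊗ 1.
Proof.
rewrite /tensor_mul flip_sw; lt; rewrite -(Ri_R Q (F := fun x y => y ⊗ x)); lt.
by apply: eq_sw => a b; rewrite flip_sw; lt.
Qed.
Fact flipped_RmatVV : tensor_mul (flip R) (flip Ri) = 1 ⊗ 1.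
Proof.
rewrite /tensor_mul flip_sw; lt; rewrite -(R_Ri Q (F := fun x y => y ⊗ x)); lt.
by apply: eq_sw => a b; rewrite flip_sw; lt.
Qed.
Fact flipped_comul_left :
  \sw_(r, s <- flip Ri) \sw_(r1, r2 <- De r) r1 ⊗ (r2 ⊗ s) =
  \sw_(r, s <- flip Ri) \sw_(r', s' <- flip Ri) r ⊗ (r' ⊗ (s * s')).
Proof.
rewrite !flip_sw; lt; rhs 1 (rewrite flip_sw; lt).
by rewrite (Ri_comulr Q (G := fun a b1 b2 => b1 ⊗ (b2 ⊗ a))); lt.
Qed.
Fact flipped_comul_right :
  \sw_(r, s <- flip Ri) \sw_(s1, s2 <- De s) r ⊗ (s1 ⊗ s2) =
  \sw_(r, s <- flip Ri) \sw_(r', s' <- flip Ri) (r * r') ⊗ (s' ⊗ s).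
Proof.
rewrite !flip_sw; lt; rhs 1 (rewrite flip_sw; lt).
by rewrite (Ri_comull Q (G := fun a1 a2 b => b ⊗ (a1 ⊗ a2))); lt.
Qed.
Fact flipped_comm (h : H) :
  \sw_(r, s <- flip Ri) \sw_(h1, h2 <- De h) (r * h1) ⊗ (s * h2) =
  \sw_(r, s <- flip Ri) \sw_(h1, h2 <- De h) (h2 * r) ⊗ (h1 * s).
Proof.
rewrite !flip_sw; lt.
by rewrite (Ri_comm Q (G := fun x y => y ⊗ x)); lt.
Qed.
(** The R-matrix R_21^-1, whose braiding is the inverse of that of R.  It makes every
statement about the braided category available for the inverse braiding. *)
Definition flipped : quasitriangular H :=
  Quasitriangular flipped_RmatV flipped_RmatVV flipped_comul_left
    flipped_comul_right flipped_comm.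

Lemma Ri_counitr X (f : H -> X) : lin f -> \sw_(a, b <- Ri) ep b *: f a = f 1.
Proof. by move=> hf; rewrite -(R_counitl flipped hf) flip_sw; lt. Qed.
Lemma Ri_counitl X (f : H -> X) : lin f -> \sw_(a, b <- Ri) ep a *: f b = f 1.
Proof. by move=> hf; rewrite -(R_counitr flipped hf) flip_sw; lt. Qed.

Section InvariantForm.
Variables (V W : lmodType k) (aV : {bilinear H -> V -> V}) (aW : {bilinear H -> W -> W}).
Variable f : V -> W -> k^o.
Hypotheses (VP : is_action aV) (WP : is_action aW) (hf : bil f).
Hypothesis f_inv : forall h v w,
  \sw_(h1, h2 <- De h) f (aV h1 v) (aW h2 w) = ep h * (f v w : k).

(** An invariant form moves h from its second argument to S^-1(h) on the first one, and
(id ⊗ S^-1)(R) = R^-1.  The second hexagon relation, with one copy of R cancelled,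
gives this without the antipode. *)
Lemma R_invariant_form X (g : H -> X) v w : lin g ->
  \sw_(r, s <- R) (f v (aW s w) : k) *: g r =
  \sw_(a, b <- Ri) (f (aV b v) w : k) *: g a.
Proof.
move=> hg.
have E x (g' : H -> X) : lin g' -> (f x w : k) *: g' 1 =
    \sw_(r, s <- R) \sw_(r', s' <- R) (f (aV s' x) (aW s w) : k) *: g' (r * r').
  move=> hg'; rewrite -(R_comulr Q (F := fun r s1 s2 => (f (aV s1 x) (aW s2 w) : k) *: g' r)); lt.
  lhs 0 (rewrite -(R_counitr Q (f := fun r => (f x w : k) *: g' r)); lt).
  apply: eq_sw => r s; rewrite -sw_scalel f_inv scalerA; congr (_ *: _).
rhs 1 (rewrite -[X in g X]mul1r (E _ (fun y => g (y * _))); lt).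
rewrite sw_exch; apply: eq_sw => r s.
rewrite sw_exch.
transitivity ((f (aV 1 v) (aW s w) : k) *: g (r * 1)); first by rewrite VP.1 mulr1.
rewrite -(R_Ri Q (F := fun x y => (f (aV y v) (aW s w) : k) *: g (r * x))); lt.
by apply: eq_sw => r' s'; apply: eq_sw => a b; rewrite VP.2 !mulrA.
Qed.
End InvariantForm.
End Flipped.

Lemma invariant_form (k : fieldType) (H : hopfAlg k) (V W : lmodType k)
    (aV : {bilinear H -> V -> V}) (aW : {bilinear H -> W -> W})
    (f : {linear (V ⊗ W)%type -> k^o}) :
  hequivariant (act_tensor aV aW) (@act_unit k H) f -> forall h x y,
  \sw_(h1, h2 <- hopf_comul H h) (f (aV h1 x ⊗ aW h2 y) : k^o) =
  (hopf_counit H h : k) * (f (x ⊗ y) : k).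
Proof.
move=> f_inv h x y; have := f_inv h (x ⊗ y); rewrite /act_tensor /act_unit => <-.
by rewrite sw_tens; lt; rewrite sw_linear.
Qed.

Lemma inverse_braidingE (k : fieldType) (H : hopfAlg k) (Q : quasitriangular H)
    (V W : lmodType k) (aV : {bilinear H -> V -> V}) (aW : {bilinear H -> W -> W}) :
  inverse_braiding Q aV aW = braiding (flipped Q) aV aW.
Proof.
apply/funext => t; rewrite /inverse_braiding /braiding; apply: eq_sw => v w.
by rewrite flip_sw; lt.
Qed.

(** * Twisted products inside a bosonization *)

Lemma lin_braiding (k : fieldType) (H : hopfAlg k) (Q : quasitriangular H)
    (V W : lmodType k) (aV : {bilinear H -> V -> V}) (aW : {bilinear H -> W -> W}) :
  lin (braiding Q aV aW).
Proof. rewrite /braiding; lintac. Qed.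
#[global] Hint Resolve lin_braiding : lin.

(** [V] and [W] are left D-comodules, with coactions [cV] and [cW].  Since D is the
cofree comodule on k, a form f on V ⊗ W extends to a colinear map V ⊗ W -> D, with
counit f.  All products below that involve a form are of this kind. *)
Section CofreeProduct.
Variables (k : fieldType) (H D : hopfAlg k) (iH : {lrmorphism H -> D}).
Variables (V W : lmodType k).
Variables (cV : V -> D ⊗ V) (cW : W -> D ⊗ W) (f : V -> W -> k^o).
Local Notation De := (hopf_comul H).
Local Notation ep x := (hopf_counit H x : k).
Local Notation DD := (hopf_comul D).
Local Notation epD x := (hopf_counit D x : k).
Hypotheses (cV_lin : lin cV) (cW_lin : lin cW) (f_bil : bil f).

Definition cofree (x : V) (y : W) : D :=
  \sw_(d, x' <- cV x) \sw_(d', y' <- cW y) (f x' y' : k) *: (d * d').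

Lemma cofree_bil : bil cofree.
Proof. rewrite /cofree; lintac. Qed.

Section Coassociative.
Hypothesis cVA : forall (X : lmodType k) (F : D -> D -> V -> X) e, tril F ->
  \sw_(d, e' <- cV e) \sw_(d1, d2 <- DD d) F d1 d2 e' =
  \sw_(d, e' <- cV e) \sw_(d', e'' <- cV e') F d d' e''.
Hypothesis cWA : forall (X : lmodType k) (F : D -> D -> W -> X) e, tril F ->
  \sw_(d, e' <- cW e) \sw_(d1, d2 <- DD d) F d1 d2 e' =
  \sw_(d, e' <- cW e) \sw_(d', e'' <- cW e') F d d' e''.

Lemma cofree_comul (X : lmodType k) (F : D -> D -> X) x y : bil F ->
  \sw_(z1, z2 <- DD (cofree x y)) F z1 z2 =
  \sw_(d, x' <- cV x) \sw_(d', y' <- cW y) F (d * d') (cofree x' y').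
Proof.
move=> hF; rewrite /cofree sw_linear sw_sw //.
lhs 1 (rewrite sw_linear sw_sw; lt).
lhs 2 (rewrite linearZ_LR sw_scale; lt; rewrite comulM; lt).
lhs 2 (rewrite sw_scaler).
lhs 1 (rewrite sw_exch).
lhs 0 (rewrite (cVA (F := fun d1 d2 x' => \sw_(d', y' <- cW y)
  (f x' y' : k) *: \sw_(a1, a2 <- DD d') F (d1 * a1) (d2 * a2))); lt).
apply: eq_sw => d x'.
lhs 2 (rewrite sw_scaler).
lhs 1 (rewrite (cWA (F := fun a1 a2 y' => (f _ y' : k) *: F (d * a1) (_ * a2))); lt).
rewrite sw_exch; apply: eq_sw => d' y'.
rewrite (lin_sw _ _ (hF.2 _)); apply: eq_sw => d2 x''.
rewrite (lin_sw _ _ (hF.2 _)); apply: eq_sw => d3 y''.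
by rewrite (linZ (hF.2 _)).
Qed.
End Coassociative.

Section Counital.
Hypothesis cV1 : forall (X : lmodType k) (g : V -> X) e, lin g ->
  \sw_(d, e' <- cV e) epD d *: g e' = g e.
Hypothesis cW1 : forall (X : lmodType k) (g : W -> X) e, lin g ->
  \sw_(d, e' <- cW e) epD d *: g e' = g e.

Lemma cofree_counit x y : epD (cofree x y) = f x y.
Proof.
rewrite /cofree sw_linear -(cV1 (g := f^~ y)); lt; apply: eq_sw => d x'.
rewrite sw_linear -(cW1 (g := f x')); lt.
rewrite sw_scaler; apply: eq_sw => d' y'.
rewrite linearZ_LR counitM /= [RHS]scalerA [LHS]mulrC; congr (_ * _).
Qed.
End Counital.

(** The hypotheses [cVH] and [cWH] are the Yetter-Drinfeld condition
h1 v_(-1) ⊗ h2 v_(0) = (h1 v)_(-1) h2 ⊗ (h1 v)_(0), with H mapped to D. *)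
Section Equivariance.
Variables (aV : {bilinear H -> V -> V}) (aW : {bilinear H -> W -> W}).
Hypothesis f_inv : forall h v w,
  \sw_(h1, h2 <- De h) f (aV h1 v) (aW h2 w) = ep h * (f v w : k).
Hypothesis cVH : forall (X : lmodType k) (F : D -> V -> X) h e, bil F ->
  \sw_(h1, h2 <- De h) \sw_(d, e' <- cV (aV h1 e)) F (d * iH h2) e' =
  \sw_(h1, h2 <- De h) \sw_(d, e' <- cV e) F (iH h1 * d) (aV h2 e').
Hypothesis cWH : forall (X : lmodType k) (F : D -> W -> X) h e, bil F ->
  \sw_(h1, h2 <- De h) \sw_(d, e' <- cW (aW h1 e)) F (d * iH h2) e' =
  \sw_(h1, h2 <- De h) \sw_(d, e' <- cW e) F (iH h1 * d) (aW h2 e').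

Lemma cofree_equiv h x y : iH h * cofree x y =
  \sw_(h1, h2 <- De h) \sw_(h3, h4 <- De h2) cofree (aV h1 x) (aW h3 y) * iH h4.
Proof.
symmetry; rewrite /cofree.
lhs 2 (rewrite sw_mull).
lhs 1 (rewrite sw_exch).
lhs 3 (rewrite sw_mull).
lhs 4 (rewrite -scalerAl -mulrA).
lhs 2 (rewrite (cWH (F := fun d w => (f _ w : k) *: (_ * d))); lt).
lhs 1 (rewrite sw_exch).
rewrite -(comulA (F := fun h1 h3 h4 => \sw_(d, x' <- cV (aV h1 x)) \sw_(d', y' <- cW y)
  (f x' (aW h4 y') : k) *: (d * (iH h3 * d')))); lt.
lhs 4 (rewrite mulrA).
lhs 1 (rewrite (cVH (F := fun d v => \sw_(d', y' <- cW y) (f v (aW _ y') : k) *: (d * d'))); lt).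
rewrite (comulA (F := fun h1 h2 h3 => \sw_(d, x' <- cV x) \sw_(d', y' <- cW y)
  (f (aV h2 x') (aW h3 y') : k) *: (iH h1 * d * d'))); lt.
rewrite sw_mulr.
lhs 1 (rewrite sw_exch); rewrite sw_exch; apply: eq_sw => d x'.
lhs 1 (rewrite sw_exch); rewrite sw_exch sw_mulr; apply: eq_sw => d' y'.
lhs 1 (rewrite -sw_scalel f_inv -scalerA).
rewrite (@counitr _ _ _ (fun h => _ *: (iH h * d * d'))); lt.
by rewrite -scalerAr mulrA.
Qed.
End Equivariance.
End CofreeProduct.
#[global] Hint Resolve cofree_bil : lin.

Section FactorDefs.
Variables (k : fieldType) (H : hopfAlg k) (Q : quasitriangular H).
Variables (E : algType k) (act : {bilinear H -> E -> E}).
Variables (DE : E -> E ⊗ E) (epE : E -> k^o) (D : hopfAlg k).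
Variables (iH : {lrmorphism H -> D}) (j : {lrmorphism E -> D}) (pi : D -> E).

(** The coproduct of D sends j(E) to D ⊗ j(E); this is the resulting coaction, given by
the bosonization formula. *)
Definition coact (e : E) : D ⊗ E :=
  \sw_(e1, e2 <- DE e) \sw_(r, s <- Rmat Q) (j e1 * iH s) ⊗ act r e2.

(** What the double has in common with respect to B and to C: E is an algebra in the
category braided by [Q], and D contains the smash product of E and H, with the
bosonized coproduct and a linear projection [pi] onto E. *)
Record is_factor : Prop := IsFactor {
  factor_act : is_action act;
  factor_comul_lin : lin DE;
  factor_counit_lin : lin epE;
  factor_proj_lin : lin pi;
  factor_proj : forall e, pi (j e) = e;
  factor_proj_H : forall x h, pi (x * iH h) = (hopf_counit H h : k) *: pi x;
  factor_smash : forall h e,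
    iH h * j e = \sw_(h1, h2 <- hopf_comul H h) j (act h1 e) * iH h2;
  factor_comul_H : forall h, hopf_comul D (iH h) =
    \sw_(h1, h2 <- hopf_comul H h) iH h1 ⊗ iH h2;
  factor_comul : forall e, hopf_comul D (j e) = \sw_(d, e' <- coact e) d ⊗ j e';
  factor_counit : forall e, hopf_counit D (j e) = epE e
}.

(** The product of E twisted by [sg], x · y = x_(1) y_(1) sg(x_(2), y_(2)), where the
coproducts are combined in the braided tensor square of E. *)
Definition twmul (sg : E ⊗ E -> k) (x y : E) : E :=
  \sw_(p, q <- comul2 (braiding Q act act) DE (x ⊗ y)) sg q *: tmult p.
End FactorDefs.

Section Factor.
Variables (k : fieldType) (H : hopfAlg k) (Q : quasitriangular H).
Variables (E : algType k) (act : {bilinear H -> E -> E}).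
Variables (DE : E -> E ⊗ E) (epE : E -> k^o) (D : hopfAlg k).
Variables (iH : {lrmorphism H -> D}) (j : {lrmorphism E -> D}) (pi : D -> E).
Local Notation De := (hopf_comul H).
Local Notation ep x := (hopf_counit H x : k).
Local Notation R := (Rmat Q).
Local Notation DD := (hopf_comul D).
Implicit Type X : lmodType k.
Hypothesis fac : is_factor Q act DE epE iH j pi.
Let actP := factor_act fac.
Let DE_lin := factor_comul_lin fac.
Let epE_lin := factor_counit_lin fac.
Let pi_lin := factor_proj_lin fac.
Let pi_j := factor_proj fac.
Let pi_H := factor_proj_H fac.
Let pi_jH e h : pi (j e * iH h) = ep h *: e.
Proof. by rewrite pi_H pi_j. Qed.
Let smash := factor_smash fac.
Let comul_iH := factor_comul_H fac.
Let comul_j := factor_comul fac.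
Let counit_j := factor_counit fac.
Local Notation coact := (coact Q act DE iH j).

Lemma coact_lin : lin coact.
Proof. rewrite /coact; lintac. Qed.
Hint Resolve coact_lin : lin.

Lemma coact_sw X (F : D -> E -> X) e : bil F -> \sw_(d, e' <- coact e) F d e' =
  \sw_(e1, e2 <- DE e) \sw_(r, s <- R) F (j e1 * iH s) (act r e2).
Proof.
move=> hF; rewrite sw_sw //; apply: eq_sw => e1 e2.
by rewrite sw_sw //; apply: eq_sw => r s; rewrite sw_tens.
Qed.

Lemma comul_j_sw X (F : D -> D -> X) e : bil F ->
  \sw_(d1, d2 <- DD (j e)) F d1 d2 = \sw_(d, e' <- coact e) F d (j e').
Proof.
by move=> hF; rewrite comul_j sw_sw //; apply: eq_sw => d e'; rewrite sw_tens.
Qed.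

Lemma coact_pi X (F : D -> E -> X) e : bil F ->
  \sw_(d, e' <- coact e) F d e' = \sw_(d1, d2 <- DD (j e)) F d1 (pi d2).
Proof.
move=> hF; rewrite comul_j_sw; lt.
by apply: eq_sw => d e'; rewrite pi_j.
Qed.

(** The coaction is the coproduct of D followed by the projection of the second leg
([coact_pi]), so coassociativity is inherited. *)
Lemma coactA X (F : D -> D -> E -> X) e : tril F ->
  \sw_(d, e' <- coact e) \sw_(d1, d2 <- DD d) F d1 d2 e' =
  \sw_(d, e' <- coact e) \sw_(d', e'' <- coact e') F d d' e''.
Proof.
move=> hF; rewrite coact_pi; lt.
rewrite (comulA (F := fun a b c => F a b (pi c))); lt.
rewrite comul_j_sw; lt; apply: eq_sw => d e'.
by rewrite (coact_pi (F := F d)); lt.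
Qed.

Lemma counit_coact X (f : E -> X) e : lin f ->
  \sw_(d, e' <- coact e) (hopf_counit D d : k) *: f e' = f e.
Proof.
move=> hf; rewrite coact_pi; lt.
by rewrite (@counitl _ _ _ (fun d => f (pi d))); lt; rewrite pi_j.
Qed.

Lemma pi_Hj h e : pi (iH h * j e) = act h e.
Proof.
rewrite smash (lin_sw _ _ pi_lin); lhs 1 (rewrite pi_jH).
by rewrite (@counitr _ _ _ (fun h => act h e)); lt.
Qed.

Lemma comul_iH_sw X (F : D -> D -> X) h : bil F ->
  \sw_(d1, d2 <- DD (iH h)) F d1 d2 = \sw_(h1, h2 <- De h) F (iH h1) (iH h2).
Proof.
by move=> hF; rewrite comul_iH sw_sw //; apply: eq_sw => a b; rewrite sw_tens.
Qed.

(** Both sides compute the coproduct of iH h * j e followed by [pi] on the second leg,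
once after moving h past e and once directly. *)
Lemma coact_act X (F : D -> E -> X) h e : bil F ->
  \sw_(h1, h2 <- De h) \sw_(d, e' <- coact (act h1 e)) F (d * iH h2) e' =
  \sw_(h1, h2 <- De h) \sw_(d, e' <- coact e) F (iH h1 * d) (act h2 e').
Proof.
move=> hF; transitivity (\sw_(z1, z2 <- DD (iH h * j e)) F z1 (pi z2)).
  rewrite smash sw_linear sw_sw; lt.
  rhs 1 (rewrite comulM; lt; rewrite comul_j_sw; lt).
  rhs 2 (rewrite comul_iH_sw; lt).
  rhs 3 (rewrite pi_jH (linZ (hF.2 _))).
  rhs 2 (rewrite (@counitr _ _ _ (fun h => F (_ * iH h) _)); lt).
  by [].
rewrite comulM; lt; rewrite comul_iH_sw; lt; apply: eq_sw => h1 h2.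
by rewrite comul_j_sw; lt; apply: eq_sw => d e'; rewrite pi_Hj.
Qed.

Lemma coact_counit X (f : D -> X) e : lin f ->
  \sw_(d, e' <- coact e) (epE e' : k) *: f d = f (j e).
Proof.
move=> hf; rewrite coact_pi; lt.
rewrite -(counitr (f := f)) //; rewrite !comul_j_sw; lt.
by apply: eq_sw => d e'; rewrite pi_j counit_j.
Qed.

Lemma coact1 X (F : D -> E -> X) : bil F -> \sw_(d, e <- coact 1) F d e = F 1 1.
Proof.
by move=> hF; rewrite coact_pi; lt; rewrite rmorph1 comul1; lt; rewrite -(rmorph1 j) pi_j.
Qed.

Section Form.
Variable sg : {linear (E ⊗ E)%type -> k^o}.
Hypothesis sg_inv : hequivariant (act_tensor act act) (@act_unit k H) sg.

Local Notation twmul := (twmul Q act DE sg).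

Lemma twmulE x y : twmul x y = \sw_(x1, x2 <- DE x) \sw_(y1, y2 <- DE y) \sw_(r, s <- R)
   (sg (act r x2 ⊗ y2) : k) *: (x1 * act s y1).
Proof.
rewrite /twmul comul2_sw; lt; apply: eq_sw => x1 x2; apply: eq_sw => y1 y2.
rewrite /braiding sw_tens; lt; rewrite sw_sw; lt.
by apply: eq_sw => r s; rewrite sw_tens; lt; rewrite tmult_tens.
Qed.

Lemma twmul_bil : bil twmul.
Proof. rewrite /twmul; lintac. Qed.
Hint Resolve twmul_bil : lin.

(** The two coactions bring in two copies of R.  By the second hexagon relation the
copy from x, on passing y, splits into the R of the braiding and a further copy; by
the first one, the latter combines with the copy from y into an element that acts
diagonally on the arguments of [sg], and the invariance of [sg] removes it. *)
Lemma j_twmul x y : j (twmul x y) =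
  \sw_(d, x' <- coact x) \sw_(d', y' <- coact y) (sg (x' ⊗ y') : k) *: (d * d').
Proof.
rewrite coact_sw; lt.
rewrite twmulE sw_linear; apply: eq_sw => x1 x2.
rhs 1 (rewrite coact_sw; lt).
rewrite sw_linear; rewrite [RHS]sw_exch; apply: eq_sw => y1 y2.
rhs 2 (rewrite -!mulrA [iH _ * (_ * _)]mulrA smash sw_mull sw_mulr sw_scaler).
rhs 1 (rewrite sw_exch).
(* the copy of R from x splits: s1 acts on y1, s2 stays in H *)
rhs 0 (rewrite (R_comulr Q (F := fun r s1 s2 => \sw_(a, b <- R)
  (sg (act r x2 ⊗ act a y2) : k) *: (j x1 * (j (act s1 y1) * iH s2 * iH b)))); lt).
rewrite sw_linear; rewrite sw_exch; apply: eq_sw => r s.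
rhs 2 (rewrite actP.2 -mulrA -rmorphM).
(* the copies with second leg in H combine *)
rhs 0 (rewrite -(R_comull Q (F := fun r1 r2 t =>
  (sg (act r1 (act r x2) ⊗ act r2 y2) : k) *: (j x1 * (j (act s y1) * iH t)))); lt).
rhs 1 (rewrite -sw_scalel (invariant_form sg_inv) -scalerA).
rewrite (R_counitl Q (f := fun t => _ *: (j x1 * (j (act s y1) * iH t)))); lt.
by rewrite linearZ_LR rmorphM rmorph1 mulr1.
Qed.

Lemma j_twmul_cofree x y : j (twmul x y) = cofree coact coact (fun x y => sg (x ⊗ y)) x y.
Proof. exact: j_twmul. Qed.

Lemma counit_twmul x y : epE (twmul x y) = sg (x ⊗ y).
Proof.
rewrite -counit_j j_twmul_cofree cofree_counit //; lt; exact: counit_coact.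
Qed.

(** The coaction is multiplicative for the twisted product because [j_twmul] is
colinear. *)
Lemma coact_twmul X (F : D -> E -> X) x y : bil F ->
  \sw_(d, e <- coact (twmul x y)) F d e =
  \sw_(d, x' <- coact x) \sw_(d', y' <- coact y) F (d * d') (twmul x' y').
Proof.
move=> hF; rewrite coact_pi; lt; rewrite j_twmul_cofree cofree_comul; lt; try exact: coactA.
by apply: eq_sw => d x'; apply: eq_sw => d' y'; rewrite -j_twmul_cofree pi_j.
Qed.

Lemma act_twmul h x y : act h (twmul x y) = \sw_(h1, h2 <- De h) twmul (act h1 x) (act h2 y).
Proof.
have fb : bil (fun x y => sg (x ⊗ y)) by lintac.
rewrite -pi_Hj j_twmul_cofree.
rewrite (cofree_equiv coact_lin fb (invariant_form sg_inv) (@coact_act) (@coact_act)).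
rewrite (lin_sw _ _ pi_lin); apply: eq_sw => h1 h2; rewrite (lin_sw _ _ pi_lin).
lhs 1 (rewrite -j_twmul_cofree pi_jH).
by rewrite (@counitr _ _ _ (fun h => twmul _ (act h y))); lt.
Qed.

Lemma twmul1l y : (forall x, sg (1 ⊗ x) = epE x) -> twmul 1 y = y.
Proof.
move=> s1; rewrite -[LHS]pi_j j_twmul coact1; lt.
lhs 0 (rewrite (lin_sw _ _ pi_lin)).
lhs 1 (rewrite s1 mul1r (linZ pi_lin)).
by rewrite coact_counit // pi_j.
Qed.

Lemma twmul1r x : (forall x, sg (x ⊗ 1) = epE x) -> twmul x 1 = x.
Proof.
move=> s1; rewrite -[LHS]pi_j j_twmul.
lhs 0 (rewrite (lin_sw _ _ pi_lin)).
lhs 1 (rewrite coact1; lt; rewrite s1 mulr1 (linZ pi_lin)).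
by rewrite coact_counit // pi_j.
Qed.

(** Both sides are colinear in x ⊗ y ⊗ z, so their equality is that of their counits,
which is the cocycle identity in the form of [cocycle_twist]. *)
Lemma twmulA x y z : (forall x y z, sg (x ⊗ twmul y z) = sg (twmul x y ⊗ z)) ->
  twmul x (twmul y z) = twmul (twmul x y) z.
Proof.
move=> coc; rewrite -[LHS]pi_j -[RHS]pi_j; congr pi; rewrite !j_twmul.
rewrite [RHS]coact_twmul; lt; apply: eq_sw => d x'.
rewrite coact_twmul; lt; apply: eq_sw => d' y'; apply: eq_sw => d2 z'.
by rewrite coc mulrA.
Qed.

End Form.
End Factor.

Section TwistedForm.
Variables (k : fieldType) (H : hopfAlg k) (Q : quasitriangular H).
Variables (E : algType k) (act : {bilinear H -> E -> E}).
Variables (DE : E -> E ⊗ E).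

(** The cocycle identity says that the form is associative for the product it twists. *)
Lemma cocycle_twist (s : {linear (E ⊗ E)%type -> k^o}) x y z :
  \sw_(p, q <- comul2 (braiding Q act act) DE (y ⊗ z)) s (x ⊗ tmult p) * s q =
  \sw_(p, q <- comul2 (braiding Q act act) DE (x ⊗ y)) s (tmult p ⊗ z) * s q ->
  s (x ⊗ twmul Q act DE s y z) = s (twmul Q act DE s x y ⊗ z).
Proof.
have hl : lin (fun u => s (x ⊗ u) : k^o) by lintac.
have hr : lin (fun u => s (u ⊗ z) : k^o) by lintac.
move=> coc; rewrite /twmul (lin_sw _ _ hl) (lin_sw _ _ hr).
lhs 1 (rewrite (linZ hl)); rhs 1 (rewrite (linZ hr)).
rewrite /GRing.scale /=.
by lhs 1 (rewrite mulrC); rhs 1 (rewrite mulrC).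
Qed.
End TwistedForm.

(** * Coboundaries inside a bosonization *)

Section FactorCoboundary.
Variables (k : fieldType) (H : hopfAlg k) (Q : quasitriangular H).
Variables (E : algType k) (act : {bilinear H -> E -> E}).
Variables (DE : E -> E ⊗ E) (epE : E -> k^o) (D : hopfAlg k).
Variables (iH : {lrmorphism H -> D}) (j : {lrmorphism E -> D}) (pi : D -> E).
Local Notation De := (hopf_comul H).
Local Notation ep x := (hopf_counit H x : k).
Implicit Type X : lmodType k.
Hypothesis fac : is_factor Q act DE epE iH j pi.
Let actP := factor_act fac.
Let DE_lin := factor_comul_lin fac.
Let epE_lin := factor_counit_lin fac.
Let pi_lin := factor_proj_lin fac.
Let pi_j := factor_proj fac.
Let pi_H := factor_proj_H fac.
Local Notation coact := (coact Q act DE iH j).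
Let coactl := coact_lin fac.
Hint Resolve coactl : lin.

(** The gauge map of a cochain: it is an isomorphism from the product twisted by the
coboundary transform to the original twisted product. *)
Definition gauge (be : E -> k) (x : E) : E := \sw_(x1, x2 <- DE x) be x2 *: x1.

Section Gauge.
Variable be : {linear E -> k^o}.
Hypothesis be_inv : hequivariant act (@act_unit k H) be.
Local Notation phi := (gauge be).

Lemma gauge_lin : lin phi.
Proof. rewrite /gauge; lintac. Qed.
Hint Resolve gauge_lin : lin.

Lemma j_gauge x : j (phi x) = \sw_(d, x' <- coact x) (be x' : k) *: d.
Proof.
rewrite coact_sw; lt; rewrite /gauge sw_linear; apply: eq_sw => x1 x2.
have bi h x' : be (act h x') = ep h * (be x' : k) :> k by exact: be_inv.
rhs 1 (rewrite bi -scalerA).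
rewrite (R_counitl Q (f := fun s => (be x2 : k) *: (j x1 * iH s))); lt.
by rewrite linearZ_LR rmorph1 mulr1.
Qed.

Lemma coact_gauge X (F : D -> E -> X) x : bil F ->
  \sw_(d, e <- coact (phi x)) F d e = \sw_(d, e <- coact x) F d (phi e).
Proof.
move=> hF; rewrite (coact_pi fac) // j_gauge sw_linear sw_sw; lt.
lhs 1 (rewrite linearZ_LR sw_scale; lt).
lhs 1 (rewrite sw_scaler).
rewrite (coactA fac (F := fun d1 d2 e => (be e : k) *: F d1 (pi d2))); lt.
apply: eq_sw => d e; rewrite -[RHS](congr1 (F d) (pi_j _)) j_gauge.
rewrite (lin_sw _ _ pi_lin) (lin_sw _ _ (hF.2 d)); apply: eq_sw => d' e'.
by rewrite (linZ pi_lin) (linZ (hF.2 d)).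
Qed.

Lemma act_gauge h x : act h (phi x) = phi (act h x).
Proof.
rewrite -[RHS]pi_j j_gauge (lin_sw _ _ pi_lin).
rewrite -(pi_Hj fac) j_gauge sw_mulr (lin_sw _ _ pi_lin).
have bi h' x' : be (act h' x') = ep h' * (be x' : k) :> k by exact: be_inv.
pose F d e := (be e : k) *: pi d.
transitivity (\sw_(h1, h2 <- De h) \sw_(d, e <- coact x) F (iH h1 * d) (act h2 e)).
  rewrite /F; rhs 2 (rewrite bi -scalerA).
  rhs 1 (rewrite -sw_scaler).
  rewrite (counitr (f := fun h => \sw_(d, e <- coact x) (be e : k) *: pi (iH h * d))); lt.
  by apply: eq_sw => d e; rewrite -scalerAr (linZ pi_lin).
rewrite -(coact_act fac) /F; lt.
lhs 2 (rewrite pi_H scaler_swap).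
lhs 1 (rewrite -sw_scaler).
rewrite (counitr (f := fun h => \sw_(d, e' <- coact (act h x)) (be e' : k) *: pi d)); lt.
by apply: eq_sw => d e; rewrite (linZ pi_lin).
Qed.
End Gauge.

(** The form sg^be, with [be'] in the role of the convolution inverse of [be]. *)
Definition coboundary (be be' : E -> k) (sg : E ⊗ E -> k) (x y : E) : k :=
  \sw_(x1, x2 <- DE x) \sw_(y1, y2 <- DE y)
  \sw_(x11, x12 <- DE x1) \sw_(y11, y12 <- DE y1)
  \sw_(u, v <- braiding Q act act (x12 ⊗ y11))
    be' (x11 * u) * sg (v ⊗ y12) * be x2 * be y2.

(** In the defining sum, the factors be x2 and be y2 belong to the gauge maps and sg
with the braiding belongs to the twisted product. *)
Lemma coboundaryE (be be' : {linear E -> k^o}) (sg : {linear (E ⊗ E)%type -> k^o}) x y :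
  coboundary be be' sg x y = be' (twmul Q act DE sg (gauge be x) (gauge be y)).
Proof.
rewrite /coboundary; have tb := twmul_bil fac sg.
have tbl y := tb.1 y; have tbr x := tb.2 x.
rewrite /gauge (lin_sw _ _ (tbl _)) sw_linear; apply: eq_sw => x1 x2.
rewrite (linZ (tbl _)) (lin_sw _ _ (tbr _)) linearZ_LR sw_linear sw_scaler.
apply: eq_sw => y1 y2; rewrite (linZ (tbr _)) linearZ_LR.
rewrite /twmul comul2_sw; lt; rewrite sw_linear !sw_scaler; apply: eq_sw => x11 x12.
rewrite sw_linear !sw_scaler; apply: eq_sw => y11 y12.
rewrite sw_linear !sw_scaler; apply: eq_sw => u v.
rewrite tmult_tens (linZ (lin_linear be')).
have A (a b c d : k) : a * b * c * d = c * (d * (b * a)) by ring.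
exact: A.
Qed.

Section TrivialGauge.
Variable be : {linear E -> k^o}.
Hypothesis be_inv : hequivariant act (@act_unit k H) be.
Hypothesis be_counit : forall x, be x = epE x.

Lemma gauge_counit x : gauge be x = x.
Proof.
rewrite -[LHS]pi_j (j_gauge be_inv); lhs 0 (rewrite (lin_sw _ _ pi_lin)).
lhs 1 (rewrite be_counit (linZ pi_lin)).
by rewrite (coact_counit fac) // pi_j.
Qed.

Lemma counit_inverse : convolution_inverse DE epE be be.
Proof.
move=> x; rewrite -(be_counit x) -[in RHS](gauge_counit x) /gauge sw_linear.
by split; apply: eq_sw => x1 x2; rewrite linearZ_LR mulrC.
Qed.

Lemma coboundary_counit (sg : {linear (E ⊗ E)%type -> k^o}) x y :
  hequivariant (act_tensor act act) (@act_unit k H) sg ->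
  coboundary be be sg x y = sg (x ⊗ y).
Proof.
by move=> sg_inv; rewrite coboundaryE !gauge_counit be_counit (counit_twmul fac sg_inv).
Qed.
End TrivialGauge.

Section Coboundary.
Variables (be be' : {linear E -> k^o}) (sg sg' : {linear (E ⊗ E)%type -> k^o}).
Hypothesis be_inv : hequivariant act (@act_unit k H) be.
Hypothesis be'_inv : hequivariant act (@act_unit k H) be'.
Hypothesis bb : convolution_inverse DE epE be be'.
Hypothesis sg_inv : hequivariant (act_tensor act act) (@act_unit k H) sg.
Hypothesis sg'_inv : hequivariant (act_tensor act act) (@act_unit k H) sg'.
Hypothesis sg'E : forall x y : E, sg' (x ⊗ y) = coboundary be be' sg x y.
Local Notation phi := (gauge be).
Local Notation phi' := (gauge be').

(** All maps involved are colinear, so both sides have the same image in D: the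
counits of the two agree by [coboundaryE]. *)
Lemma twmul_coboundary x y : twmul Q act DE sg' x y = phi' (twmul Q act DE sg (phi x) (phi y)).
Proof.
have tb := twmul_bil fac sg; have gl := gauge_lin be; have gl' := gauge_lin be'.
rewrite -[LHS]pi_j -[RHS]pi_j (j_twmul fac) // (j_gauge be'_inv); congr pi.
rewrite (coact_twmul fac sg_inv) ?(coact_gauge be_inv); lt; apply: eq_sw => d x'.
rewrite (coact_gauge be_inv); lt; apply: eq_sw => d' y'.
by rewrite sg'E coboundaryE.
Qed.

Lemma gauge_twmul x y : be (twmul Q act DE sg' x y) = sg (phi x ⊗ phi y).
Proof.
rewrite twmul_coboundary -(counit_twmul fac sg_inv) -(bb _).1 /gauge sw_linear.
by apply: eq_sw => x1 x2; rewrite linearZ_LR /= mulrC.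
Qed.
End Coboundary.
End FactorCoboundary.

(** * Cocycles over a Hopf algebra in vector spaces *)

Section Convolution.
Variables (k : fieldType) (D : hopfAlg k).
Local Notation DD := (hopf_comul D).
Local Notation epD x := (hopf_counit D x : k).
Implicit Types f g : D -> D -> k^o.

(** Convolution of bilinear forms on D, that is, the product of the dual algebra of the
coalgebra D ⊗ D. *)
Definition conv f g (x y : D) : k^o :=
  \sw_(x1, x2 <- DD x) \sw_(y1, y2 <- DD y) (f x1 y1 : k) *: g x2 y2.
Definition conv1 (x y : D) : k^o := (epD x * epD y : k).

Lemma conv_bil f g : bil f -> bil g -> bil (conv f g).
Proof. by move=> hf hg; rewrite /conv; lintac. Qed.
Lemma conv1_bil : bil conv1. Proof. by rewrite /conv1; lintac. Qed.

Lemma convA f g h x y : bil f -> bil g -> bil h ->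
  conv (conv f g) h x y = conv f (conv g h) x y.
Proof.
move=> hf hg hh; rewrite /conv.
lhs 2 (rewrite sw_scalel).
lhs 3 (rewrite sw_scalel).
lhs 1 (rewrite sw_exch).
rewrite (comulA (F := fun x1 x2 x3 => \sw_(y1, y2 <- DD y) \sw_(y3, y4 <- DD y1)
  ((f x1 y3 : k) *: g x2 y4 : k) *: h x3 y2)); lt.
apply: eq_sw => x1 x2.
rhs 1 (rewrite sw_scaler).
rewrite [RHS]sw_exch; apply: eq_sw => x3 x4.
rewrite (comulA (F := fun y1 y2 y3 => ((f x1 y1 : k) *: g x3 y2 : k) *: h x4 y3)); lt.
apply: eq_sw => y1 y2; rewrite sw_scaler; apply: eq_sw => y3 y4.
by rewrite scalerA.
Qed.

Lemma eq_conv f f' g g' : f =2 f' -> g =2 g' -> conv f g =2 conv f' g'.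
Proof.
move=> ff gg x y; rewrite /conv.
by apply: eq_sw => x1 x2; apply: eq_sw => y1 y2; rewrite ff gg.
Qed.

Lemma conv1l f x y : bil f -> conv conv1 f x y = f x y.
Proof.
move=> hf; rewrite /conv /conv1.
lhs 2 (rewrite -scalerA).
lhs 1 (rewrite -sw_scaler (counitl (f := f _)); lt).
by rewrite (counitl (f := f^~ y)); lt.
Qed.

Definition conv_inverse f g : Prop := conv f g =2 conv1 /\ conv g f =2 conv1.

Lemma conv_inverse_conv f f' g g' : bil f -> bil f' -> bil g -> bil g' ->
  conv_inverse f f' -> conv_inverse g g' -> conv_inverse (conv f g) (conv g' f').
Proof.
move=> hf hf' hg hg' [ff f'f] [gg g'g].
have hgf := conv_bil hg' hf'; have hfg := conv_bil hf hg.
split=> x y.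
- rewrite convA // -(ff x y); apply: eq_conv => // u v.
  by rewrite -convA // (eq_conv (f' := conv1) (g' := f')) // conv1l.
- rewrite convA // -(g'g x y); apply: eq_conv => // u v.
  by rewrite -convA // (eq_conv (f' := conv1) (g' := g)) // conv1l.
Qed.
End Convolution.

Lemma form_conv (k : fieldType) (H : hopfAlg k) (Q : quasitriangular H)
    (E : algType k) (act : {bilinear H -> E -> E}) (DE : E -> E ⊗ E)
    (s s' : {linear (E ⊗ E)%type -> k^o}) x y : lin DE ->
  \sw_(p, q <- comul2 (braiding Q act act) DE (x ⊗ y)) (s p : k) *: (s' q : k^o) =
  \sw_(x1, x2 <- DE x) \sw_(y1, y2 <- DE y) \sw_(r, t <- Rmat Q)
    (s (x1 ⊗ act t y1) : k) *: (s' (act r x2 ⊗ y2) : k^o).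
Proof.
move=> hD; rewrite comul2_sw; lt; apply: eq_sw => x1 x2; apply: eq_sw => y1 y2.
rewrite /braiding sw_tens; lt; rewrite sw_sw; lt; apply: eq_sw => r t.
by rewrite sw_tens; lt.
Qed.

Section VectorSpaceCocycles.
Variables (k : fieldType) (D : hopfAlg k).
Local Notation DD := (hopf_comul D).
Local Notation epD x := (hopf_counit D x : k).
Implicit Types (f g J : D -> D -> k^o) (be ga : D -> k^o).

Definition tensor_form J (hJ : bil J) : {linear (D ⊗ D)%type -> k^o} :=
  linmap (lin_sw_bil hJ).
Lemma tensor_formE J (hJ : bil J) x y : tensor_form hJ (x ⊗ y) = J x y.
Proof. exact: sw_tens. Qed.

Lemma comul2_flip (X : lmodType k) (F : D ⊗ D -> D ⊗ D -> X) x y : bil F ->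
  \sw_(p, q <- comul2 (@flip k D D) DD (x ⊗ y)) F p q =
  \sw_(x1, x2 <- DD x) \sw_(y1, y2 <- DD y) F (x1 ⊗ y1) (x2 ⊗ y2).
Proof.
move=> hF; rewrite comul2_sw; lt; apply: eq_sw => x1 x2; apply: eq_sw => y1 y2.
by rewrite flip_sw ?sw_tens; lt.
Qed.

Lemma tensor_form_conv f g (hf : bil f) (hg : bil g) x y :
  \sw_(p, q <- comul2 (@flip k D D) DD (x ⊗ y))
     (tensor_form hf p : k) *: tensor_form hg q = conv f g x y.
Proof.
rewrite comul2_flip; lt; apply: eq_sw => x1 x2; apply: eq_sw => y1 y2.
by rewrite !tensor_formE.
Qed.

Lemma tensor_form_inverse f g (hf : bil f) (hg : bil g) : conv_inverse f g ->
  convolution_inverse (comul2 (@flip k D D) DD) (counit2 (hopf_counit D))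
    (tensor_form hf) (tensor_form hg).
Proof.
move=> [fg gf].
have c2 : lin (counit2 (hopf_counit D) : _ -> k^o).
  exact: (@lin_sw_bil k D D k^o (@conv1 k D) (@conv1_bil k D)).
have cl : lin (comul2 (@flip k D D) DD) by apply: lin_comul2; lt.
have L (s s' : {linear (D ⊗ D)%type -> k^o}) : lin (fun t : D ⊗ D =>
    \sw_(p, q <- comul2 (@flip k D D) DD t) (s p : k) *: (s' q : k^o)) by lintac.
have c2E v w : counit2 (hopf_counit D) (v ⊗ w) = conv1 v w.
  exact: (@sw_tens k D D k^o _ v w (@conv1_bil k D)).
move=> t; split; move: t.
- by apply: (tensor_ext (L _ _) c2) => v w; rewrite tensor_form_conv fg c2E.
- by apply: (tensor_ext (L _ _) c2) => v w; rewrite tensor_form_conv gf c2E.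
Qed.

(** In vector spaces the braiding is the flip, so conditions on linear forms on D ⊗ D
are conditions on bilinear forms on D. *)
Lemma right_cocycle_of_form J (hJ : bil J) :
  (exists2 g, bil g & conv_inverse J g) ->
  (forall x y z,
    \sw_(y1, y2 <- DD y) \sw_(z1, z2 <- DD z) (J y2 z2 : k) *: J x (y1 * z1) =
    \sw_(x1, x2 <- DD x) \sw_(y1, y2 <- DD y) (J x2 y2 : k) *: J (x1 * y1) z) ->
  (forall x, J 1 x = epD x) -> (forall x, J x 1 = epD x) ->
  is_right_cocycle (E := in_Vect D) (tensor_form hJ).
Proof.
move=> [g hg Jg] coc J1 J1'; split=> //.
- by exists (tensor_form hg); split=> //; exact: tensor_form_inverse.
- move=> x y z /=; set F := tensor_form hJ.
  transitivity (\sw_(p, q <- comul2 (@flip k D D) DD (y ⊗ z))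
     (F q : k) *: F (x ⊗ tmult p)); first by apply: eq_sw => p q; exact: mulrC.
  transitivity (\sw_(p, q <- comul2 (@flip k D D) DD (x ⊗ y))
     (F q : k) *: F (tmult p ⊗ z)); last by apply: eq_sw => p q; exact: mulrC.
  rewrite !comul2_flip; lt.
  lhs 2 (rewrite tmult_tens !tensor_formE); rhs 2 (rewrite tmult_tens !tensor_formE).
  by rewrite coc.
- by move=> x; rewrite tensor_formE.
- by move=> x; rewrite tensor_formE.
Qed.

Definition lconv be ga (x : D) : k^o := \sw_(x1, x2 <- DD x) be x1 * ga x2.
Definition pullback be (x y : D) : k^o := be (x * y).
Definition square be (x y : D) : k^o := be x * be y.

Section LinearForms.
Implicit Types (b c : {linear D -> k^o}).

Lemma lconv_lin b c : lin (lconv b c).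
Proof.
have h : bil (fun x y => b x * c y : k^o) by lintac.
by rewrite /lconv => a x y; rewrite linearP; exact: (lin_sw_bil h).
Qed.
Lemma pullback_bil b : bil (pullback b). Proof. rewrite /pullback; lintac. Qed.
Lemma square_bil b : bil (square b). Proof. rewrite /square; lintac. Qed.

Lemma conv_pullback b c x y :
  conv (pullback b) (pullback c) x y = pullback (lconv b c) x y.
Proof.
by rewrite /pullback /lconv (comulM (F := fun u v => (b u * c v : k^o))); lt.
Qed.

Lemma conv_square b c x y :
  conv (square b) (square c) x y = square (lconv b c) x y.
Proof.
rewrite /square /lconv (sw_mull (A := k^o)); apply: eq_sw => x1 x2.
rewrite (sw_mulr (A := k^o)); apply: eq_sw => y1 y2.
by rewrite scalekE; ring.
Qed.

(** Pullback along the product of D is a convolution homomorphism and is injective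
(take y = 1), so facts about bilinear forms apply to linear forms. *)
Lemma pullback_inverse b c :
  convolution_inverse DD (hopf_counit D) b c <->
  conv_inverse (pullback b) (pullback c).
Proof.
split=> [bc | [bc cb] x].
  by split=> x y; rewrite conv_pullback /pullback /lconv /conv1 -counitM;
    [exact: (bc _).1 | exact: (bc _).2].
have := bc x 1; have := cb x 1.
by rewrite !conv_pullback /pullback /lconv /conv1 mulr1 counit1 mulr1 => -> ->.
Qed.
End LinearForms.

(** In the convolution algebra of D ⊗ D the relation reads
t = (beta^-1 m) * s * (beta ⊗ beta). *)
Lemma cohomologousE (s t : C2 (in_Vect D)) : cohomologous s t <->
  exists b c : {linear D -> k^o},
    [/\ convolution_inverse DD (hopf_counit D) b c, b 1 = 1 &
       (fun x y => t (x ⊗ y)) =2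
       conv (conv (pullback c) (fun x y => s (x ⊗ y))) (square b)].
Proof.
have hs : bil (fun x y : D => s (x ⊗ y) : k^o) by lintac.
have E (b c : {linear D -> k^o}) (x y : D) :
  \sw_(x1, x2 <- DD x) \sw_(y1, y2 <- DD y)
  \sw_(x11, x12 <- DD x1) \sw_(y11, y12 <- DD y1)
  \sw_(u, v <- flip (x12 ⊗ y11)) c (x11 * u) * s (v ⊗ y12) * b x2 * b y2 =
  conv (conv (pullback c) (fun x y => s (x ⊗ y))) (square b) x y :> k.
- apply: eq_sw => x1 x2; apply: eq_sw => y1 y2.
  rewrite [in RHS]/conv sw_scalel; apply: eq_sw => x11 x12.
  rewrite sw_scalel; apply: eq_sw => y11 y12.
  rewrite (@flip_sw k _ _ k^o _ (fun u v => c (x11 * u) * s (v ⊗ y12) * b x2 * b y2)); lt.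
  rewrite (@sw_tens k _ _ k^o); lt.
  by rewrite /pullback /square !scalekE; ring.
split=> [[b [c [_ _ bc b1 e]]] | [b [c [bc b1 e]]]]; exists b, c; split=> // x y.
- by rewrite e -E.
- by rewrite e -E.
Qed.

(** With both relations in the form of [cohomologousE], transitivity is associativity
of convolution, for the cochain b * c. *)
Lemma cohomologous_trans (s1 s2 s3 : C2 (in_Vect D)) :
  cohomologous s1 s2 -> cohomologous s2 s3 -> cohomologous s1 s3.
Proof.
move=> /cohomologousE [b [b' [bb' b1 e2]]] /cohomologousE [c [c' [cc' c1 e3]]].
have hs (s : C2 (in_Vect D)) : bil (fun x y : D => s (x ⊗ y) : k^o) by lintac.
have [hb hb'] := (square_bil b, pullback_bil b').
have [hc hc'] := (square_bil c, pullback_bil c').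
apply/cohomologousE; exists (linmap (lconv_lin b c)), (linmap (lconv_lin c' b')).
split.
- apply/pullback_inverse.
  have [i1 i2] := conv_inverse_conv (pullback_bil b) hb' (pullback_bil c) hc'
    ((pullback_inverse _ _).1 bb') ((pullback_inverse _ _).1 cc').
  split=> x y; [rewrite -i1 | rewrite -i2];
    by apply: eq_conv => u v; rewrite conv_pullback.
- by rewrite /= /lconv (comul1 (F := fun u v => (b u * c v : k^o))) ?b1 ?c1 ?mulr1; lt.
move=> x y; rewrite e3.
transitivity (conv (conv (pullback c')
  (conv (conv (pullback b') (fun x y => s1 (x ⊗ y))) (square b))) (square c) x y).
  by do 2 apply: eq_conv => // ? ?.
transitivity (conv (conv (conv (pullback c') (pullback b')) (fun x y => s1 (x ⊗ y)))
  (conv (square b) (square c)) x y).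
  rewrite -convA //; try exact: conv_bil; try (do 2 apply: conv_bil => //).
  apply: eq_conv => // u v.
  rewrite -convA //; try exact: conv_bil.
  by apply: eq_conv => // u' v'; rewrite convA //.
apply: eq_conv => u v; last exact: conv_square.
by apply: eq_conv => // u' v'; exact: conv_pullback.
Qed.
End VectorSpaceCocycles.

Section Classes.
Variables (k : fieldType) (E : bialgebra_in_category k).

Definition coh_rep (P : H2 E) : C2 E := projT1 (cid (proj2_sig P)).

(** The class of s determines s only up to ~, but as a set it contains s and its
representative, whence the two relations. *)
Lemma coh_repP (s : C2 E) : (forall t : C2 E, cohomologous t t) ->
  cohomologous (coh_rep (coh_class s)) s /\ cohomologous s (coh_rep (coh_class s)).
Proof.
rewrite /coh_rep => refl; case: cid => s' /= E'.
by split; [rewrite -E' | rewrite E']; exact: refl.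
Qed.

Lemma coh_class_eq (s t : C2 E) :
  (forall s1 s2 s3 : C2 E, cohomologous s1 s2 -> cohomologous s2 s3 -> cohomologous s1 s3) ->
  cohomologous s t -> cohomologous t s -> coh_class s = coh_class t.
Proof.
move=> trans st ts; apply: eq_exist; apply/funext => u; apply/propext.
by split; [exact: trans | exact: trans].
Qed.
End Classes.

(** * The triangular decomposition of the double *)

Section DrinfeldDouble.
Variables (k : fieldType) (H : hopfAlg k) (Q : quasitriangular H).
Variables (C B : braidedHopfAlg Q) (e : weakly_dual C B) (D : drinfeld_double e).
Local Notation De := (hopf_comul H).
Local Notation ep x := (hopf_counit H x : k).
Local Notation epB x := (bh_counit B x : k).
Local Notation epC x := (bh_counit C x : k).
Local Notation epD x := (hopf_counit D x : k).
Local Notation aB := (bh_act B).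
Local Notation aC := (bh_act C).
Local Notation iH := (drin_H D).
Local Notation jB := (drin_B D).
Local Notation jC := (drin_C D).
Local Notation DD := (hopf_comul D).
Local Notation dB := (bh_comul B).
Local Notation dC := (bh_comul C).
Local Notation cop := (@cop_comul k H Q C).
Local Notation coactC := (coact (flipped Q) aC cop iH jC).
Local Notation coactB := (coact Q aB dB iH jB).
Implicit Type X : lmodType k.

Definition trimul (t : B ⊗ (H ⊗ C)) : D :=
  \sw_(b, u <- t) \sw_(h, c <- u) jB b * iH h * jC c.

Lemma trimul_lin : lin trimul.
Proof. rewrite /trimul; lintac. Qed.

Fact trimul_inverse_sig : {g : D -> B ⊗ (H ⊗ C) | cancel trimul g & cancel g trimul}.
Proof.
apply/cid2; have [g gK Kg] := drin_triangular D.
by exists g.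
Qed.
Definition triinv : D -> B ⊗ (H ⊗ C) := s2val trimul_inverse_sig.
Lemma trimulK : cancel trimul triinv. Proof. exact: (s2valP trimul_inverse_sig). Qed.
Lemma triinvK : cancel triinv trimul. Proof. exact: (s2valP' trimul_inverse_sig). Qed.
Lemma triinv_lin : lin triinv.
Proof. by move=> a x y; apply: (can_inj trimulK); rewrite trimul_lin !triinvK. Qed.
Hint Resolve trimul_lin triinv_lin : lin.

Definition triext X (f : B -> H -> C -> X) (x : D) : X :=
  \sw_(b, u <- triinv x) \sw_(h, c <- u) f b h c.

Lemma triext_lin X (f : B -> H -> C -> X) : tril f -> lin (triext f).
Proof. by move=> hf; rewrite /triext; lintac. Qed.

Lemma triextE X (f : B -> H -> C -> X) b h c : tril f ->
  triext f (jB b * iH h * jC c) = f b h c.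
Proof.
move=> hf; rewrite /triext; have <- : trimul (b ⊗ (h ⊗ c)) = jB b * iH h * jC c.
  by rewrite /trimul !sw_tens; lt.
by rewrite trimulK !sw_tens; lt.
Qed.

(** The double in the order B C H instead of B H C: right multiplication by H then
commutes with all the multiplications from the left that make up the twisted product. *)
Definition bch (b : B) (c : C) (h : H) : D := jB b * jC c * iH h.
Lemma bch_tril : tril bch.
Proof. by split=> *; rewrite /bch; lintac. Qed.

(** The linear map with prescribed values on the elements b c h, defined through the
decomposition b h c by means of h c = (h_(1) c) h_(2). *)
Definition ext X (f : B -> C -> H -> X) : D -> X :=
  triext (fun b h c => \sw_(h1, h2 <- De h) f b (aC h1 c) h2).

Lemma ext_lin X (f : B -> C -> H -> X) : tril f -> lin (ext f).
Proof. by move=> hf; apply: triext_lin; lintac. Qed.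

Lemma ext_bil X (Y : lmodType k) (f : Y -> B -> C -> H -> X) :
  (forall y, tril (f y)) -> (forall b c h, lin (fun y => f y b c h)) ->
  bil (fun y => ext (f y)).
Proof.
move=> hf hy; split=> [x | y]; last exact: ext_lin.
by rewrite /ext /triext; do 3 (apply: lin_sw_body => ? ?); apply: hy.
Qed.

Lemma iH_jC h c : iH h * jC c = \sw_(h1, h2 <- De h) jC (aC h1 c) * iH h2.
Proof. exact: (drin_rel_HC (drin_rel D)). Qed.
Lemma iH_jB h b : iH h * jB b = \sw_(h1, h2 <- De h) jB (aB h1 b) * iH h2.
Proof. exact: (drin_rel_HB (drin_rel D)). Qed.

(** To evaluate [ext] one must also rewrite c h in the order h c.  This takes the
inverse [T] of the antipode: c h = h_(2) (T(h_(1)) c). *)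
Section CoAntipode.
Variables (T : H -> H) (hT : lin T).
Hypothesis TP : forall h, \sw_(h1, h2 <- De h) h2 * T h1 = (ep h)%:A.

Lemma coantipode_cancel X (F : C -> H -> X) c h : bil F ->
  \sw_(h1, h2 <- De h) \sw_(h3, h4 <- De h2) F (aC h3 (aC (T h1) c)) h4 = F c h.
Proof.
move=> hF; rewrite -(comulA (F := fun h1 h3 h4 => F (aC h3 (aC (T h1) c)) h4)); lt.
rewrite -[RHS](@counitl _ _ _ (F c)); lt; apply: eq_sw => h1 h2.
lhs 1 (rewrite -(bh_actP C).2).
rewrite -(lin_sw _ _ (hF.1 h2)) -sw_bill TP linearZl_LR (bh_actP C).1.
by rewrite (linZ (hF.1 h2)).
Qed.

Lemma jC_iH c h : jC c * iH h = \sw_(h1, h2 <- De h) iH h2 * jC (aC (T h1) c).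
Proof.
lhs 0 (rewrite -(coantipode_cancel (F := fun c h => jC c * iH h)); lt).
by apply: eq_sw => h1 h2; rewrite iH_jC.
Qed.
End CoAntipode.

Lemma extE X (f : B -> C -> H -> X) b c h : tril f -> ext f (bch b c h) = f b c h.
Proof.
move=> hf; have [T hT TP] := antipode_inverse H.
rewrite /bch -mulrA (jC_iH hT TP) sw_mulr (lin_sw _ _ (ext_lin hf)).
lhs 1 (rewrite mulrA /ext triextE; lt).
by rewrite (coantipode_cancel (F := f b) hT TP); lt.
Qed.

Lemma bch_ext X (f g : D -> X) : lin f -> lin g ->
  (forall b c h, f (bch b c h) = g (bch b c h)) -> f =1 g.
Proof.
move=> hf hg fg x; rewrite -[x]triinvK /trimul.
rewrite (lin_sw _ _ hf) (lin_sw _ _ hg); apply: eq_sw => b u.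
rewrite (lin_sw _ _ hf) (lin_sw _ _ hg); apply: eq_sw => h c.
rewrite -mulrA iH_jC sw_mulr (lin_sw _ _ hf) (lin_sw _ _ hg); apply: eq_sw => h1 h2.
by rewrite mulrA -/(bch _ _ _).
Qed.

Lemma iH_bch h b c h' : iH h * bch b c h' =
  \sw_(h1, h2 <- De h) \sw_(h3, h4 <- De h2) bch (aB h1 b) (aC h3 c) (h4 * h').
Proof.
rewrite /bch -mulrA mulrA iH_jB sw_mull; apply: eq_sw => h1 h2.
rewrite mulrA -[_ * _ * jC c]mulrA iH_jC sw_mulr sw_mull; apply: eq_sw => h3 h4.
by rewrite rmorphM !mulrA.
Qed.

Lemma bch_iH b c h h' : bch b c h * iH h' = bch b c (h * h').
Proof. by rewrite /bch rmorphM !mulrA. Qed.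
Lemma jB_bch b b' c h : jB b * bch b' c h = bch (b * b') c h.
Proof. by rewrite /bch rmorphM !mulrA. Qed.
Lemma bch1 b c h : [/\ bch b 1 1 = jB b, bch 1 c 1 = jC c & bch 1 1 h = iH h].
Proof. by rewrite /bch !rmorph1 !mulr1 !mul1r. Qed.

Definition piB : D -> B := ext (fun b c h => epC c *: (ep h *: b)).
Definition piC : D -> C := ext (fun b c h => epB b *: (ep h *: c)).
Lemma piB_lin : lin piB. Proof. by apply: ext_lin; lintac. Qed.
Lemma piC_lin : lin piC. Proof. by apply: ext_lin; lintac. Qed.
Hint Resolve piB_lin piC_lin : lin.
Lemma piBE b c h : piB (bch b c h) = epC c *: (ep h *: b).
Proof. by rewrite /piB extE; lt. Qed.
Lemma piCE b c h : piC (bch b c h) = epB b *: (ep h *: c).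
Proof. by rewrite /piC extE; lt. Qed.

Lemma piB_iHr x h : piB (x * iH h) = ep h *: piB x.
Proof.
move: x; apply: bch_ext => [||b' c' h']; lt.
by rewrite bch_iH !piBE counitM [ep h' * _]mulrC -scalerA [RHS]scalerA mulrC -scalerA.
Qed.
Lemma piC_iHr x h : piC (x * iH h) = ep h *: piC x.
Proof.
move: x; apply: bch_ext => [||b' c' h']; lt.
by rewrite bch_iH !piCE counitM [ep h' * _]mulrC -scalerA [RHS]scalerA mulrC -scalerA.
Qed.
Lemma piB_jB1 b : piB (jB b) = b.
Proof.
have [<- _ _] := bch1 b 1 1.
by rewrite piBE (counit_one (bh_bialgebra C)) counit1 !scale1r.
Qed.
Lemma piC_jC c : piC (jC c) = c.
Proof.
have [_ <- _] := bch1 1 c 1.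
by rewrite piCE (counit_one (bh_bialgebra B)) counit1 !scale1r.
Qed.

Lemma lin_cop_comul : lin cop.
Proof. rewrite /cop_comul; lintac. Qed.
Hint Resolve lin_cop_comul : lin.

Lemma factorB : is_factor Q aB (bh_comul B) (bh_counit B) iH jB piB.
Proof.
split; lt.
- exact: bh_actP.
- exact: piB_jB1.
- exact: piB_iHr.
- exact: iH_jB.
- exact: drin_comul_H.
- move=> b; rewrite drin_comul_B /coact sw_sw; lt; apply: eq_sw => b1 b2.
  by rewrite sw_sw; lt; apply: eq_sw => r s; rewrite sw_tens; lt.
- exact: drin_counit_B.
Qed.

(** The bosonization formula for R_21^-1 and the opposite coproduct, with H moved to
the left of C: one of the two copies of R^-1 is absorbed by this reordering. *)
Lemma coactC_sw X (F : D -> C -> X) c : bil F ->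
  \sw_(d, c' <- coactC c) F d c' = \sw_(c1, c2 <- bh_comul C c)
    \sw_(r, s <- Rmat_inv Q) F (iH r * jC c2) (aC s c1).
Proof.
move=> hF; rewrite coact_sw // /cop_comul sw_sw; lt; apply: eq_sw => c1 c2.
rewrite sw_sw; lt.
lhs 1 (rewrite sw_tens; lt; rewrite flip_sw; lt).
rhs 1 (rewrite iH_jC (lin_sw _ _ (hF.1 _))).
rewrite (Ri_comull Q (G := fun a1 a2 b => F (jC (aC a1 c2) * iH a2) (aC b c1))); lt.
rewrite sw_exch; apply: eq_sw => a b; apply: eq_sw => a' b'.
by rewrite (bh_actP C).2.
Qed.

Lemma factorC : is_factor (flipped Q) aC (cop) (bh_counit C) iH jC piC.
Proof.
split; lt.
- exact: bh_actP.
- exact: piC_jC.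
- exact: piC_iHr.
- exact: iH_jC.
- exact: drin_comul_H.
- by move=> c; rewrite coactC_sw ?drin_comul_C; lt.
- exact: drin_counit_C.
Qed.

Local Notation fac_coactA := (@coactA _ _ _ _ _ _ _ _ _ _ _).
Local Notation fac_counit := (@counit_coact _ _ _ _ _ _ _ _ _ _ _).
Local Notation fac_act := (@coact_act _ _ _ _ _ _ _ _ _ _ _).
Let fB := factorB.
Let fC := factorC.
Let coactB_lin : lin coactB := coact_lin fB.
Let coactC_lin : lin coactC := coact_lin fC.
Let bch_lin1 c h : lin (fun b => bch b c h) := tril1 bch_tril c h.
Let bch_lin2 b h : lin (fun c => bch b c h) := tril2 bch_tril b h.
Let bch_lin3 b c : lin (fun h => bch b c h) := tril3 bch_tril b c.
Let piBl : lin piB := piB_lin.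
Let piCl : lin piC := piC_lin.
Hint Resolve coactB_lin coactC_lin bch_lin1 bch_lin2 bch_lin3 : lin.

(** * The twisted product on the double *)

Lemma comul_bch X (F : D -> D -> X) b c h : bil F ->
  \sw_(z1, z2 <- DD (bch b c h)) F z1 z2 =
  \sw_(d, b' <- coactB b) \sw_(d', c' <- coactC c) \sw_(h1, h2 <- De h)
    F (d * d' * iH h1) (bch b' c' h2).
Proof.
move=> hF; rewrite /bch comulM; lt; rewrite comulM; lt.
rewrite (comul_j_sw fB); lt; apply: eq_sw => d b'.
rewrite (comul_j_sw fC); lt; apply: eq_sw => d' c'.
by rewrite (comul_iH_sw fB); lt.
Qed.

Lemma counit_bch b c h : epD (bch b c h) = epB b * epC c * ep h.
Proof. by rewrite /bch !counitM drin_counit_B drin_counit_C drin_counit_H. Qed.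

Lemma epC_act h c : epC (aC h c) = ep h * epC c.
Proof. exact: (bh_counit_equiv h c). Qed.
Lemma epB_act h b : epB (aB h b) = ep h * epB b.
Proof. exact: (bh_counit_equiv h b). Qed.

Definition evf (c : C) (b : B) : k^o := ev e (c ⊗ b).
Lemma evf_bil : bil evf. Proof. rewrite /evf; lintac. Qed.
Hint Resolve evf_bil : lin.
Lemma evf_inv h c b : \sw_(h1, h2 <- De h) evf (aC h1 c) (aB h2 b) = ep h * (evf c b : k).
Proof. exact: (invariant_form (ev_equiv e)). Qed.

(** The twisted product of c and b: one side of the defining relation of the double,
with B on the left of C. *)
Definition cross (c : C) (b : B) : D :=
  \sw_(b1, b2 <- dB b) \sw_(c1, c2 <- dC c) \sw_(r, s <- Rmat_inv Q)
    (evf c2 b1 : k) *: (jB (aB r b2) * jC (aC s c1)).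
Lemma cross_bil : bil cross. Proof. rewrite /cross; lintac. Qed.
Hint Resolve cross_bil : lin.

(** This is the defining relation of the double, the other side of which is the colinear
extension of ev. *)
Lemma cross_cofree c b : cross c b = cofree coactC coactB evf c b.
Proof.
rewrite /cross (drin_rel_CB (drin_rel D)) /cofree coactC_sw; lt.
rewrite sw_exch; apply: eq_sw => c1 c2.
rewrite sw_exch; apply: eq_sw => r s.
rewrite coact_sw; lt; apply: eq_sw => b1 b2.
by apply: eq_sw => r' s'; rewrite !mulrA.
Qed.

Lemma comul_cross X (F : D -> D -> X) c b : bil F ->
  \sw_(z1, z2 <- DD (cross c b)) F z1 z2 =
  \sw_(d, c' <- coactC c) \sw_(d', b' <- coactB b) F (d * d') (cross c' b').
Proof.
move=> hF; rewrite cross_cofree (cofree_comul evf_bil (fac_coactA fC) (fac_coactA fB)) //.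
by apply: eq_sw => d c'; apply: eq_sw => d' b'; rewrite cross_cofree.
Qed.

Lemma counit_cross c b : epD (cross c b) = evf c b.
Proof.
rewrite cross_cofree; exact: (cofree_counit evf_bil (fac_counit fC) (fac_counit fB)).
Qed.

Lemma iH_cross h c b : iH h * cross c b =
  \sw_(h1, h2 <- De h) \sw_(h3, h4 <- De h2) cross (aC h1 c) (aB h3 b) * iH h4.
Proof.
rewrite cross_cofree (cofree_equiv coactC_lin evf_bil evf_inv (fac_act fC) (fac_act fB)).
by apply: eq_sw => h1 h2; apply: eq_sw => h3 h4; rewrite cross_cofree.
Qed.

Lemma cross_bch c b : cross c b = \sw_(b1, b2 <- dB b) \sw_(c1, c2 <- dC c)
  \sw_(r, s <- Rmat_inv Q) (evf c2 b1 : k) *: bch (aB r b2) (aC s c1) 1.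
Proof.
apply: eq_sw => b1 b2; apply: eq_sw => c1 c2; apply: eq_sw => r s.
by rewrite /bch rmorph1 mulr1.
Qed.

(** The twisted product is assembled from left multiplication by B ([lmulB]) and by C
([lmulC]) and right multiplication by C ([rmulC]). *)
Section Forms.
Variables (sg : {linear (B ⊗ B)%type -> k^o}) (ta : {linear (C ⊗ C)%type -> k^o}).
Local Notation mB := (twmul Q aB dB sg).
Local Notation mC := (twmul (flipped Q) aC (cop) ta).
Hypothesis sg_inv : hequivariant (act_tensor aB aB) (@act_unit k H) sg.
Hypothesis ta_inv : hequivariant (act_tensor aC aC) (@act_unit k H) ta.
Hypothesis sg_coc : forall x y z, sg (x ⊗ mB y z) = sg (mB x y ⊗ z).
Hypothesis ta_coc : forall x y z, ta (x ⊗ mC y z) = ta (mC x y ⊗ z).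
Hypothesis sg1l : forall x, sg (1 ⊗ x) = bh_counit B x.
Hypothesis sg1r : forall x, sg (x ⊗ 1) = bh_counit B x.
Hypothesis ta1l : forall x, ta (1 ⊗ x) = bh_counit C x.
Hypothesis ta1r : forall x, ta (x ⊗ 1) = bh_counit C x.

Let mB_bil : bil mB := twmul_bil fB sg.
Let mC_bil : bil mC := twmul_bil fC ta.
Hint Resolve mB_bil mC_bil : lin.

Definition lmulB (b : B) : D -> D := ext (fun b' c h => bch (mB b b') c h).
Lemma lmulBE b b' c h : lmulB b (bch b' c h) = bch (mB b b') c h.
Proof. by rewrite /lmulB extE; lt. Qed.
Lemma lmulB_bil : bil lmulB.
Proof. by apply: ext_bil; lt. Qed.
Hint Resolve lmulB_bil : lin.
Lemma lmulB_iH b x h : lmulB b (x * iH h) = lmulB b x * iH h.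
Proof.
move: x; apply: bch_ext => [||b' c h']; lt.
by rewrite bch_iH !lmulBE bch_iH.
Qed.
Lemma lmulB1 x : lmulB 1 x = x.
Proof.
by move: x; apply: bch_ext => [||b' c h']; lt; rewrite lmulBE (twmul1l fB sg_inv).
Qed.
Lemma lmulB_lmulB b b' x : lmulB b (lmulB b' x) = lmulB (mB b b') x.
Proof.
by move: x; apply: bch_ext => [||b0 c h]; lt; rewrite !lmulBE (twmulA fB sg_inv).
Qed.
Lemma iH_lmulB h b x : iH h * lmulB b x = \sw_(h1, h2 <- De h) lmulB (aB h1 b) (iH h2 * x).
Proof.
move: x; apply: bch_ext => [||b0 c h']; lt.
rewrite lmulBE iH_bch.
rhs 1 (rewrite iH_bch (lin_sw _ _ (lmulB_bil.2 _))).
rhs 2 (rewrite (lin_sw _ _ (lmulB_bil.2 _))).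
rhs 3 (rewrite lmulBE).
lhs 2 (rewrite (act_twmul fB sg_inv) (lin_sw _ _ (bch_lin1 _ _))).
lhs 1 (rewrite sw_exch).
by rewrite (comulA (F := fun h1 h2 h3 => \sw_(h4, h5 <- De h3)
  bch (mB (aB h1 b) (aB h2 b0)) (aC h4 c) (h5 * h'))); lt.
Qed.

Lemma counit_lmulB b x : epD (lmulB b x) = sg (b ⊗ piB x).
Proof.
move: x; apply: (@bch_ext (k^o)) => [||b0 c h']; lt.
have hs : lin (fun x => sg (b ⊗ x) : k^o) by lintac.
rewrite lmulBE counit_bch (counit_twmul fB sg_inv) piBE (linZ hs) (linZ hs).
have E (x y z : k) : x * y * z = y * (z * x) by rewrite -mulrA mulrC -mulrA.
exact: E.
Qed.
Lemma comul_lmulB X (F : D -> D -> X) b x : bil F ->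
  \sw_(z1, z2 <- DD (lmulB b x)) F z1 z2 =
  \sw_(d, b' <- coactB b) \sw_(x1, x2 <- DD x) F (d * x1) (lmulB b' x2).
Proof.
move=> hF; move: x; apply: bch_ext => [||b0 c h']; lt.
rewrite lmulBE comul_bch; lt; rewrite (coact_twmul fB sg_inv); lt; apply: eq_sw => d b'.
rewrite comul_bch; lt; apply: eq_sw => d' c'.
apply: eq_sw => d2 c2; apply: eq_sw => h1 h2.
by rewrite lmulBE !mulrA.
Qed.

(** The element c on the right first has to pass h, hence the action of h_(1). *)
Definition rmulC (c : C) : D -> D :=
  ext (fun b c0 h => \sw_(h1, h2 <- De h) bch b (mC c0 (aC h1 c)) h2).
Lemma rmulCE c b c0 h : rmulC c (bch b c0 h) =
  \sw_(h1, h2 <- De h) bch b (mC c0 (aC h1 c)) h2.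
Proof. by rewrite /rmulC extE; lt. Qed.
Lemma rmulC_bil : bil rmulC.
Proof. by apply: ext_bil; lt. Qed.
Hint Resolve rmulC_bil : lin.
Lemma rmulC_bc c b c0 : rmulC c (bch b c0 1) = bch b (mC c0 c) 1.
Proof. by rewrite rmulCE comul1; lt; rewrite (bh_actP C).1. Qed.
Lemma rmulC1 x : rmulC 1 x = x.
Proof.
have a1 h : aC h 1 = (ep h)%:A.
  by have := bh_one_equiv C h 1; rewrite /act_unit mulr1 scale1r => <-.
move: x; apply: bch_ext => [||b' c h']; lt; rewrite rmulCE.
lhs 1 (rewrite a1 (linZ (mC_bil.2 _)) (twmul1r fC ta_inv _ ta1r) (linZ (bch_lin2 _ _))).
by rewrite (counitl (f := bch b' c)); lt.
Qed.
(** Left and right multiplication commute since they act on different tensor factors. *)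
Lemma lmulB_rmulC b c x : lmulB b (rmulC c x) = rmulC c (lmulB b x).
Proof.
move: x; apply: bch_ext => [||b' c' h']; lt.
rewrite lmulBE !rmulCE (lin_sw _ _ (lmulB_bil.2 _)); apply: eq_sw => h1 h2.
by rewrite lmulBE.
Qed.
Lemma rmulC_iH c x h : rmulC c (x * iH h) = \sw_(h1, h2 <- De h) rmulC (aC h1 c) x * iH h2.
Proof.
move: x; apply: bch_ext => [||b c0 h']; lt.
rewrite bch_iH rmulCE comulM; lt; rewrite sw_exch; apply: eq_sw => h1 h2.
rewrite rmulCE sw_mull; apply: eq_sw => h3 h4.
by rewrite bch_iH (bh_actP C).2.
Qed.
Lemma iH_rmulC c x h : iH h * rmulC c x = rmulC c (iH h * x).
Proof.
move: x; apply: bch_ext => [||b c0 h']; lt.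
rewrite rmulCE iH_bch sw_mulr; lhs 1 (rewrite iH_bch).
rewrite sw_exch (lin_sw _ _ (rmulC_bil.2 _)); apply: eq_sw => h1 h2.
rewrite (lin_sw _ _ (rmulC_bil.2 _)).
rhs 1 (rewrite rmulCE comulM; lt).
rewrite sw_exch.
lhs 2 (rewrite (act_twmul fC ta_inv) (lin_sw _ _ (bch_lin2 _ _))).
lhs 1 (rewrite sw_exch).
rewrite (comulA (F := fun h3 h4 h5 => \sw_(u1, u2 <- De h')
  bch (aB h1 b) (mC (aC h3 c0) (aC h4 (aC u1 c))) (h5 * u2))); lt.
apply: eq_sw => h3 h4; apply: eq_sw => h5 h6; apply: eq_sw => u1 u2.
by rewrite (bh_actP C).2.
Qed.
Lemma rmulC_rmulC c c' x : rmulC c (rmulC c' x) = rmulC (mC c' c) x.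
Proof.
move: x; apply: bch_ext => [||b c0 h]; lt.
rewrite !rmulCE (lin_sw _ _ (rmulC_bil.2 _)).
lhs 1 (rewrite rmulCE).
rhs 1 (rewrite (act_twmul fC ta_inv) (lin_sw _ _ (mC_bil.2 _)) (lin_sw _ _ (bch_lin2 _ _))).
rewrite -(comulA (F := fun h1 h2 h3 => bch b (mC (mC c0 (aC h1 c')) (aC h2 c)) h3)); lt.
apply: eq_sw => h1 h2; apply: eq_sw => h3 h4.
by rewrite (twmulA fC ta_inv).
Qed.
Lemma comul_rmulC X (F : D -> D -> X) c x : bil F ->
  \sw_(z1, z2 <- DD (rmulC c x)) F z1 z2 =
  \sw_(x1, x2 <- DD x) \sw_(d, c' <- coactC c) F (x1 * d) (rmulC c' x2).
Proof.
move=> hF; move: x; apply: bch_ext => [||b c0 h']; lt.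
rewrite rmulCE sw_linear sw_sw; lt.
lhs 1 (rewrite comul_bch; lt).
lhs 2 (rewrite (coact_twmul fC ta_inv); lt).
rewrite comul_bch; lt.
rewrite sw_exch; apply: eq_sw => d b'.
rewrite sw_exch; apply: eq_sw => d' c'.
lhs 1 (rewrite sw_exch).
rewrite -(comulA (F := fun h1 h2 h3 => \sw_(d2, c2 <- coactC (aC h1 c))
   F (d * (d' * d2) * iH h2) (bch b' (mC c' c2) h3))); lt.
lhs 3 (rewrite -!mulrA).
lhs 1 (rewrite (coact_act fC
  (F := fun x y => F (d * (d' * x)) (bch b' (mC c' y) _))); lt).
rewrite (comulA (F := fun h1 h2 h3 => \sw_(d2, c2 <- coactC c)
   F (d * (d' * (iH h1 * d2))) (bch b' (mC c' (aC h2 c2)) h3))); lt.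
apply: eq_sw => h1 h2; rewrite sw_exch; apply: eq_sw => d2 c2.
rewrite rmulCE (lin_sw _ _ (hF.2 _)); apply: eq_sw => h3 h4.
by rewrite !mulrA.
Qed.

(** Multiplying b' c' h' by c on the left, c crosses b' and then meets c' and h' in the
order in which they stand. *)
Definition lmulC (c : C) : D -> D :=
  ext (fun b' c' h' => rmulC c' (cross c b') * iH h').
Lemma lmulCE c b' c' h' : lmulC c (bch b' c' h') = rmulC c' (cross c b') * iH h'.
Proof. by rewrite /lmulC extE; lt. Qed.
Lemma lmulC_bil : bil lmulC.
Proof. by apply: ext_bil; lt. Qed.
Hint Resolve lmulC_bil : lin.
Lemma lmulC_iH c x h : lmulC c (x * iH h) = lmulC c x * iH h.
Proof.
move: x; apply: bch_ext => [||b' c' h']; lt.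
by rewrite bch_iH !lmulCE rmorphM mulrA.
Qed.
(** By the definition of [lmulC] this is associativity of right multiplication. *)
Lemma lmulC_rmulC c c' x : lmulC c (rmulC c' x) = rmulC c' (lmulC c x).
Proof.
move: x; apply: bch_ext => [||b c0 h]; lt.
rewrite rmulCE lmulCE rmulC_iH (lin_sw _ _ (lmulC_bil.2 _)); apply: eq_sw => h1 h2.
by rewrite lmulCE rmulC_rmulC.
Qed.
Lemma iH_lmulC h c x : iH h * lmulC c x = \sw_(h1, h2 <- De h) lmulC (aC h1 c) (iH h2 * x).
Proof.
move: x; apply: bch_ext => [||b c0 h']; lt.
rewrite lmulCE mulrA iH_rmulC iH_cross.
rewrite (lin_sw _ _ (rmulC_bil.2 _)) sw_mull; apply: eq_sw => h1 h2.
rewrite (lin_sw _ _ (rmulC_bil.2 _)) sw_mull.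
rewrite iH_bch (lin_sw _ _ (lmulC_bil.2 _)); apply: eq_sw => h3 h4.
rewrite (lin_sw _ _ (lmulC_bil.2 _)) rmulC_iH sw_mull; apply: eq_sw => h5 h6.
by rewrite lmulCE rmorphM mulrA.
Qed.
Lemma lmulC_jB c b : lmulC c (jB b) = cross c b.
Proof.
by have [<- _ _] := bch1 b 1 1; rewrite lmulCE rmulC1 rmorph1 mulr1.
Qed.
Lemma comul_lmulC X (F : D -> D -> X) c x : bil F ->
  \sw_(z1, z2 <- DD (lmulC c x)) F z1 z2 =
  \sw_(d, c' <- coactC c) \sw_(x1, x2 <- DD x) F (d * x1) (lmulC c' x2).
Proof.
move=> hF; move: x; apply: bch_ext => [||b c0 h]; lt.
rewrite lmulCE comulM; lt; rewrite comul_rmulC; lt; rewrite comul_cross; lt.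
apply: eq_sw => d c'; rewrite comul_bch; lt; apply: eq_sw => d' b'.
apply: eq_sw => d2 c2; rewrite (comul_iH_sw fC); lt; apply: eq_sw => h1 h2.
by rewrite lmulCE !mulrA.
Qed.

Lemma cross1 b : cross 1 b = jB b.
Proof.
rewrite cross_cofree /cofree (coact1 fC); lt.
lhs 1 (rewrite mul1r /evf ev_one_left).
by rewrite (coact_counit fB (f := id)).
Qed.
Lemma crossC1 c : cross c 1 = jC c.
Proof.
rewrite cross_cofree /cofree.
lhs 1 (rewrite (coact1 fB); lt; rewrite mulr1 /evf ev_one_right).
by rewrite (coact_counit fC (f := id)).
Qed.

Lemma lmulC1 x : lmulC 1 x = x.
Proof.
move: x; apply: bch_ext => [||b c0 h]; lt.
rewrite lmulCE cross1; have [<- _ _] := bch1 b 1 1.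
by rewrite rmulC_bc (twmul1l fC ta_inv) // bch_iH mul1r.
Qed.

Definition star (x y : D) : D := ext (fun b c h => lmulB b (lmulC c (iH h * y))) x.
Lemma starE b c h y : star (bch b c h) y = lmulB b (lmulC c (iH h * y)).
Proof. by rewrite /star extE; lt. Qed.
Lemma star_bil : bil star.
Proof.
have [h1 h2] : bil (fun y => ext (fun b c h => lmulB b (lmulC c (iH h * y)))).
  by apply: ext_bil; lt.
by split.
Qed.
Hint Resolve star_bil : lin.

Lemma star_lmulB b x y : star (lmulB b x) y = lmulB b (star x y).
Proof.
move: x; apply: bch_ext => [||b0 c h]; lt.
by rewrite lmulBE !starE lmulB_lmulB.
Qed.
Lemma star_iHl h x y : star (iH h * x) y = iH h * star x y.
Proof.
move: x; apply: bch_ext => [||b0 c h0]; lt.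
rewrite iH_bch starE iH_lmulB (lin_sw _ _ (star_bil.1 y)); apply: eq_sw => h1 h2.
rewrite (lin_sw _ _ (star_bil.1 y)) iH_lmulC (lin_sw _ _ (lmulB_bil.2 _)).
by apply: eq_sw => h3 h4; rewrite starE rmorphM mulrA.
Qed.
Lemma star_iHm h x y : star (x * iH h) y = star x (iH h * y).
Proof.
move: x; apply: bch_ext => [||b0 c h0]; lt.
by rewrite bch_iH !starE rmorphM mulrA.
Qed.
Lemma star_iHr h x y : star x (y * iH h) = star x y * iH h.
Proof.
move: x; apply: bch_ext => [||b0 c h0]; lt.
by rewrite !starE mulrA lmulC_iH lmulB_iH.
Qed.
Lemma star_rmulC c x y : star x (rmulC c y) = rmulC c (star x y).
Proof.
move: x; apply: bch_ext => [||b0 c' h0]; lt.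
by rewrite !starE iH_rmulC lmulC_rmulC lmulB_rmulC.
Qed.
Lemma star_jB b y : star (jB b) y = lmulB b y.
Proof. by have [<- _ _] := bch1 b 1 1; rewrite starE rmorph1 mul1r lmulC1. Qed.
Lemma star_jC c y : star (jC c) y = lmulC c y.
Proof. by have [_ <- _] := bch1 1 c 1; rewrite starE rmorph1 mul1r lmulB1. Qed.
Lemma star_iH h y : star (iH h) y = iH h * y.
Proof. by have [_ _ E] := bch1 1 1 h; rewrite -{1}E starE lmulB1 lmulC1. Qed.
Lemma star1l y : star 1 y = y.
Proof. by rewrite -(rmorph1 iH) star_iH rmorph1 mul1r. Qed.
Lemma lmulB_jB b b' : lmulB b (jB b') = jB (mB b b').
Proof. by have [<- _ _] := bch1 b' 1 1; rewrite lmulBE /bch !rmorph1 !mulr1. Qed.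
Lemma lmulB_jC b c : lmulB b (jC c) = jB b * jC c.
Proof.
have [_ <- _] := bch1 1 c 1.
by rewrite lmulBE (twmul1r fB sg_inv) // /bch rmorph1 rmorph1 mulr1 mul1r mulr1.
Qed.
Lemma star1r x : star x 1 = x.
Proof.
move: x; apply: bch_ext => [||b c h]; lt.
rewrite starE mulr1 -[iH h]mul1r lmulC_iH lmulB_iH -(rmorph1 jB) lmulC_jB crossC1.
by rewrite lmulB_jC.
Qed.

(** The product is composed of colinear maps: left multiplication by H, C and B. *)
Lemma comul_star X (F : D -> D -> X) x y : bil F ->
  \sw_(z1, z2 <- DD (star x y)) F z1 z2 =
  \sw_(x1, x2 <- DD x) \sw_(y1, y2 <- DD y) F (x1 * y1) (star x2 y2).
Proof.
move=> hF; move: x; apply: bch_ext => [||b c h]; lt.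
rewrite starE comul_lmulB; lt; rewrite comul_bch; lt; apply: eq_sw => d b'.
rewrite comul_lmulC; lt; apply: eq_sw => d' c'.
rewrite comulM; lt; rewrite (comul_iH_sw fC); lt; apply: eq_sw => h1 h2.
by apply: eq_sw => y1 y2; rewrite starE !mulrA.
Qed.

(** A colinear map into D is recovered from its counit. *)
Lemma star_comul x y : star x y =
  \sw_(x1, x2 <- DD x) \sw_(y1, y2 <- DD y) epD (star x2 y2) *: (x1 * y1).
Proof.
rewrite -[LHS](counitr (f := fun z => z)); last by lintac.
rewrite comul_star; last by lintac.
by [].
Qed.

Lemma piB_cross c b : piB (cross c b) = \sw_(b1, b2 <- dB b) (evf c b1 : k) *: b2.
Proof.
rewrite cross_bch (lin_sw _ _ piBl); apply: eq_sw => b1 b2.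
rewrite (lin_sw _ _ piBl).
lhs 1 (rewrite (lin_sw _ _ piBl)).
lhs 2 (rewrite (linZ piBl) piBE counit1 scale1r epC_act scalerA mulrCA -scalerA).
lhs 1 (rewrite (Ri_counitr Q (f := fun r => (evf _ b1 * epC _ : k) *: aB r b2)); lt).
lhs 1 (rewrite (bh_actP B).1 mulrC -scalerA).
by rewrite (bialg_counitl (bh_bialgebra C) (f := fun c => (evf c b1 : k) *: b2)); lt.
Qed.

Lemma evfMr c b b' :
  evf c (b * b') = \sw_(c1, c2 <- dC c) (evf c2 b : k) *: evf c1 b'.
Proof. exact: ev_mul_right. Qed.
Lemma evfMl c c' b :
  evf (c * c') b = \sw_(b1, b2 <- dB b) (evf c b2 : k) *: evf c' b1.
Proof. exact: ev_mul_left. Qed.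

(** On the left R^-1 of [cross] acts on the first argument of sg and on the first
argument of ev; on the right R of the braiding acts on the first argument of sg and
on the second of ev.  The form ev is invariant, so [R_invariant_form] applies. *)
Lemma counit_cross_star c b b' : epD (star (cross c b) (jB b')) = evf c (mB b b').
Proof.
symmetry; rewrite (twmulE fB sg) (lin_sw _ _ (evf_bil.2 _)).
rewrite cross_bch (lin_sw _ _ (star_bil.1 _)) sw_linear; apply: eq_sw => b1 b2.
rewrite (lin_sw _ _ (evf_bil.2 _)).
lhs 1 (rewrite (lin_sw _ _ (evf_bil.2 _))).
lhs 2 (rewrite (linZ (evf_bil.2 _)) evfMr sw_scaler).
lhs 1 (rewrite sw_exch).
rewrite sw_exch (lin_sw _ _ (star_bil.1 _)) sw_linear; apply: eq_sw => c1 c2.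
rewrite (lin_sw _ _ (star_bil.1 _)) sw_linear.
rhs 1 (rewrite (linZ (star_bil.1 _)) linearZ_LR starE rmorph1 mul1r lmulC_jB counit_lmulB
   piB_cross sw_tensr sw_linear sw_scaler).
rewrite [RHS]sw_exch; apply: eq_sw => b1' b2'.
(* all factors that contain the first leg of R *)
pose g u : k^o := (evf c2 b1 : k) *: (sg (aB u b2 ⊗ b2') : k^o).
have hg : lin g by rewrite /g; lintac.
have hs u : lin (fun x => sg (u ⊗ x) : k^o) by lintac.
transitivity (\sw_(r, s <- Rmat Q) (evf c1 (aB s b1') : k) *: g r).
  by apply: eq_sw => r s; exact: scaler_rev.
rewrite (R_invariant_form Q (@bh_actP _ _ _ C) evf_bil evf_inv) //.
by apply: eq_sw => r s; rewrite (linZ (hs _)) scaler_swap.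
Qed.

(** Both sides are colinear, hence it is enough that their counits agree. *)
Lemma cross_mB c b b' : cross c (mB b b') = star (cross c b) (jB b').
Proof.
rewrite star_comul comul_cross; lt.
rewrite -[LHS](counitr (f := fun z => z)); last by lintac.
rewrite comul_cross; last by lintac.
apply: eq_sw => d c'; rewrite (coact_twmul fB sg_inv); last by lintac.
apply: eq_sw => d' b1; rewrite (comul_j_sw fB); last by lintac.
by apply: eq_sw => d2 b2; rewrite counit_cross counit_cross_star mulrA.
Qed.

Lemma counit_rmulC_cross c c' b :
  epD (rmulC c' (cross c b)) = \sw_(c1, c2 <- dC c) (evf c2 b : k) *: ta (c1 ⊗ c').
Proof.
rewrite cross_bch (lin_sw _ _ (rmulC_bil.2 _)) sw_linear.
lhs 1 (rewrite (lin_sw _ _ (rmulC_bil.2 _)) sw_linear).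
rewrite sw_exch; apply: eq_sw => c1 c2.
lhs 1 (rewrite (lin_sw _ _ (rmulC_bil.2 _)) sw_linear).
lhs 2 (rewrite (linZ (rmulC_bil.2 _)) linearZ_LR rmulC_bc counit_bch epB_act).
lhs 2 (rewrite (counit_twmul fC ta_inv) counit1 mulr1).
lhs 2 (rewrite -mulrA scalerM3).
lhs 1 (rewrite (Ri_counitl Q
  (f := fun s => (epB _ : k) *: ((evf c2 _ : k) *: (ta (aC s c1 ⊗ c') : k^o)))); lt).
rewrite (bialg_counitr (bh_bialgebra B)
  (f := fun b => (evf c2 b : k) *: (ta (aC 1 c1 ⊗ c') : k^o))); lt.
by rewrite (bh_actP C).1.
Qed.

Lemma cop_sw X (F : C -> C -> X) c : bil F ->
  \sw_(x, y <- cop c) F x y = \sw_(c1, c2 <- dC c)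
    \sw_(r, s <- Rmat_inv Q) F (aC r c2) (aC s c1).
Proof.
move=> hF; rewrite /cop_comul sw_sw //; apply: eq_sw => c1 c2.
by rewrite sw_sw //; apply: eq_sw => r s; rewrite sw_tens.
Qed.

Definition taf (c c' : C) : k^o := ta (c ⊗ c').
Lemma taf_bil : bil taf. Proof. rewrite /taf; lintac. Qed.
Lemma taf_inv h c c' :
  \sw_(h1, h2 <- De h) taf (aC h1 c) (aC h2 c') = ep h * (taf c c' : k).
Proof. exact: (invariant_form ta_inv). Qed.
Hint Resolve taf_bil : lin.

Lemma evf_mC c c' b : evf (mC c c') b =
  \sw_(c1, c2 <- dC c) \sw_(r, s <- Rmat_inv Q) \sw_(c1', c2' <- dC c')
  \sw_(b1, b2 <- dB b)
   (evf (aC r c2) b2 : k) *: ((evf c2' b1 : k) *: taf (aC s c1) c1').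
Proof.
rewrite (twmulE fC ta) (lin_sw _ _ (evf_bil.1 _)) cop_sw; lt.
apply: eq_sw => c1 c2; apply: eq_sw => r s.
rewrite (lin_sw _ _ (evf_bil.1 _)) cop_sw; lt; apply: eq_sw => c1' c2'.
lhs 1 (rewrite flip_sw; lt; rewrite (lin_sw _ _ (evf_bil.1 _))).
lhs 2 (rewrite (linZ (evf_bil.1 _)) evfMl sw_scaler).
lhs 1 (rewrite sw_exch); rewrite sw_exch; apply: eq_sw => b1 b2.
rewrite sw_exch.
lhs 2 (rewrite -[aC _ (aC _ c2')](bh_actP C).2 -/(taf _ _)).
rewrite -(Ri_comulr Q (G := fun a s1 s2 => (taf (aC s1 (aC s c1)) (aC s2 c1') : k) *:
   ((evf (aC r c2) b2 : k) *: evf (aC a c2') b1))); lt.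
lhs 1 (rewrite -sw_scalel taf_inv -scalerA).
rewrite (Ri_counitr Q (f := fun a => (taf (aC s c1) c1' : k) *:
   ((evf (aC r c2) b2 : k) *: evf (aC a c2') b1))); lt.
by rewrite (bh_actP C).1 scaler_rev scaler_swap scaler_rev scaler_swap.
Qed.

(** On the left R^-1 acts on the second arguments of ev and ta, on the right on their
first arguments.  [R_invariant_form] for ev, with R_21^-1 as the R-matrix, replaces
R^-1 by R, and for ta, with R, it brings R^-1 back. *)
Lemma counit_lmulC_cross c c' b : epD (lmulC c (cross c' b)) = evf (mC c c') b.
Proof.
rewrite evf_mC cross_bch (lin_sw _ _ (lmulC_bil.2 _)) sw_linear.
lhs 1 (rewrite (lin_sw _ _ (lmulC_bil.2 _)) sw_linear).
lhs 2 (rewrite (lin_sw _ _ (lmulC_bil.2 _)) sw_linear).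
lhs 3 (rewrite (linZ (lmulC_bil.2 _)) linearZ_LR lmulCE rmorph1 mulr1 counit_rmulC_cross sw_scaler).
lhs 2 (rewrite sw_exch).
rhs 2 (rewrite sw_exch).
rhs 1 (rewrite sw_exch).
rewrite [RHS]sw_exch; apply: eq_sw => b1 b2.
rhs 1 (rewrite sw_exch).
rewrite [RHS]sw_exch; apply: eq_sw => c1' c2'; apply: eq_sw => c1 c2.
pose g s : k^o := (evf c2' b1 : k) *: taf c1 (aC s c1').
transitivity (\sw_(r, s <- flip (Rmat_inv Q)) (evf c2 (aB s b2) : k) *: g r).
  by rewrite flip_sw /g; lt; apply: eq_sw => r s; rewrite scaler_swap.
rewrite (R_invariant_form (flipped Q) (@bh_actP _ _ _ C) evf_bil evf_inv); last first.
  by rewrite /g; lt.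
rewrite flip_sw /g; lt.
transitivity (\sw_(r, s <- Rmat Q) (taf c1 (aC s c1') : k) *:
   ((evf c2' b1 : k) *: evf (aC r c2) b2)).
  by apply: eq_sw => r s; exact: scaler_rev.
rewrite (R_invariant_form Q (@bh_actP _ _ _ C) taf_bil taf_inv
  (g := fun r => (evf c2' b1 : k) *: evf (aC r c2) b2)); last by lintac.
by apply: eq_sw => r s; exact: scaler_rev.
Qed.

(** Again both sides are colinear with the same counit. *)
Lemma cross_mC c c' b : cross (mC c c') b = lmulC c (cross c' b).
Proof.
rewrite -[RHS](counitr (f := fun z => z)); last by lintac.
rewrite comul_lmulC; last by lintac.
rewrite -[LHS](counitr (f := fun z => z)); last by lintac.
rewrite comul_cross; last by lintac.
rewrite (coact_twmul fC ta_inv); last by lintac.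
apply: eq_sw => d c1; rewrite comul_cross; last by lintac.
apply: eq_sw => d' c2; apply: eq_sw => d2 b2.
by rewrite counit_cross counit_lmulC_cross mulrA.
Qed.

(** Crossing puts C to the right of B and leaves no H: a linear map on such elements is
determined by its values on b c. *)
Lemma cross_ext X (f g : D -> X) c b : lin f -> lin g ->
  (forall b' c', f (bch b' c' 1) = g (bch b' c' 1)) -> f (cross c b) = g (cross c b).
Proof.
move=> hf hg fg; rewrite cross_bch (lin_sw _ _ hf) (lin_sw _ _ hg); apply: eq_sw => b1 b2.
rewrite (lin_sw _ _ hf) (lin_sw _ _ hg); apply: eq_sw => c1 c2.
rewrite (lin_sw _ _ hf) (lin_sw _ _ hg); apply: eq_sw => r s.
by rewrite (linZ hf) (linZ hg) fg.
Qed.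

Lemma rmulC_jB c b : rmulC c (jB b) = bch b c 1.
Proof. by have [<- _ _] := bch1 b 1 1; rewrite rmulC_bc (twmul1l fC ta_inv). Qed.

Lemma star_bc_jB b c b' : star (bch b c 1) (jB b') = lmulB b (cross c b').
Proof. by rewrite starE rmorph1 mul1r lmulC_jB. Qed.

Lemma star_rmulC_cross c c' b b' :
  star (rmulC c' (cross c b')) (jB b) = star (cross c b') (cross c' b).
Proof.
apply: (cross_ext (f := fun x => star (rmulC c' x) (jB b)) (g := fun x => star x _)); lt.
move=> b0 c0; rewrite rmulC_bc star_bc_jB cross_mC starE rmorph1.
by rewrite mul1r.
Qed.

Lemma lmulC_lmulB_cross c c' b b' :
  lmulC c (lmulB b' (cross c' b)) = star (cross c b') (cross c' b).
Proof.
apply: (cross_ext (f := fun x => lmulC c (lmulB b' x)) (g := star _)); lt.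
move=> b0 c0; rewrite lmulBE lmulCE rmorph1 mulr1 cross_mB.
by rewrite -star_rmulC rmulC_jB.
Qed.

Lemma star_jB_iH x h b : star (x * iH h) (jB b) =
  \sw_(h1, h2 <- De h) star x (jB (aB h1 b)) * iH h2.
Proof.
rewrite star_iHm iH_jB (lin_sw _ _ (star_bil.2 _)); apply: eq_sw => h1 h2.
by rewrite star_iHr.
Qed.

(** The essential case of associativity, c * (b' c' * b) = (c * b' c') * b.  Both
bracketings equal (c * b') * (c' * b): one by [cross_mC], which lets c' meet the
C-part of c * b', the other by [cross_mB], which lets b' meet the B-part of c' * b. *)
Lemma star_lmulC_jB c y b : star (lmulC c y) (jB b) = lmulC c (star y (jB b)).
Proof.
move: y; apply: bch_ext => [||b' c' h]; lt.
have -> : bch b' c' h = bch b' c' 1 * iH h by rewrite bch_iH mul1r.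
rewrite lmulC_iH !star_jB_iH (lin_sw _ _ (lmulC_bil.2 _)); apply: eq_sw => h1 h2.
rewrite lmulC_iH lmulCE rmorph1 mulr1 star_bc_jB lmulC_lmulB_cross.
by rewrite star_rmulC_cross.
Qed.

(** The right factor b' c' h' of a product can be peeled off on the right down to b'. *)
Lemma star_lmulC c y z : star (lmulC c y) z = lmulC c (star y z).
Proof.
move: z; apply: bch_ext => [||b' c' h]; lt.
have -> : bch b' c' h = bch b' c' 1 * iH h by rewrite bch_iH mul1r.
by rewrite -rmulC_jB !star_iHr lmulC_iH !star_rmulC lmulC_rmulC star_lmulC_jB.
Qed.

(** By the definition of the product it remains to see that left multiplications by B,
by C and by H pass through the first factor. *)
Lemma starA x y z : star x (star y z) = star (star x y) z.
Proof.
move: x; apply: bch_ext => [||b c h]; lt.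
by rewrite !starE star_lmulB star_lmulC star_iHl.
Qed.

(** The form sigma o tau of the theorem, by [JformE]. *)
Definition Jform (x y : D) : k^o := epD (star x y).
Lemma Jform_bil : bil Jform. Proof. rewrite /Jform; lintac. Qed.

(** Both sides expand J(x, y * z) = J(x * y, z), which is associativity, by
[star_comul]. *)
Lemma Jform_cocycle x y z :
  \sw_(y1, y2 <- DD y) \sw_(z1, z2 <- DD z) (Jform y2 z2 : k) *: Jform x (y1 * z1) =
  \sw_(x1, x2 <- DD x) \sw_(y1, y2 <- DD y) (Jform x2 y2 : k) *: Jform (x1 * y1) z.
Proof.
have hl : lin (fun y => Jform x y) := Jform_bil.2 x.
have hr : lin (fun y => Jform y z) := Jform_bil.1 z.
transitivity (Jform x (star y z)).
  rewrite (star_comul y z) (lin_sw _ _ hl); apply: eq_sw => y1 y2.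
  by rewrite (lin_sw _ _ hl); apply: eq_sw => z1 z2; rewrite (linZ hl).
rewrite {1}/Jform starA -/(Jform _ _) (star_comul x y) (lin_sw _ _ hr).
apply: eq_sw => y1 y2.
by rewrite (lin_sw _ _ hr); apply: eq_sw => z1 z2; rewrite (linZ hr).
Qed.

Lemma Jform1l x : Jform 1 x = epD x. Proof. by rewrite /Jform star1l. Qed.
Lemma Jform1r x : Jform x 1 = epD x. Proof. by rewrite /Jform star1r. Qed.

Lemma piB_iHl x h : piB (iH h * x) = aB h (piB x).
Proof.
move: x; apply: bch_ext => [||b' c' h']; lt.
rewrite iH_bch piBE (lin_sw _ _ piBl).
lhs 1 (rewrite (lin_sw _ _ piBl)).
lhs 2 (rewrite piBE epC_act counitM -!scalerA).
lhs 1 (rewrite (@counitl _ _ _ (fun h4 => epC c' *: (ep h4 *: (ep h' *: aB _ b')))); lt).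
lhs 1 (rewrite scaler_swap).
rewrite (@counitr _ _ _ (fun h => epC c' *: (ep h' *: aB h b'))); lt.
by rewrite !linearZr_LR.
Qed.
Lemma piB_rmulC_cross c c' b : piB (rmulC c' (cross c b)) =
  \sw_(b1, b2 <- dB b) \sw_(c1, c2 <- dC c) \sw_(r, s <- Rmat_inv Q)
    (evf c2 b1 : k) *: ((taf (aC s c1) c' : k) *: aB r b2).
Proof.
rewrite cross_bch (lin_sw _ _ (rmulC_bil.2 _)) (lin_sw _ _ piBl); apply: eq_sw => b1 b2.
rewrite (lin_sw _ _ (rmulC_bil.2 _)) (lin_sw _ _ piBl); apply: eq_sw => c1 c2.
rewrite (lin_sw _ _ (rmulC_bil.2 _)) (lin_sw _ _ piBl); apply: eq_sw => r s.
rewrite (linZ (rmulC_bil.2 _)) (linZ piBl) rmulC_bc piBE.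
by rewrite (counit_twmul fC ta_inv) counit1 scale1r.
Qed.

Lemma Jform_bch b c h y : Jform (bch b c h) y = sg (b ⊗ piB (lmulC c (iH h * y))).
Proof. by rewrite /Jform starE counit_lmulB. Qed.

Lemma Jform_bhc b h c y :
  Jform (jB b * iH h * jC c) y = sg (b ⊗ aB h (piB (lmulC c y))).
Proof.
have hs : lin (fun x => sg (b ⊗ piB x) : k^o) by lintac.
rewrite -mulrA iH_jC sw_mulr (lin_sw _ _ (Jform_bil.1 _)).
lhs 1 (rewrite mulrA -/(bch _ _ _) Jform_bch).
by rewrite -piB_iHl iH_lmulC (lin_sw _ _ hs).
Qed.

(** In the order b' h' c' of the theorem, h' acts on c' and then its counit is taken. *)
Lemma piB_lmulC_bhc c b' h' c' :
  piB (lmulC c (jB b' * iH h' * jC c')) = piB (rmulC (aC h' c') (cross c b')).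
Proof.
rewrite -mulrA iH_jC sw_mulr (lin_sw _ _ (lmulC_bil.2 _)) (lin_sw _ _ piBl).
lhs 1 (rewrite mulrA -/(bch _ _ _) lmulCE piB_iHr).
by rewrite (@counitr _ _ _ (fun h => piB (rmulC (aC h c') _))); lt.
Qed.

Lemma JformE b b' h h' c c' :
  Jform (jB b * iH h * jC c) (jB b' * iH h' * jC c') =
  \sw_(b1, b2 <- dB b') \sw_(c1, c2 <- dC c) \sw_(r, s <- Rmat_inv Q)
   (sg (b ⊗ aB (h * r) b2) : k) * (evf c2 b1 : k) * (taf (aC s c1) (aC h' c') : k).
Proof.
have hs : lin (fun x => sg (b ⊗ aB h x) : k^o) by lintac.
rewrite Jform_bhc piB_lmulC_bhc piB_rmulC_cross (lin_sw _ _ hs); apply: eq_sw => b1 b2.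
rewrite (lin_sw _ _ hs); apply: eq_sw => c1 c2.
rewrite (lin_sw _ _ hs); apply: eq_sw => r s.
rewrite !(linZ hs) -(bh_actP B).2.
have E (x y z : k) : x * (y * z) = z * x * y by rewrite mulrA mulrC mulrA.
exact: E.
Qed.

Lemma Jform_BB b b' : Jform (jB b) (jB b') = sg (b ⊗ b').
Proof. by rewrite /Jform star_jB lmulB_jB drin_counit_B (counit_twmul fB sg_inv). Qed.
Lemma Jform_CC c c' : Jform (jC c) (jC c') = ta (c ⊗ c').
Proof.
rewrite /Jform star_jC; have [_ <- _] := bch1 1 c' 1.
rewrite lmulCE rmorph1 mulr1 crossC1; have [_ <- _] := bch1 1 c 1.
rewrite rmulC_bc counit_bch (counit_twmul fC ta_inv) counit1 (counit_one (bh_bialgebra B)).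
by rewrite mul1r mulr1.
Qed.
Lemma Jform_HH h h' : Jform (iH h) (iH h') = hopf_counit H (h * h').
Proof. by rewrite /Jform star_iH -rmorphM drin_counit_H. Qed.
End Forms.

(** * Convolution invertibility of the form *)

(** Forms on D ⊗_H D.  By the triangular decomposition they are determined by values on
a first argument without H-component ([balanced_eq]). *)
Record balanced (K : D -> D -> k^o) : Prop := Balanced {
  balanced_bil : bil K;
  balanced_mid : forall x h y, K (x * iH h) y = K x (iH h * y)
}.

Lemma balanced_eq K K' : balanced K -> balanced K' ->
  (forall b c b' c' h', K (bch b c 1) (bch b' c' h') = K' (bch b c 1) (bch b' c' h')) ->
  K =2 K'.
Proof.
move=> [hK mK] [hK' mK'] KK x y.
have E b c z : K (bch b c 1) z = K' (bch b c 1) z.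
  by move: z; apply: (@bch_ext (k^o)) => [||b' c' h']; lt.
move: x; apply: (@bch_ext (k^o)) => [||b c h]; lt.
have -> : bch b c h = bch b c 1 * iH h by rewrite bch_iH mul1r.
by rewrite mK mK' E.
Qed.

Lemma balanced_conv f g : balanced f -> balanced g -> balanced (conv f g).
Proof.
move=> [hf mf] [hg mg]; split; first exact: conv_bil.
move=> x h y; rewrite /conv comulM; lt; apply: eq_sw => x1 x2.
rhs 0 (rewrite comulM; lt); rewrite (comul_iH_sw fB); lt.
rhs 0 (rewrite (comul_iH_sw fB); lt).
by apply: eq_sw => h1 h2; apply: eq_sw => y1 y2; rewrite mf mg.
Qed.
Lemma balanced_conv1 : balanced (@conv1 k D).
Proof.
split; first exact: conv1_bil.
by move=> x h y; rewrite /conv1 !counitM mulrA.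
Qed.

Lemma conv1_bch b c b' c' h' : conv1 (bch b c 1) (bch b' c' h') =
  epB b * epC c * (epB b' * epC c' * ep h').
Proof. by rewrite /conv1 !counit_bch counit1 mulr1. Qed.

Lemma piB_jB b x : piB (jB b * x) = b * piB x.
Proof.
move: x; apply: bch_ext => [||b' c' h']; lt.
by rewrite jB_bch !piBE !scalerAr.
Qed.
Lemma piB_jC c h : piB (jC c * iH h) = (epC c * ep h)%:A.
Proof.
have -> : jC c * iH h = bch 1 c h by rewrite /bch rmorph1 mul1r.
by rewrite piBE scalerA.
Qed.
Lemma aB1 h : aB h 1 = (ep h)%:A.
Proof. by have := bh_one_equiv B h 1; rewrite /act_unit mulr1 scale1r => <-. Qed.

Lemma piB_word b s r c h : piB (jB b * iH s * (iH r * jC c) * iH h) =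
  (ep s * (ep r * (epC c * ep h))) *: b.
Proof.
rewrite -!mulrA piB_jB !piB_iHl piB_jC !(linZ (lin_bilr aB _)) aB1.
rewrite (linZ (lin_bilr aB _)) aB1 !scalerA -scalerAr mulr1.
congr (_ *: _). ring.
Qed.

(** Projecting the first leg to B leaves only the coproduct of b: the C- and H-parts
of this leg, and with them both R-matrices, are met by counits. *)
Lemma comul_piB X (F : B -> D -> X) b c h : bil F ->
  \sw_(y1, y2 <- DD (bch b c h)) F (piB y1) y2 =
  \sw_(b1, b2 <- dB b) F b1 (bch b2 c h).
Proof.
move=> hF; rewrite comul_bch; lt; rewrite coact_sw; lt; apply: eq_sw => b1 b2.
lhs 1 (rewrite coactC_sw; lt).
lhs 4 (rewrite piB_word (linZ (hF.1 _)) -!scalerA).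
lhs 3 (rewrite -!sw_scaler (counitl (f := fun h => F b1 (bch _ _ h))); lt).
lhs 2 (rewrite -sw_scaler (Ri_counitl Q
  (f := fun r => epC _ *: F b1 (bch _ (aC r _) h))); lt; rewrite (bh_actP C).1).
lhs 1 (rewrite -sw_scaler (bialg_counitr (bh_bialgebra C)
  (f := fun c => F b1 (bch _ c h))); lt).
rewrite (R_counitr Q (f := fun r => F b1 (bch (aB r b2) c h))); lt.
by rewrite (bh_actP B).1.
Qed.

Lemma piC_jB b x : piC (jB b * x) = epB b *: piC x.
Proof.
move: x; apply: bch_ext => [||b' c' h']; lt.
by rewrite jB_bch !piCE (counit_mul (bh_bialgebra B)) -scalerA.
Qed.
Lemma piC_iHl x h : piC (iH h * x) = aC h (piC x).
Proof.
move: x; apply: bch_ext => [||b' c' h']; lt.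
rewrite iH_bch piCE (lin_sw _ _ piCl).
lhs 1 (rewrite (lin_sw _ _ piCl)).
lhs 2 (rewrite piCE epB_act counitM -!scalerA [epB b' *: _]scaler_swap).
lhs 1 (rewrite -sw_scaler (counitr (f := fun h => epB b' *: (ep h' *: aC h c'))); lt).
rewrite (counitl (f := fun h => epB b' *: (ep h' *: aC h c'))); lt.
by rewrite !(linZ (lin_bilr aC _)).
Qed.

Lemma comul_piC X (F : C -> C -> X) b c h : bil F ->
  \sw_(y1, y2 <- DD (bch b c h)) F (piC y1) (piC y2) =
  epB b *: (ep h *: \sw_(c1, c2 <- cop c) F c1 c2).
Proof.
move=> hF; rewrite comul_bch; lt.
lhs 3 (rewrite piCE piC_iHr !(linZ (hF.2 _)) (linZ (hF.1 _))).
lhs 2 (rewrite -!sw_scaler (counitr (f := fun h => ep h *: F (piC (_ * _)) _)); lt).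
lhs 1 (rewrite -sw_scaler).
rewrite (coact_counit fB (f := fun d => \sw_(d', c' <- coactC c)
   ep h *: F (piC (d * d')) c')); lt.
rewrite -sw_scaler scaler_swap; congr (_ *: _).
lhs 1 (rewrite piC_jB (linZ (hF.1 _))).
rewrite -sw_scaler coact_sw; lt; congr (_ *: _); apply: eq_sw => c1 c2.
lhs 1 (rewrite piC_iHr piC_jC (linZ (hF.1 _))).
rewrite (R_counitr (flipped Q) (f := fun r => F c1 (aC r c2))); lt.
by rewrite (bh_actP C).1.
Qed.

Lemma piB_piC X (F : B -> C -> X) b c h : bil F ->
  \sw_(y1, y2 <- DD (bch b c h)) F (piB y1) (piC y2) = ep h *: F b c.
Proof.
move=> hF; rewrite (comul_piB (F := fun b x => F b (piC x))); lt.
lhs 1 (rewrite piCE !(linZ (hF.2 _))).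
by rewrite (bialg_counitr (bh_bialgebra B) (f := fun b => ep h *: F b c)); lt.
Qed.

(** A pairing of C with a quotient [W] of D, inflated to a form on D that sees B through
its counit.  It is used for ev, with W = B, and for tau, with W = C. *)
Section InflatedFromC.
Variables (W : lmodType k) (aW : {bilinear H -> W -> W}) (f : C -> W -> k^o) (pi : D -> W).
Hypotheses (hf : bil f) (pil : lin pi).
Hypothesis f_inv : forall h v w,
  \sw_(h1, h2 <- De h) f (aC h1 v) (aW h2 w) = ep h * (f v w : k).
Hypothesis pi_iHl : forall h x, pi (iH h * x) = aW h (pi x).

Definition formC (x y : D) : k^o :=
  ext (fun b c h => (epB b : k) *: (f c (pi (iH h * y)) : k^o)) x.
Lemma formCE b c h y : formC (bch b c h) y = (epB b : k) *: (f c (pi (iH h * y)) : k^o).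
Proof. by rewrite /formC extE; lt. Qed.
Lemma formC_bil : bil formC.
Proof.
have [h1 h2] : bil (fun y => ext (fun b c h =>
    (epB b : k) *: (f c (pi (iH h * y)) : k^o))) by apply: ext_bil; lt.
by split.
Qed.
Hint Resolve formC_bil : lin.
Lemma balanced_formC : balanced formC.
Proof.
split; first exact: formC_bil.
move=> x h y; move: x; apply: (@bch_ext (k^o)) => [||b c h']; lt.
by rewrite bch_iH !formCE rmorphM mulrA.
Qed.
Lemma formC_jB b x y : formC (jB b * x) y = (epB b : k) *: formC x y.
Proof.
move: x; apply: (@bch_ext (k^o)) => [||b' c h']; lt.
by rewrite jB_bch !formCE (counit_mul (bh_bialgebra B)) -scalerA.
Qed.
Lemma formC_iH h x y : formC (iH h * x) y = ep h *: formC x y.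
Proof.
move: x; apply: (@bch_ext (k^o)) => [||b c h']; lt.
rewrite iH_bch (lin_sw _ _ (formC_bil.1 y)).
lhs 1 (rewrite (lin_sw _ _ (formC_bil.1 y))).
lhs 2 (rewrite formCE epB_act rmorphM -mulrA pi_iHl -scalerA).
lhs 1 (rewrite -!sw_scaler f_inv mulkE).
rewrite (counitl (f := fun h => epB b *: (ep h *: (f c (pi (iH h' * y)) : k^o)))); lt.
rewrite formCE; exact: scaler_swap.
Qed.

Lemma conv_formC g b c y : bil g -> conv formC g (bch b c 1) y =
  \sw_(c1, c2 <- dC c) \sw_(y1, y2 <- DD y) (f c2 (pi y1) : k) *: g (bch b c1 1) y2.
Proof.
move=> hg; rewrite /conv comul_bch; lt.
lhs 2 (rewrite comul1; lt; rewrite rmorph1).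
lhs 3 (rewrite mulr1).
rewrite coact_sw; lt.
lhs 3 (lhs 1 (rewrite -mulrA formC_jB formC_iH -!scalerA); reflexivity).
lhs 3 (rewrite -!sw_scaler).
lhs 2 (rewrite -!sw_scaler scaler_swap).
lhs 1 (rewrite (R_counitr Q (f := fun r => epB _ *: \sw_(d, c' <- coactC c)
  \sw_(y1, y2 <- DD y) (formC d y1 : k) *: g (bch (aB r _) c' 1) y2)); lt; rewrite (bh_actP B).1).
rewrite (bialg_counitl (bh_bialgebra B) (f := fun b => \sw_(d, c' <- coactC c)
  \sw_(y1, y2 <- DD y) (formC d y1 : k) *: g (bch b c' 1) y2)); lt.
rewrite coactC_sw; lt; apply: eq_sw => c1 c2.
lhs 2 (rewrite formC_iH -scalerA).
lhs 1 (rewrite -sw_scaler).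
rewrite (Ri_counitl Q (f := fun s => \sw_(y1, y2 <- DD y)
  (formC (jC c2) y1 : k) *: g (bch b (aC s c1) 1) y2)); lt.
apply: eq_sw => y1 y2; rewrite (bh_actP C).1; have [_ <- _] := bch1 1 c2 1.
by rewrite formCE rmorph1 mul1r (counit_one (bh_bialgebra B)) scale1r.
Qed.
End InflatedFromC.

(** The convolution inverse of ev, as for any pairing of Hopf algebras ([ev_conv]). *)
Definition evfS (c : C) (b : B) : k^o := evf (bh_antipode C c) b.
Lemma evfS_bil : bil evfS.
Proof. by have := evf_bil; rewrite /evfS => h; lintac. Qed.
Lemma evfS_inv h c b :
  \sw_(h1, h2 <- De h) evfS (aC h1 c) (aB h2 b) = ep h * (evfS c b : k).
Proof.
rewrite /evfS -evf_inv; apply: eq_sw => h1 h2.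
by rewrite (bh_antipode_equiv h1 c).
Qed.
Let evfb := evf_bil.

Lemma ev_conv (c : C) (b : B) :
  \sw_(c1, c2 <- dC c) \sw_(b1, b2 <- dB b) (evf c2 b1 : k) *: evfS c1 b2 = epC c * epB b /\
  \sw_(c1, c2 <- dC c) \sw_(b1, b2 <- dB b) (evfS c2 b1 : k) *: evf c1 b2 = epC c * epB b.
Proof.
have E u : evf (u%:A) b = u * epB b.
  by rewrite (linZ (evfb.1 b)) /evf ev_one_left.
split.
- rewrite -E -(bh_antipodeP c).1 (lin_sw _ _ (evfb.1 b)); apply: eq_sw => c1 c2.
  by rewrite evfMl; apply: eq_sw => b1 b2; exact: scalerCk.
- rewrite -E -(bh_antipodeP c).2 (lin_sw _ _ (evfb.1 b)); apply: eq_sw => c1 c2.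
  by rewrite evfMl; apply: eq_sw => b1 b2; exact: scalerCk.
Qed.

Lemma conv_formC_piB (f : C -> B -> k^o) g b c b' c' h' : bil f ->
  (forall h v w, \sw_(h1, h2 <- De h) f (aC h1 v) (aB h2 w) = ep h * (f v w : k)) ->
  bil g -> conv (formC f piB) g (bch b c 1) (bch b' c' h') =
  \sw_(c1, c2 <- dC c) \sw_(b1, b2 <- dB b') (f c2 b1 : k) *: g (bch b c1 1) (bch b2 c' h').
Proof.
move=> hf finv hg; rewrite (conv_formC hf piBl finv (fun h x => piB_iHl x h)) //.
apply: eq_sw => c1 c2.
by rewrite (comul_piB (F := fun b x => (f c2 b : k) *: g (bch _ c1 1) x)); lt.
Qed.

Lemma ev_form_inverse : conv_inverse (formC evf piB) (formC evfS piB).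
Proof.
have evi := evf_inv; have esb := evfS_bil; have esi := evfS_inv.
have h1 : bil (formC evf piB) by apply: formC_bil.
have h2 : bil (formC evfS piB) by apply: formC_bil.
have b1 : balanced (formC evf piB) by apply: balanced_formC.
have b2 : balanced (formC evfS piB) by apply: balanced_formC.
split; apply: balanced_eq => [||b c b' c' h'];
  try exact: balanced_conv1; try exact: balanced_conv.
- rewrite conv_formC_piB //.
  lhs 2 (rewrite (formCE esb piBl) rmorph1 mul1r piBE !(linZ (esb.2 _)) scaler_pull).
  lhs 1 (rewrite -sw_scaler).
  by rewrite -sw_scaler (ev_conv c b').1 conv1_bch scalekE; ring.
- rewrite conv_formC_piB //.
  lhs 2 (rewrite (formCE evfb piBl) rmorph1 mul1r piBE !(linZ (evfb.2 _)) scaler_pull).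
  lhs 1 (rewrite -sw_scaler).
  by rewrite -sw_scaler (ev_conv c b').2 conv1_bch scalekE; ring.
Qed.

(** The analogue for a form on B, which is to be sigma. *)
Section InflatedFromB.
Variable f : B -> B -> k^o.
Hypothesis hf : bil f.
Definition formB (x y : D) : k^o :=
  ext (fun b c h => (epC c : k) *: (f b (piB (iH h * y)) : k^o)) x.
Lemma formBE b c h y : formB (bch b c h) y = (epC c : k) *: (f b (piB (iH h * y)) : k^o).
Proof. by rewrite /formB extE; lt. Qed.
Lemma formB_bil : bil formB.
Proof.
have [h1 h2] : bil (fun y => ext (fun b c h =>
    (epC c : k) *: (f b (piB (iH h * y)) : k^o))) by apply: ext_bil; lt.
by split.
Qed.
Hint Resolve formB_bil : lin.
Lemma balanced_formB : balanced formB.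
Proof.
split; first exact: formB_bil.
move=> x h y; move: x; apply: (@bch_ext (k^o)) => [||b c h']; lt.
by rewrite bch_iH !formBE rmorphM mulrA.
Qed.
Lemma formB_word b s r c y : formB (jB b * iH s * (iH r * jC c)) y =
  (epC c : k) *: (f b (aB s (aB r (piB y))) : k^o).
Proof.
have -> : jB b * iH s * (iH r * jC c) = jB b * (iH (s * r) * jC c).
  by rewrite rmorphM !mulrA.
rewrite iH_jC sw_mulr (lin_sw _ _ (formB_bil.1 y)).
lhs 1 (rewrite mulrA -/(bch _ _ _) formBE epC_act -scalerA).
rewrite (counitl (f := fun h => epC c *: (f b (piB (iH h * y)) : k^o))); lt.
by rewrite rmorphM -mulrA !piB_iHl.
Qed.
Lemma conv_formB g b c y : bil g -> conv formB g (bch b c 1) y =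
  \sw_(b1, b2 <- dB b) \sw_(r, s <- Rmat Q) \sw_(r', s' <- Rmat_inv Q)
  \sw_(y1, y2 <- DD y) (f b1 (aB s (aB r' (piB y1))) : k) *: g (bch (aB r b2) (aC s' c) 1) y2.
Proof.
move=> hg; rewrite /conv comul_bch; lt.
lhs 2 (rewrite comul1; lt; rewrite rmorph1).
lhs 3 (rewrite mulr1).
rewrite coact_sw; lt; apply: eq_sw => b1 b2; apply: eq_sw => r s.
rewrite coactC_sw; lt.
lhs 3 (rewrite formB_word -scalerA).
lhs 2 (rewrite -sw_scaler).
lhs 1 (rewrite -sw_scaler).
by rewrite (bialg_counitr (bh_bialgebra C) (f := fun c => \sw_(r', s' <- Rmat_inv Q)
  \sw_(y1, y2 <- DD y) (f b1 (aB s (aB r' (piB y1))) : k) *: g (bch (aB r b2) (aC s' c) 1) y2)); lt.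
Qed.
End InflatedFromB.

Lemma formB_inverse (f f' : B -> B -> k^o) : bil f -> bil f' ->
  (forall b b', \sw_(b1, b2 <- dB b) \sw_(b1', b2' <- dB b') \sw_(r, s <- Rmat Q)
     (f b1 (aB s b1') : k) *: f' (aB r b2) b2' = epB b * epB b') ->
  conv (formB f) (formB f') =2 @conv1 k D.
Proof.
move=> hf hf' ff; apply: balanced_eq => [||b c b' c' h'].
- by apply: balanced_conv; apply: balanced_formB.
- exact: balanced_conv1.
have hK := formB_bil hf'.
rewrite conv_formB //.
lhs 4 (rewrite (formBE hf') rmorph1 mul1r epC_act -scalerA scaler_swap).
lhs 3 (rewrite -sw_scaler).
lhs 2 (rewrite (Ri_counitr Q (f := fun r' => \sw_(y1, y2 <- DD (bch b' c' h'))
  (f _ (aB _ (aB r' (piB y1))) : k) *: (epC c *: f' (aB _ _) (piB y2)))); lt).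
lhs 3 (rewrite (bh_actP B).1).
lhs 2 (rewrite (comul_piB (F := fun u x =>
  (f _ (aB _ u) : k) *: (epC c *: f' (aB _ _) (piB x)))); lt).
lhs 3 (rewrite piBE !(linZ (hf'.2 _)) scaler_pull).
lhs 1 (rewrite sw_exch).
lhs 2 (rewrite -sw_scaler).
lhs 1 (rewrite -sw_scaler).
by rewrite -sw_scaler ff conv1_bch !scalekE; ring.
Qed.

Section Jtau.
Variables (ta ta' : {linear (C ⊗ C)%type -> k^o}).
Hypothesis ta_inv : hequivariant (act_tensor aC aC) (@act_unit k H) ta.

(** In the braided square of C with opposite coproduct the R^-1 of the opposite
coproduct and the one of the braiding combine, by a hexagon relation, into an
element that acts diagonally on the arguments of ta; invariance removes it. *)
Lemma cop_conv c c' :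
  \sw_(c1, c2 <- cop c) \sw_(c1', c2' <- cop c')
    \sw_(r, s <- Rmat (flipped Q)) (taf ta c1 (aC s c1') : k) *: taf ta' (aC r c2) c2' =
  \sw_(c1, c2 <- dC c) \sw_(c1', c2' <- cop c')
    (taf ta c2 c1' : k) *: taf ta' c1 c2'.
Proof.
have hf := taf_bil ta; have hf' := taf_bil ta'.
rewrite cop_sw; lt; apply: eq_sw => c1 c2.
rewrite sw_exch; apply: eq_sw => c1' c2'.
lhs 1 (rewrite flip_sw; lt).
rewrite sw_exch.
lhs 2 (rewrite -(bh_actP C).2).
rewrite -(Ri_comull Q (G := fun a1 a2 b =>
  (taf ta (aC a1 c2) (aC a2 c1') : k) *: taf ta' (aC b c1) c2')); lt.
lhs 1 (rewrite -sw_scalel (taf_inv ta_inv) -scalerA).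
rewrite (Ri_counitl Q (f := fun b => (taf ta c2 c1' : k) *: taf ta' (aC b c1) c2')); lt.
by rewrite (bh_actP C).1.
Qed.

Lemma tau_form_inverse :
  (forall c c', \sw_(c1, c2 <- cop c) \sw_(c1', c2' <- cop c')
    \sw_(r, s <- Rmat (flipped Q)) (taf ta c1 (aC s c1') : k) *: taf ta' (aC r c2) c2' =
    epC c * epC c') ->
  conv (formC (taf ta) piC) (formC (taf ta') piC) =2 @conv1 k D.
Proof.
move=> tt.
have hf := taf_bil ta; have hf' := taf_bil ta'.
have hK := formC_bil hf' piCl.
apply: balanced_eq => [||b c b' c' h'].
- by apply: balanced_conv; apply: balanced_formC.
- exact: balanced_conv1.
rewrite (conv_formC hf piCl (taf_inv ta_inv) (fun h x => piC_iHl x h)) //.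
lhs 2 (rewrite (formCE hf' piCl) rmorph1 mul1r scaler_swap).
lhs 1 (rewrite -sw_scaler (comul_piC (F := fun u v => (taf ta _ u : k) *: taf ta' _ v)); lt).
lhs 0 (rewrite -!sw_scaler -cop_conv tt).
by rewrite conv1_bch !scalekE; ring.
Qed.
End Jtau.

Section Decompose.
Variables (sg : {linear (B ⊗ B)%type -> k^o}) (ta : {linear (C ⊗ C)%type -> k^o}).
Hypothesis sg_inv : hequivariant (act_tensor aB aB) (@act_unit k H) sg.
Hypothesis ta_inv : hequivariant (act_tensor aC aC) (@act_unit k H) ta.
Definition sgf (b b' : B) : k^o := sg (b ⊗ b').
Lemma sgf_bil : bil sgf. Proof. rewrite /sgf; lintac. Qed.

Lemma conv_formB_formC b c b' c' h' :
  conv (formB sgf) (formC (taf ta) piC) (bch b c 1) (bch b' c' h') =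
  ep h' *: \sw_(r, s <- Rmat_inv Q) (sgf b (aB r b') : k) *: taf ta (aC s c) c'.
Proof.
have hs := sgf_bil; have hf := taf_bil ta.
have hK3 := formC_bil hf piCl.
rewrite (conv_formB hs _ _ _ hK3).
lhs 4 (rewrite (formCE hf piCl) rmorph1 mul1r epB_act -scalerA scaler_swap).
lhs 2 (lhs 1 (rewrite -sw_scaler); rewrite -sw_scaler; reflexivity).
lhs 1 (rewrite (R_counitl Q (f := fun s => \sw_(r', s' <- Rmat_inv Q)
  \sw_(y1, y2 <- DD (bch b' c' h')) (sgf _ (aB s (aB r' (piB y1))) : k) *:
    (epB _ *: taf ta (aC s' c) (piC y2)))); lt).
lhs 3 (rewrite (bh_actP B).1 scaler_swap).
lhs 1 (lhs 1 (rewrite -sw_scaler); rewrite -sw_scaler; reflexivity).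
rewrite (bialg_counitr (bh_bialgebra B) (f := fun b => \sw_(r', s' <- Rmat_inv Q)
  \sw_(y1, y2 <- DD (bch b' c' h')) (sgf b (aB r' (piB y1)) : k) *:
    taf ta (aC s' c) (piC y2))); lt.
lhs 1 (rewrite (piB_piC (F := fun u v => (sgf b (aB _ u) : k) *: taf ta (aC _ c) v)); lt).
by rewrite -sw_scaler.
Qed.

(** This is the value formula of the theorem: ev consumes b'_(1) and c_(2), and the
R^-1 between sigma and tau comes from the coaction of D on C. *)
Lemma Jform_factor :
  Jform sg ta =2
  conv (formC evf piB) (conv (formB sgf) (formC (taf ta) piC)).
Proof.
have hs := sgf_bil; have hf := taf_bil ta; have hJ := Jform_bil sg ta.
have hformC := formC_bil evfb piBl; have hformB := formB_bil hs; have hK3 := formC_bil hf piCl.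
have hK23 := conv_bil hformB hK3.
apply: balanced_eq => [||b c b' c' h'].
- by split=> // x h y; rewrite /Jform star_iHm.
- apply: balanced_conv; first exact: balanced_formC.
  by apply: balanced_conv; [exact: balanced_formB | exact: balanced_formC].
rewrite (Jform_bch ta sg_inv) rmorph1 mul1r lmulCE piB_iHr (piB_rmulC_cross ta_inv).
rewrite (conv_formC_piB _ _ _ _ _ evfb evf_inv) //.
rhs 2 (rewrite conv_formB_formC scaler_swap).
rhs 1 (rewrite -sw_scaler).
rewrite -sw_scaler tensZr linearZ_LR; congr (_ *: _).
have hl : lin (fun x => sg (b ⊗ x) : k^o) by lintac.
rewrite (lin_sw _ _ hl) sw_exch; apply: eq_sw => b1 b2.
rewrite (lin_sw _ _ hl); apply: eq_sw => c1 c2.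
rewrite (lin_sw _ _ hl) sw_scaler; apply: eq_sw => r s.
by rewrite !(linZ hl); congr (_ *: _); exact: scalerCk.
Qed.
End Decompose.

Lemma Jform_inverse (sg sg' : {linear (B ⊗ B)%type -> k^o})
    (ta ta' : {linear (C ⊗ C)%type -> k^o}) :
  hequivariant (act_tensor aB aB) (@act_unit k H) sg ->
  hequivariant (act_tensor aC aC) (@act_unit k H) ta ->
  hequivariant (act_tensor aC aC) (@act_unit k H) ta' ->
  convolution_inverse (comul2 (braiding Q aB aB) dB)
    (counit2 (bh_counit B)) sg sg' ->
  convolution_inverse (comul2 (inverse_braiding Q aC aC) (cop))
    (counit2 (bh_counit C)) ta ta' ->
  exists2 g, bil g & conv_inverse (Jform sg ta) g.
Proof.
move=> sgi tai tai' ss tt.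
have hs := sgf_bil sg; have hs' := sgf_bil sg'.
have hf := taf_bil ta; have hf' := taf_bil ta'.
have hformC := formC_bil evfb piBl; have hformB := formB_bil hs; have hK3 := formC_bil hf piCl.
have hformB' := formB_bil hs'; have hK3' := formC_bil hf' piCl.
have hES := formC_bil evfS_bil piBl.
have c2 (b b' : B) : counit2 (bh_counit B) (b ⊗ b') = epB b * epB b' :> k^o.
  by rewrite /counit2 (@sw_tens k B B k^o); lt.
have c2' (b b' : C) : counit2 (bh_counit C) (b ⊗ b') = epC b * epC b' :> k^o.
  by rewrite /counit2 (@sw_tens k C C k^o); lt.
exists (conv (conv (formC (taf ta') piC) (formB (sgf sg'))) (formC evfS piB)).
  by do 2 (apply: conv_bil => //).
have E := Jform_factor sgi tai.
have [i1 i2] : conv_inverse (conv (formC evf piB) (conv (formB (sgf sg)) (formC (taf ta) piC)))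
   (conv (conv (formC (taf ta') piC) (formB (sgf sg'))) (formC evfS piB)).
  apply: conv_inverse_conv => //; try exact: conv_bil.
    exact: ev_form_inverse.
  apply: conv_inverse_conv => //; split.
  - apply: formB_inverse => // b b'; rewrite -form_conv; last by lintac.
    by rewrite -c2 -(ss (b ⊗ b')).1.
  - apply: formB_inverse => // b b'; rewrite -form_conv; last by lintac.
    by rewrite -c2 -(ss (b ⊗ b')).2.
  - apply: tau_form_inverse => // c c'; rewrite -form_conv; last by lintac.
    by rewrite -c2' -(tt (c ⊗ c')).1 inverse_braidingE.
  - apply: tau_form_inverse => // c c'; rewrite -form_conv; last by lintac.
    by rewrite -c2' -(tt (c ⊗ c')).2 inverse_braidingE.
split=> x y; [rewrite -(i1 x y) | rewrite -(i2 x y)]; exact: eq_conv.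
Qed.

(** * Coboundaries of the double *)

(** If be and ga relate sigma to sigma' and tau to tau', this cochain relates the two
forms on the double ([Jform_coboundary]). *)
Definition delta (be : B -> k^o) (ga : C -> k^o) : D -> k^o :=
  ext (fun b c h => (be b : k) *: ((ga c : k) *: (ep h : k^o))).

Section Delta.
Variables (be : {linear B -> k^o}) (ga : {linear C -> k^o}).
Hypothesis be_inv : hequivariant aB (@act_unit k H) be.
Hypothesis ga_inv : hequivariant aC (@act_unit k H) ga.
Local Notation dl := (delta be ga).
Lemma be_act h x : be (aB h x) = ep h * (be x : k) :> k. Proof. exact: be_inv. Qed.
Lemma ga_act h x : ga (aC h x) = ep h * (ga x : k) :> k. Proof. exact: ga_inv. Qed.

Lemma deltaE b c h : dl (bch b c h) = (be b : k) *: ((ga c : k) *: (ep h : k^o)).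
Proof. by rewrite /delta extE; lt. Qed.
Lemma delta_lin : lin dl.
Proof. by apply: ext_lin; lt. Qed.
Hint Resolve delta_lin : lin.

Lemma delta_iHr x h : dl (x * iH h) = ep h *: dl x.
Proof.
move: x; apply: (@bch_ext (k^o)) => [||b c h']; lt.
by rewrite bch_iH !deltaE counitM !scalekE; ring.
Qed.
Lemma delta_word b s c h :
  dl (jB b * (iH s * jC c) * iH h) = ep s *: ((be b : k) *: ((ga c : k) *: (ep h : k^o))).
Proof.
rewrite iH_jC sw_mulr sw_mull (lin_sw _ _ delta_lin).
lhs 1 (rewrite delta_iHr mulrA -/(bch _ _ _) deltaE ga_act).
lhs 1 (rewrite -scalerA scaler_front).
rewrite (counitl (f := fun s => ep h *: ((be b : k) *: ((ga c : k) *: (ep s : k^o))))); lt.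
by rewrite !scalekE; ring.
Qed.
Lemma delta_iHl x h : dl (iH h * x) = ep h *: dl x.
Proof.
move: x; apply: (@bch_ext (k^o)) => [||b c h']; lt.
rewrite /bch !mulrA iH_jB 2!sw_mull (lin_sw _ _ delta_lin).
lhs 1 (rewrite -[_ * jC c]mulrA delta_word be_act -scalerA).
lhs 1 (rewrite scaler_swap).
rewrite (counitl (f := fun h => ep h *: ((be b : k) *: ((ga c : k) *: (ep h' : k^o))))); lt.
by rewrite -/(bch _ _ _) deltaE.
Qed.

(** By [gaugeDE] the gauge map of [delta] is the tensor product of those of be and ga, so
that coboundaries of the double can be computed in B and C. *)
Definition gaugeD (x : D) : D := \sw_(x1, x2 <- DD x) (dl x2 : k) *: x1.
Local Notation phB := (gauge dB be).
Local Notation phC := (gauge cop ga).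
Lemma gaugeD_lin : lin gaugeD. Proof. rewrite /gaugeD; lintac. Qed.
Lemma gaugeDE b c h : gaugeD (bch b c h) = bch (phB b) (phC c) h.
Proof.
rewrite /gaugeD comul_bch; lt.
rewrite /bch (j_gauge Q dB iH jB be_inv) (j_gauge (flipped Q) cop iH jC ga_inv).
rewrite !sw_mull; apply: eq_sw => d b'.
rewrite sw_mulr sw_mull; apply: eq_sw => d' c'.
lhs 1 (rewrite -/(bch _ _ _) deltaE -!scalerA scaler_front).
rewrite (counitr (f := fun h => (be b' : k) *: ((ga c' : k) *: (d * d' * iH h)))); lt.
by rewrite -scalerAl -scalerAr -!scalerAl.
Qed.
Lemma gaugeD_iHr x h : gaugeD (x * iH h) = gaugeD x * iH h.
Proof.
rewrite /gaugeD comulM; lt; rewrite sw_mull; apply: eq_sw => x1 x2.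
rewrite (comul_iH_sw fB); lt.
lhs 1 (rewrite delta_iHr -scalerA).
rewrite (counitr (f := fun h => (dl x2 : k) *: (x1 * iH h))); lt.
by rewrite scalerAl.
Qed.
Lemma gaugeD_iHl x h : gaugeD (iH h * x) = iH h * gaugeD x.
Proof.
rewrite /gaugeD comulM; lt; rewrite sw_mulr (comul_iH_sw fB); lt.
rewrite sw_exch; apply: eq_sw => x1 x2.
lhs 1 (rewrite delta_iHl -scalerA).
rewrite (counitr (f := fun h => (dl x2 : k) *: (iH h * x1))); lt.
by rewrite scalerAr.
Qed.

Lemma comul_phB X (F : B -> B -> X) b : bil F ->
  \sw_(b1, b2 <- dB (phB b)) F b1 b2 = \sw_(b1, b2 <- dB b) F b1 (phB b2).
Proof.
move=> hF; rewrite /gauge sw_linear sw_sw //.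
lhs 1 (rewrite linearZ_LR sw_scale; lt; rewrite sw_scaler).
rewrite (bialg_comulA (bh_bialgebra B) (F := fun x y z => (be z : k) *: F x y)); lt.
apply: eq_sw => b1 b2; rewrite (lin_sw _ _ (hF.2 _)).
by apply: eq_sw => b3 b4; rewrite (linZ (hF.2 _)).
Qed.
(** For the opposite coproduct the cochain meets the first leg of the coproduct of C,
and the R^-1 drops out as ga is invariant. *)
Lemma phCE c : phC c = \sw_(c1, c2 <- dC c) (ga c1 : k) *: c2.
Proof.
rewrite /gauge cop_sw; lt; apply: eq_sw => c1 c2.
lhs 1 (rewrite ga_act -scalerA).
rewrite (Ri_counitr Q (f := fun r => (ga c1 : k) *: aC r c2)); lt.
by rewrite (bh_actP C).1.
Qed.
Lemma comul_phC X (F : C -> C -> X) c : bil F ->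
  \sw_(c1, c2 <- dC (phC c)) F c1 c2 = \sw_(c1, c2 <- dC c) F (phC c1) c2.
Proof.
move=> hF; rewrite phCE sw_linear sw_sw //.
lhs 1 (rewrite linearZ_LR sw_scale; lt; rewrite sw_scaler).
rewrite -(bialg_comulA (bh_bialgebra C) (F := fun x y z => (ga x : k) *: F y z)); lt.
apply: eq_sw => c1 c2; rewrite phCE (lin_sw _ _ (hF.1 _)).
by apply: eq_sw => c3 c4; rewrite (linZ (hF.1 _)).
Qed.
End Delta.

Lemma delta_conv (be be' : {linear B -> k^o}) (ga ga' : {linear C -> k^o}) x :
  hequivariant aB (@act_unit k H) be' -> hequivariant aC (@act_unit k H) ga' ->
  (forall b, \sw_(b1, b2 <- dB b) be b1 * be' b2 = (epB b : k^o)) ->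
  (forall c, \sw_(c1, c2 <- cop c) ga c1 * ga' c2 = (epC c : k^o)) ->
  \sw_(x1, x2 <- DD x) (delta be ga x1 : k) *: delta be' ga' x2 = epD x :> k^o.
Proof.
move=> bi gi bb gg; have dl := delta_lin be ga; have pl := gaugeD_lin be' ga'.
transitivity (delta be ga (gaugeD be' ga' x)).
  rewrite /gaugeD (lin_sw _ _ dl); apply: eq_sw => x1 x2.
  by rewrite (linZ dl) scalerCk.
move: x; apply: (@bch_ext (k^o)) => [||b c h]; lt.
rewrite gaugeDE // deltaE counit_bch -bb -gg /gauge !sw_linear.
rewrite -mulrA [RHS]/((_ : k) *: ((_ : k) *: (_ : k^o))).
congr (_ *: (_ *: _)); apply: eq_sw => u v; rewrite linearZ_LR; exact: mulrC.
Qed.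

Section Gauge.
Variables (sg sg' : {linear (B ⊗ B)%type -> k^o}) (ta ta' : {linear (C ⊗ C)%type -> k^o}).
Variables (be be' : {linear B -> k^o}) (ga ga' : {linear C -> k^o}).
Hypothesis be_inv : hequivariant aB (@act_unit k H) be.
Hypothesis be'_inv : hequivariant aB (@act_unit k H) be'.
Hypothesis ga_inv : hequivariant aC (@act_unit k H) ga.
Hypothesis ga'_inv : hequivariant aC (@act_unit k H) ga'.
Hypothesis bb : convolution_inverse dB (bh_counit B) be be'.
Hypothesis gg : convolution_inverse cop (bh_counit C) ga ga'.
Hypothesis sg_inv : hequivariant (act_tensor aB aB) (@act_unit k H) sg.
Hypothesis sg'_inv : hequivariant (act_tensor aB aB) (@act_unit k H) sg'.
Hypothesis ta_inv : hequivariant (act_tensor aC aC) (@act_unit k H) ta.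
Hypothesis ta'_inv : hequivariant (act_tensor aC aC) (@act_unit k H) ta'.
Hypothesis sg'E : forall x y, sg' (x ⊗ y) = coboundary Q aB dB be be' sg x y.
Hypothesis ta'E : forall x y, ta' (x ⊗ y) = coboundary (flipped Q) aC cop ga ga' ta x y.
Local Notation dl := (delta be ga).
Local Notation star2 := (star sg' ta').
Local Notation J1 := (Jform sg ta).
Local Notation phB := (gauge dB be).
Local Notation phC := (gauge cop ga).
Local Notation phD := (gaugeD be ga).

(** The gauge map of B touches only the second leg of the coproduct of B, that of C only
the first leg of the coproduct of C, so neither meets ev, which pairs c_(2) with b_(1).
What remains is [gauge_twmul] in B and in C. *)
Lemma delta_star x y : dl (star2 x y) = J1 (phD x) (phD y).
Proof.
have dll := delta_lin be ga; have pl := gaugeD_lin be ga.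
have s2 := star_bil sg' ta'; have hJ := Jform_bil sg ta.
have hL := lmulB_bil sg'; have hR := rmulC_bil ta'.
have hb := gauge_lin fB be; have hc := gauge_lin fC ga.
have hf := taf_bil ta; have he := evf_bil.
have hs b : lin (fun x : B => sg (phB b ⊗ x) : k^o) by lintac.
pose F1 x y := dl (star2 x y); pose F2 x y := J1 (phD x) (phD y).
suff : F1 =2 F2 by apply.
apply: balanced_eq => [||b c b' c' h'].
- split; first by rewrite /F1; lintac.
  by move=> u h v; rewrite /F1 star_iHm.
- split; first by rewrite /F2; lintac.
  by move=> u h v; rewrite /F2 gaugeD_iHr gaugeD_iHl // /Jform star_iHm.
rewrite /F1 /F2 !gaugeDE // (Jform_bch ta sg_inv) rmorph1 mul1r lmulCE.
rewrite piB_iHr (piB_rmulC_cross ta_inv).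
rewrite starE rmorph1 mul1r lmulCE lmulB_iH delta_iHr // tensZr linearZ_LR; congr (_ *: _).
rewrite cross_bch (lin_sw _ _ (hR.2 _)) (lin_sw _ _ (hL.2 _)) (lin_sw _ _ dll).
rewrite comul_phB; last by lintac.
rewrite (lin_sw _ _ (hs _)); apply: eq_sw => b1 b2.
rewrite (lin_sw _ _ (hR.2 _)) (lin_sw _ _ (hL.2 _)) (lin_sw _ _ dll).
rewrite (comul_phC ga_inv); last by lintac.
rewrite (lin_sw _ _ (hs _)); apply: eq_sw => c1 c2.
rewrite (lin_sw _ _ (hR.2 _)) (lin_sw _ _ (hL.2 _)) (lin_sw _ _ dll).
rewrite (lin_sw _ _ (hs _)); apply: eq_sw => r s.
rewrite (linZ (hR.2 _)) (linZ (hL.2 _)) (linZ dll) !(linZ (hs _)); congr (_ *: _).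
rewrite rmulC_bc lmulBE deltaE counit1.
rewrite (gauge_twmul fB be_inv be'_inv bb sg_inv sg'_inv sg'E).
rewrite (gauge_twmul fC ga_inv ga'_inv gg ta_inv ta'_inv ta'E).
rewrite (act_gauge fB be_inv) (act_gauge fC ga_inv) -/(taf _ _ _) !scalekE mulr1 mulrC.
by [].
Qed.

Local Notation J2 := (Jform sg' ta').
Local Notation dl' := (delta be' ga').

(** The counit of the new product x * y is (delta' * delta)(x * y); the product is
colinear, so this is delta' on x_(1) y_(1) times delta on the product of x_(2) and
y_(2), to which [delta_star] applies. *)
Lemma Jform_coboundary x y : J2 x y =
  \sw_(x1, x2 <- DD x) \sw_(y1, y2 <- DD y)
  \sw_(x11, x12 <- DD x1) \sw_(y11, y12 <- DD y1)
    (dl' (x11 * y11) : k) *: ((dl x2 : k) *: ((dl y2 : k) *: J1 x12 y12)).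
Proof.
have dll := delta_lin be ga; have dll' := delta_lin be' ga'.
have s2 := star_bil sg' ta'; have hJ := Jform_bil sg ta.
rewrite {1}/Jform -(delta_conv _ be_inv ga_inv (fun b => (bb b).2) (fun c => (gg c).2)).
rewrite (comul_star sg'_inv ta'_inv); lt.
lhs 2 (rewrite delta_star).
rhs 1 (rewrite sw_exch).
rewrite (comulA (F := fun x1 x2 x3 => \sw_(y1, y2 <- DD y) \sw_(y11, y12 <- DD y1)
  (dl' (x1 * y11) : k) *: ((dl x3 : k) *: ((dl y2 : k) *: J1 x2 y12)))); lt.
apply: eq_sw => x1 x2.
rhs 1 (rewrite (comulA (F := fun y1 y2 y3 =>
  (dl' (x1 * y1) : k) *: ((dl _ : k) *: ((dl y3 : k) *: J1 _ y2)))); lt).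
rewrite [RHS]sw_exch; apply: eq_sw => y1 y2.
rewrite {1}/gaugeD (lin_sw _ _ (hJ.1 _)) sw_scaler; apply: eq_sw => x3 x4.
rewrite (linZ (hJ.1 _)) /gaugeD (lin_sw _ _ (hJ.2 _)) !sw_scaler; apply: eq_sw => y3 y4.
by rewrite (linZ (hJ.2 _)).
Qed.
End Gauge.
End DrinfeldDouble.

(** * The map on second cohomology *)

Section Reflexivity.
Variables (k : fieldType) (H : hopfAlg k) (Q : quasitriangular H).
Variables (C B : braidedHopfAlg Q) (e : weakly_dual C B) (D : drinfeld_double e).

Lemma cohomologous_refl_HMod (s : C2 (in_HMod B)) : cohomologous s s.
Proof.
have bi : hequivariant (bh_act B) (@act_unit k H) (bh_counit B) := @bh_counit_equiv _ _ _ B.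
exists (bh_counit B), (bh_counit B); split=> //.
- exact: (counit_inverse (factorB D)).
- exact: (counit_one (bh_bialgebra B)).
move=> x y; symmetry.
by apply: (coboundary_counit (factorB D)) => //; exact: (cocycle_hom (proj2_sig s)).
Qed.

Lemma cohomologous_refl_cop (t : C2 (cop_in_HMod_bar C)) : cohomologous t t.
Proof.
have ci : hequivariant (bh_act C) (@act_unit k H) (bh_counit C) := @bh_counit_equiv _ _ _ C.
exists (bh_counit C), (bh_counit C); split=> //.
- exact: (counit_inverse (factorC D)).
- exact: (counit_one (bh_bialgebra C)).
move=> x y; symmetry; rewrite /= inverse_braidingE.
by apply: (coboundary_counit (factorC D)) => //; exact: (cocycle_hom (proj2_sig t)).
Qed.
End Reflexivity.

Section CompositeCocycle.
Variables (k : fieldType) (H : hopfAlg k) (Q : quasitriangular H).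
Variables (C B : braidedHopfAlg Q) (e : weakly_dual C B) (D : drinfeld_double e).
Section Product.
Variables (s : C2 (in_HMod B)) (t : C2 (cop_in_HMod_bar C)).

Let s_inv : hequivariant (act_tensor (bh_act B) (bh_act B)) (@act_unit k H) s :=
  cocycle_hom (proj2_sig s).
Let t_inv : hequivariant (act_tensor (bh_act C) (bh_act C)) (@act_unit k H) t :=
  cocycle_hom (proj2_sig t).
Let s1l : forall x : B, s (1 ⊗ x) = bh_counit B x := cocycle_one_left (proj2_sig s).
Let s1r : forall x : B, s (x ⊗ 1) = bh_counit B x := cocycle_one_right (proj2_sig s).
Let t1l : forall x : C, t (1 ⊗ x) = bh_counit C x := cocycle_one_left (proj2_sig t).
Let t1r : forall x : C, t (x ⊗ 1) = bh_counit C x := cocycle_one_right (proj2_sig t).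
Let s_coc (x y z : B) : s (x ⊗ twmul Q (bh_act B) (bh_comul B) s y z) =
  s (twmul Q (bh_act B) (bh_comul B) s x y ⊗ z).
Proof. exact: cocycle_twist (cocycle_eq (proj2_sig s) x y z). Qed.
Let t_coc (x y z : C) :
  t (x ⊗ twmul (flipped Q) (bh_act C) (@cop_comul k H Q C) t y z) =
  t (twmul (flipped Q) (bh_act C) (@cop_comul k H Q C) t x y ⊗ z).
Proof.
by apply: cocycle_twist; rewrite -inverse_braidingE; exact: (cocycle_eq (proj2_sig t)).
Qed.

Definition circ_form : {linear (D ⊗ D)%type -> k^o} :=
  tensor_form (Jform_bil D (cocycle_form s) (cocycle_form t)).

Lemma circ_formE x y : circ_form (x ⊗ y) = Jform (D := D) s t x y.
Proof. exact: tensor_formE. Qed.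

Lemma circ_cocycle : is_right_cocycle (E := in_Vect D) circ_form.
Proof.
apply: right_cocycle_of_form.
- have [s' [_ ss']] := cocycle_invertible (proj2_sig s).
  have [t' [t'_inv tt']] := cocycle_invertible (proj2_sig t).
  exact: (Jform_inverse D s_inv t_inv t'_inv ss' tt').
- exact: Jform_cocycle.
- exact: Jform1l.
- exact: Jform1r.
Qed.

Definition circ : C2 (in_Vect D) := exist _ circ_form circ_cocycle.

Lemma circE (x y : D) : circ (x ⊗ y) = Jform (D := D) s t x y.
Proof. exact: circ_formE. Qed.

Lemma circ_BB (b b' : B) : circ (drin_B D b ⊗ drin_B D b') = s (b ⊗ b').
Proof. by rewrite circE Jform_BB. Qed.
Lemma circ_CC (c c' : C) : circ (drin_C D c ⊗ drin_C D c') = t (c ⊗ c').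
Proof. by rewrite circE Jform_CC. Qed.
Lemma circ_HH (h h' : H) :
  circ (drin_H D h ⊗ drin_H D h') = hopf_counit H (h * h').
Proof. by rewrite circE Jform_HH. Qed.
Lemma circ_bhc (b b' : B) (h h' : H) (c c' : C) :
  circ ((drin_B D b * drin_H D h * drin_C D c) ⊗
        (drin_B D b' * drin_H D h' * drin_C D c')) =
  \sw_(b'1, b'2 <- bh_comul B b') \sw_(c1, c2 <- bh_comul C c)
  \sw_(r, s0 <- Rmat_inv Q)
    s (b ⊗ bh_act B (h * r) b'2) * ev e (c2 ⊗ b'1) *
    t (bh_act C s0 c1 ⊗ bh_act C h' c').
Proof. by rewrite circE JformE. Qed.
End Product.

Lemma circ_cohomologous s s' t t' :
  cohomologous s s' -> cohomologous t t' -> cohomologous (circ s t) (circ s' t').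
Proof.
move=> [be [be' [be_inv be'_inv bb be1 sE]]] [ga [ga' [ga_inv ga'_inv gg ga1 tE]]].
have s_inv := cocycle_hom (proj2_sig s); have s'_inv := cocycle_hom (proj2_sig s').
have t_inv := cocycle_hom (proj2_sig t); have t'_inv := cocycle_hom (proj2_sig t').
have dl := delta_lin (D := D) be ga; have dl' := delta_lin (D := D) be' ga'.
exists (linmap dl), (linmap dl'); split=> //.
- move=> x; split.
  + exact: (delta_conv x be'_inv ga'_inv (fun b => (bb b).1) (fun c => (gg c).1)).
  + exact: (delta_conv x be_inv ga_inv (fun b => (bb b).2) (fun c => (gg c).2)).
- have -> : 1 = bch D 1 1 1 by rewrite /bch !rmorph1 !mulr1.
  by rewrite /= deltaE be1 ga1 counit1 !scale1r.
move=> x y; rewrite circE.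
rewrite (Jform_coboundary be_inv be'_inv ga_inv ga'_inv bb gg
  s_inv s'_inv t_inv t'_inv); first last.
- by move=> u v; rewrite tE /coboundary -inverse_braidingE.
- exact: sE.
apply: eq_sw => x1 x2; apply: eq_sw => y1 y2; apply: eq_sw => x11 x12; apply: eq_sw => y11 y12.
rewrite (@flip_sw k D D k^o); lt; rewrite (@sw_tens k D D k^o); lt.
have A (a b c d : k) : a * (b * (c * d)) = a * d * b * c by ring.
by rewrite circE; exact: A.
Qed.

End CompositeCocycle.

Theorem theorem4p18 (k : fieldType) (H : hopfAlg k) (Q : quasitriangular H)
    (C B : braidedHopfAlg Q) (e : weakly_dual C B) (D : drinfeld_double e) :
  exists circ : C2 (in_HMod B) -> C2 (cop_in_HMod_bar C) -> C2 (in_Vect D),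
    [/\ forall (sigma : C2 (in_HMod B)) (tau : C2 (cop_in_HMod_bar C)),
          [/\ forall b b' : B,
                circ sigma tau (drin_B D b ⊗ drin_B D b') = sigma (b ⊗ b'),
              forall c c' : C,
                circ sigma tau (drin_C D c ⊗ drin_C D c') = tau (c ⊗ c'),
              forall h h' : H,
                circ sigma tau (drin_H D h ⊗ drin_H D h') =
                hopf_counit H (h * h') &
              forall (b b' : B) (h h' : H) (c c' : C),
                circ sigma tau
                  ((drin_B D b * drin_H D h * drin_C D c) ⊗
                   (drin_B D b' * drin_H D h' * drin_C D c')) =
                \sw_(b'1, b'2 <- bh_comul B b') \sw_(c1, c2 <- bh_comul C c)
                \sw_(r, s <- Rmat_inv Q)
                  sigma (b ⊗ bh_act B (h * r) b'2) * ev e (c2 ⊗ b'1) *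
                  tau (bh_act C s c1 ⊗ bh_act C h' c')],
        forall (sigma sigma' : C2 (in_HMod B))
               (tau tau' : C2 (cop_in_HMod_bar C)),
          cohomologous sigma sigma' -> cohomologous tau tau' ->
          cohomologous (circ sigma tau) (circ sigma' tau') &
        exists circH : H2 (in_HMod B) -> H2 (cop_in_HMod_bar C) ->
                       H2 (in_Vect D),
          forall (sigma : C2 (in_HMod B)) (tau : C2 (cop_in_HMod_bar C)),
            circH (coh_class sigma) (coh_class tau) =
            coh_class (circ sigma tau)].
Proof.
exists (circ D); split.
- move=> s t; split; [exact: circ_BB | exact: circ_CC | exact: circ_HH | exact: circ_bhc].
- exact: circ_cohomologous.
exists (fun P T => coh_class (circ D (coh_rep P) (coh_rep T))) => s t.
have sP := coh_repP s (cohomologous_refl_HMod D).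
have tP := coh_repP t (cohomologous_refl_cop D).
apply: (coh_class_eq (@cohomologous_trans _ _)).
- exact: circ_cohomologous sP.1 tP.1.
- exact: circ_cohomologous sP.2 tP.2.
Qed.
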